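(* Suppose that $w_\rho(s), u^t(s), w(s)$, functions on $C$ of the arc-length $s$, are solutions to the equations \begin{align*} &(w_\rho (u^t)^2)'+3w_\rho u^t w=\rho_0(u_0,\mathbf n)(u_0,\mathbf t),\\ &(w_\rho u^t w)'-w_\rho (u^t)^2+2w_\rho w^2=\rho_0 w_0(u_0,\mathbf n),\\ &(w_\rho u^t)'+2w_\rho w=\rho_0(u_0,\mathbf n), \end{align*} where $'=\mathrm d/\mathrm ds$ and $u_0,w_0$ are evaluated on $C$. Then Problem A admits a Radon measure solution given by $$\varrho=\rho_0\mathbb I_\Omega\,\mathrm d\mathcal H^2+w_\rho(s)\delta_C,\quad u=u_0\mathbb I_\Omega+u^t(s)\mathbf t\,\mathbb I_C,\quad w=w_0\mathbb I_\Omega+w(s)\mathbb I_C,\quad E=E_0\mathbb I_\Omega+E_0\mathbb I_C,$$ provided that $$W_C=w_\rho (u^t)^2(\mathbf t,\mathrm D_{\mathbf t}\mathbf n)+\rho_0(u_0,\mathbf n)^2+\tilde p(\rho_0,E_0)>0.$$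
   Context: **Geometry.** On $\mathbb R^3$ use $x^1=r\cos\theta$, $x^2=r\sin\theta\cos\phi$, $x^3=r\sin\theta\sin\phi$, with $\theta\in[0,\pi]$, $\phi\in[-\pi,\pi]$, and $\vec{\partial_r}=\partial x/\partial r$. An infinite straight cone with vertex $O$, symmetric about the $x^1$-axis, has semi-vertex angle $\theta_0\in(0,\pi/2)$; it meets the unit sphere $S^2$ in $Con=\{\theta\le\theta_0\}$. Let $\Omega=S^2\setminus Con$ and $C=\partial\Omega=\{\theta=\theta_0\}$, a circle of length $L=2\pi\sin\theta_0$ with arc-length parameter $s\in[0,L]$. On $C$, $\mathbf t(s)$ is the unit tangent vector in the direction of increasing $s$, and $\mathbf n(s)$ is the unit normal, tangent to $S^2$, pointing out of $\Omega$. $(\cdot,\cdot)$, $\mathrm D$, $\nabla=\mathrm{grad}$, $\mathrm{div}$ are the metric, Levi-Civita connection, gradient and divergence of $S^2$; $\mathcal H^2$ is the standard Hausdorff measure on $S^2$; $\mathbb I_A$ is the indicator function of $A$. **Upcoming flow.** $\rho_0=1$, $E_0\ge\frac12$ constant, and $V_0\in S^2$ the constant unit velocity with attack angle $\alpha_0$, $V_0=(\cos\alpha_0,\sin\alpha_0,0)$. Restricted to $S^2$, $V_0=u_0+w_0\vec{\partial_r}$ with $u_0$ tangent to $S^2$ and $w_0=(V_0,\vec{\partial_r})$. The state equation of the gas is $p=\tilde p(\rho,E)$, and the upstream pressure is $p_0=\tilde p(\rho_0,E_0)$. **Problem A.** Find a solution (density $\rho$, tangential velocity $u$, radial velocity $w$,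 total enthalpy $E$ per unit mass) on $\Omega$ of $$\mathrm{div}(\rho u)+2\rho w=0,\quad \mathrm{div}(\rho uE)+2\rho wE=0,\quad \mathrm{div}(\rho wu)+2\rho w^2-\rho|u|^2=0,\quad \mathrm{div}(\rho u\otimes u)+3\rho wu+\mathrm{grad}\,p=0,$$ with the upcoming flow $(\rho_0,V_0,E_0)$ and upstream pressure $p_0$ above, and the slip condition $(u,\mathbf n)=0$ on $C$. **Dirac measure.** For integrable $W$ on $C$, $\langle W\delta_C,\psi\rangle=\int_0^L W(s)\,\psi|_C\,\mathrm ds$. **Radon measure solution.** Let $m_a,n_a,m_e,n_e,m_r,n_r,m_t,n_t,\varrho,\wp$ be Radon measures on $\overline\Omega$ (scalar-, vector- or tensor-valued as appropriate), and $W_C(s)$ a positive integrable function for $s\in[0,L]$. Suppose that: (i) for every $\psi\in C^1(S^2)$ and every $C^1$ vector field $v$ on $S^2$, $$\langle m_a,\nabla\psi\rangle=2\langle n_a,\psi\rangle,\quad \langle m_e,\nabla\psi\rangle=2\langle n_e,\psi\rangle,\quad \langle m_r,\nabla\psi\rangle=2\langle n_r,\psi\rangle-\langle n_t,\psi\rangle,$$ $$\langle m_t,\mathrm Dv\rangle+\langle\wp,\mathrm{div}\,v\rangle=3\langle m_r,v\rangle+\langle W_C\mathbf n\,\delta_C,v\rangle;$$ (ii) $\varrho,\wp$ are non-negative measures; $m_a,m_r,m_e,n_e,m_t,n_a,n_r,n_t,\wp$ are absolutely continuous with respect to $\varrho$; and there exist $\varrho$-a.e. functions $w,E$ and a vector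 field $u$ such that the Radon-Nikodym derivatives satisfy $$w=\frac{\mathrm dm_r/\mathrm d\varrho}{\mathrm dm_a/\mathrm d\varrho}=\frac{\mathrm dn_r/\mathrm d\varrho}{\mathrm dn_a/\mathrm d\varrho}=\frac{\mathrm dn_a}{\mathrm d\varrho},\quad E=\frac{\mathrm dm_e/\mathrm d\varrho}{\mathrm dm_a/\mathrm d\varrho}=\frac{\mathrm dn_e/\mathrm d\varrho}{\mathrm dn_a/\mathrm d\varrho},\quad u=\frac{\mathrm dm_a}{\mathrm d\varrho},\ |u|^2=\frac{\mathrm dn_t}{\mathrm d\varrho},\ u\otimes u=\frac{\mathrm dm_t}{\mathrm d\varrho},$$ where a quotient identity $a=b/c$ is read as $b=ac$; (iii) if $\varrho,\wp\ll\mathcal H^2$, with $\rho=\mathrm d\varrho/\mathrm d\mathcal H^2$, $p=\mathrm d\wp/\mathrm d\mathcal H^2$, then the state equation holds $\mathcal H^2$-a.e., and the classical entropy condition is valid for discontinuities of the functions $\rho,u,w,E$ in this case. Then $(\varrho,u,w,E)$ is called a Radon measure solution to Problem A. In the solutions constructed here, $\wp=\tilde p(\rho_0,E_0)\,\mathrm d\mathcal H^2$ and $W_C$ is the weight in (i).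
   Formalization: The formal theorem also assumes w_ρ ≥ 0 and upstream pressure p̃(ρ_0,E_0) ≥ 0, needed for ϱ and ℘ to be non-negative measures as the definition demands; ''solutions'' are read as continuous periodic functions satisfying the equations pointwise. *)

(* Defs.v *)
From HB Require Import structures.
From mathcomp Require Import all_boot all_order all_algebra.
From mathcomp Require Import all_classical all_reals all_analysis.
From mathcomp Require Import ring lra.

Set Implicit Arguments.
Unset Strict Implicit.
Unset Printing Implicit Defensive.

Import Order.TTheory GRing.Theory Num.Theory.
Import numFieldNormedType.Exports.

Local Open Scope classical_set_scope.
Local Open Scope ring_scope.

(* Borel sigma-algebra of R^n *)
HB.instance Definition _ (R : realType) (n : nat) :=
  @isMeasurable.Build (sigma_display (@open 'rV[R]_n)) 'rV[R]_n <<s open >>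
    (@sigma_algebra0 _ setT _) (@sigma_algebraC _ _)
    (@sigma_algebra_bigcup _ setT _).

Section euclidean.
Context {R : realType}.
Notation V := 'rV[R]_3.
Implicit Types u v x y : V.

Definition row3 (a b c : R) : V := \row_(i < 3) nth 0 [:: a; b; c] i.

Definition dotp u v : R := \sum_(i < 3) u 0 i * v 0 i.

(* The library's norm `|x| on 'rV[R]_3 is the sup norm. *)
Definition enorm u : R := Num.sqrt (dotp u u).

Lemma dotpE u v : dotp u v = u 0 0 * v 0 0 + u 0 1 * v 0 1 + u 0 2%:R * v 0 2%:R.
Proof.
rewrite /dotp !big_ord_recr big_ord0 /= add0r.
by congr (_ * _ + _ * _ + _ * _); congr (_ _ _); apply/val_inj.
Qed.

Lemma enorm_ge0 u : 0 <= enorm u. Proof. exact: sqrtr_ge0. Qed.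

Lemma dotpp_ge0 u : 0 <= dotp u u.
Proof. by rewrite /dotp; apply: sumr_ge0 => i _; rewrite -expr2 sqr_ge0. Qed.

Lemma ler_enormD u v : enorm (u + v) <= enorm u + enorm v.
Proof.
have h : dotp u v <= enorm u * enorm v.
  rewrite /enorm -sqrtrM ?dotpp_ge0//.
  apply: le_trans (ler_norm _) _; rewrite -sqrtr_sqr ler_wsqrtr//.
  rewrite !dotpE.
  set a := u 0 0; set b := u 0 1; set c := u 0 _.
  set d := v 0 0; set e := v 0 1; set f := v 0 _.
  have h1 := sqr_ge0 (a * e - b * d).
  have h2 := sqr_ge0 (a * f - c * d).
  have h3 := sqr_ge0 (b * f - c * e).
  by nra.
rewrite -[leLHS]ger0_norm ?enorm_ge0//.
rewrite -[leRHS]ger0_norm ?addr_ge0 ?enorm_ge0//.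
rewrite -ler_sqr ?nnegrE ?normr_ge0// !real_normK ?num_real//.
rewrite sqrrD !sqr_sqrtr ?dotpp_ge0// [X in X <= _](_ : _ =
  dotp u u + dotp v v + dotp u v *+ 2); last first.
  by rewrite !dotpE !mxE; ring.
by rewrite -/(enorm u) -/(enorm v); lra.
Qed.

Lemma enormN u : enorm (- u) = enorm u.
Proof. by rewrite /enorm !dotpE !mxE; congr (Num.sqrt _); ring. Qed.

Lemma enormB u v : enorm (u - v) = enorm (v - u).
Proof. by rewrite -enormN opprB. Qed.

Lemma ler_enormB u v w : enorm (u - w) <= enorm (u - v) + enorm (v - w).
Proof. by rewrite -[u - w](subrKA v) ler_enormD. Qed.

Lemma enorm_small (F : set V) x : closed F -> ~ F x ->
  exists n : nat, forall y, F y -> n.+1%:R^-1 <= enorm (x - y).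
Proof.
move=> cF nFx.
have : open (~` F) by exact: closed_openC.
rewrite openE => /(_ x nFx); rewrite /interior => /nbhs_ballP[e /= e0 eF].
exists (Num.truncn e^-1) => y Fy; rewrite leNgt; apply/negP => xy.
apply: (eF y) => //.
rewrite -ball_normE /ball_/=.
have lee : (Num.truncn e^-1).+1%:R^-1 <= e.
  rewrite -[leRHS]invrK lef_pV2 ?posrE ?invr_gt0//.
  by rewrite ltW// truncnS_gt.
change (mx_norm (x - y) < e); rewrite mx_normrE; apply: bigmax_lt => //= -[i j] _ /=.
apply: lt_le_trans lee; apply: le_lt_trans xy.
rewrite ord1 -sqrtr_sqr /enorm ler_wsqrtr// /dotp (bigD1 j)//= -expr2 lerDl.
by apply: sumr_ge0 => k _; rewrite -expr2 sqr_ge0.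
Qed.

End euclidean.

Section hausdorff.
Context {R : realType}.
Notation V := 'rV[R]_3.
Implicit Types A B U : set V.
Local Open Scope ereal_scope.

Definition ediam U : \bar R :=
  ereal_sup (0 |` [set (enorm (p.1 - p.2)%R)%:E | p in U `*` U]).

Definition diam_cover (d : R) A : set (nat -> set V) :=
  [set U | A `<=` \bigcup_i U i /\ forall i, ediam (U i) <= d%:E].

(* pi / 4 * diam^2 is the area of a disc of diameter diam. *)
Definition disc_area U : \bar R := (pi / 4)%:E * ediam U ^+ 2.

Definition hausdorff_delta (d : R) A : \bar R :=
  ereal_inf [set \sum_(i <oo) disc_area (U i) | U in diam_cover d A].

Definition hausdorff2 A : \bar R :=
  ereal_sup [set hausdorff_delta d A | d in [set d : R | (0 < d)%R]].

Lemma ediam_ge0 U : 0 <= ediam U.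
Proof. by apply: ereal_sup_ubound; left. Qed.

Lemma ediam0 : ediam set0 = 0.
Proof.
apply/eqP; rewrite eq_le ediam_ge0 andbT; apply: ge_ereal_sup => x [->//|].
by case=> p [].
Qed.

Lemma disc_area_ge0 U : 0 <= disc_area U.
Proof.
by rewrite mule_ge0 ?lee_fin ?divr_ge0 ?pi_ge0// expe_ge0// ediam_ge0.
Qed.

Lemma disc_area0 : disc_area set0 = 0.
Proof. by rewrite /disc_area ediam0 expe2 mul0e mule0. Qed.

Lemma hausdorff_delta_ge0 d A : 0 <= hausdorff_delta d A.
Proof.
apply: le_ereal_inf_tmp => _ [U _ <-].
by apply: nneseries_ge0 => n _ _; exact: disc_area_ge0.
Qed.

Lemma hausdorff_delta_le d A : (0 < d)%R -> hausdorff_delta d A <= hausdorff2 A.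
Proof. by move=> d0; apply: ereal_sup_ubound; exists d. Qed.

Lemma hausdorff_delta_anti d d' A : (d <= d')%R ->
  hausdorff_delta d' A <= hausdorff_delta d A.
Proof.
move=> dd'; apply: ereal_inf_le_tmp => _ [U [AU Ud] <-]; exists U => //.
by split=> // i; rewrite (le_trans (Ud i))// lee_fin.
Qed.

Let allT := g_sigma_algebraType (@setT (set V)).

Let cut_area (d : R) (U : set allT) : \bar R :=
  if ediam U <= d%:E then disc_area U else +oo.

Let cut_area0 d : (0 < d)%R -> cut_area d set0 = 0.
Proof. by move=> d0; rewrite /cut_area ediam0 lee_fin ltW// disc_area0. Qed.

Let cut_area_ge0 d U : 0 <= cut_area d U.
Proof. by rewrite /cut_area; case: ifP => // _; exact: disc_area_ge0. Qed.

Let hausdorff_deltaE d A : hausdorff_delta d A = mu_ext (cut_area d) A.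
Proof.
apply/eqP; rewrite eq_le; apply/andP; split.
  apply: le_ereal_inf_tmp => _ [U [mU AU] <-].
  have [Ud|] := pselect (forall i, ediam (U i) <= d%:E).
    apply: ereal_inf_lbound; exists U => //.
    by apply: eq_eseriesr => i _; rewrite /cut_area Ud.
  move=> /existsNP[i /negP Ui].
  rewrite (@eseries_pinfty _ _ xpredT i) ?leey//.
    by move=> n _; rewrite gt_eqF// (lt_le_trans _ (cut_area_ge0 _ _)).
  by rewrite /cut_area (negbTE Ui).
apply: le_ereal_inf_tmp => _ [U [AU Ud] <-].
apply: ereal_inf_lbound; exists U => //.
  by split=> // i; exact: sub_sigma_algebra.
by apply: eq_eseriesr => i _; rewrite /cut_area Ud.
Qed.

Let hausdorff2_0 : hausdorff2 set0 = 0.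
Proof.
apply/eqP; rewrite eq_le; apply/andP; split.
  apply: ge_ereal_sup => _ [d /= d0 <-].
  by rewrite hausdorff_deltaE mu_ext0// ?cut_area0.
exact: le_trans (hausdorff_delta_ge0 1 _) (hausdorff_delta_le _ ltr01).
Qed.

Let hausdorff2_ge0 A : 0 <= hausdorff2 A.
Proof. exact: le_trans (hausdorff_delta_ge0 1 _) (hausdorff_delta_le _ ltr01). Qed.

Let hausdorff2_le : {homo hausdorff2 : A B / A `<=` B >-> A <= B}.
Proof.
move=> A B AB; apply: ge_ereal_sup => _ [d /= d0 <-].
apply: le_trans (hausdorff_delta_le _ d0).
by rewrite !hausdorff_deltaE; exact: le_mu_ext.
Qed.

Let hausdorff2_sigma_subadditive : sigma_subadditive hausdorff2.
Proof.
move=> F; apply: ge_ereal_sup => _ [d /= d0 <-].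
rewrite hausdorff_deltaE.
apply: (le_trans (@mu_ext_sigma_subadditive _ allT _ _ (cut_area_ge0 d) F)).
apply: lee_nneseries => [i _ _|i _].
  by rewrite -hausdorff_deltaE hausdorff_delta_ge0.
by rewrite -hausdorff_deltaE hausdorff_delta_le.
Qed.

HB.instance Definition _ := isOuterMeasure.Build R V hausdorff2
  hausdorff2_0 hausdorff2_ge0 hausdorff2_le hausdorff2_sigma_subadditive.

Lemma hausdorff2_metric A B (e : R) : (0 < e)%R ->
  (forall x y, A x -> B y -> (e <= enorm (x - y))%R) ->
  hausdorff2 A + hausdorff2 B <= hausdorff2 (A `|` B).
Proof.
move=> e0 AB.
have step d : (0 < d < e)%R ->
    hausdorff_delta d A + hausdorff_delta d B <= hausdorff2 (A `|` B).
  move=> /andP[d0 de]; apply: le_trans (hausdorff_delta_le _ d0).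
  apply: le_ereal_inf_tmp => _ [U [ABU Ud] <-].
  pose part C i := if pselect (exists2 x, C x & U i x) then U i else set0.
  have cover C : C `<=` A `|` B -> diam_cover d C (part C).
    move=> CAB; split=> [x Cx|i].
      have [i _ Ux] := ABU x (CAB x Cx); exists i => //.
      by rewrite /part; case: pselect => // -[]; exists x.
    rewrite /part; case: pselect => ?; first exact: Ud.
    by rewrite ediam0 lee_fin ltW.
  apply: (@le_trans _ _ (\sum_(i <oo) disc_area (part A i) +
                         \sum_(i <oo) disc_area (part B i))).
    by apply: leeD; apply: ereal_inf_lbound;
      [exists (part A)|exists (part B)] => //; apply: cover;
      [exact: subsetUl|exact: subsetUr].
  rewrite -nneseriesD; [|by move=> *; exact: disc_area_ge0..].
  apply: lee_nneseries => [i _ _|i _].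
    by rewrite adde_ge0// disc_area_ge0.
  rewrite /part; case: pselect => [[x Ax Ux]|nA]; case: pselect => [[y By Uy]|nB];
    rewrite ?disc_area0 ?adde0 ?add0e ?disc_area_ge0//.
  exfalso; have : ediam (U i) < e%:E by rewrite (le_lt_trans (Ud i))// lte_fin.
  apply/negP; rewrite -leNgt; apply: le_trans (_ : (enorm (x - y))%:E <= _).
    by rewrite lee_fin AB.
  by apply: ereal_sup_ubound; right; exists (x, y).
have [Hoo|Hfin] := eqVneq (hausdorff2 (A `|` B)) +oo; first by rewrite Hoo leey.
have fin C : C `<=` A `|` B -> hausdorff2 C \is a fin_num.
  move=> CAB; rewrite ge0_fin_numE ?hausdorff2_ge0//.
  by rewrite (le_lt_trans (hausdorff2_le CAB))// ltey.
rewrite -leeBrDr ?fin//; apply: ge_ereal_sup => _ [d /= d0 <-].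
rewrite leeBrDr ?fin// addeC -leeBrDr; last first.
  rewrite ge0_fin_numE ?hausdorff_delta_ge0//.
  apply: le_lt_trans (hausdorff_delta_le _ d0) _.
  by rewrite -ge0_fin_numE ?hausdorff2_ge0// fin.
apply: ge_ereal_sup => _ [d' /= d'0 <-].
have fd : hausdorff_delta d A \is a fin_num.
  rewrite ge0_fin_numE ?hausdorff_delta_ge0//.
  apply: le_lt_trans (hausdorff_delta_le _ d0) _.
  by rewrite -ge0_fin_numE ?hausdorff2_ge0// fin.
rewrite leeBrDr// addeC.
pose m := Num.min (Num.min d d') (e / 2)%R.
apply: le_trans (step m _); last first.
  rewrite !lt_min d0 d'0 divr_gt0//= !gt_min.
  by apply/orP; right; rewrite ltr_pdivrMr// ltr_pMr// ltr1n.
by apply: leeD; apply: hausdorff_delta_anti; rewrite !ge_min lexx ?orbT.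
Qed.

Lemma hausdorff2_closed (F : set V) : closed F -> hausdorff2.-caratheodory F.
Proof.
move=> cF; apply: le_caratheodory_measurable => X.
change (hausdorff2 (X `&` F) + hausdorff2 (X `&` ~` F) <= hausdorff2 X).
have [->|Xfin] := eqVneq (hausdorff2 X) +oo; first by rewrite leey.
have {}Xfin : hausdorff2 X < +oo by rewrite ltey.
pose far n := [set x : V | forall y, F y -> (n.+1%:R^-1 <= enorm (x - y))%R].
have far_le m n : (m <= n)%N -> far m `<=` far n.
  move=> mn x fx y Fy; apply: le_trans (fx y Fy).
  by rewrite lef_pV2 ?posrE// ler_nat.
pose D n := X `&` (far n.+1 `\` far n).
have sep m : hausdorff2 (X `&` far m) + hausdorff2 (D m.+1) <=
    hausdorff2 (X `&` far m.+2).
  apply: (@le_trans _ _ (hausdorff2 ((X `&` far m) `|` D m.+1))).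
    apply: (@hausdorff2_metric _ _ (m.+1%:R^-1 - m.+2%:R^-1)%R).
      by rewrite subr_gt0 ltf_pV2 ?posrE// ltr_nat.
    move=> x y [_ fx] [_ [_ /existsNP[z /not_implyP[Fz /negP]]]].
    rewrite -ltNge => yz.
    rewrite lerBlDr; apply: le_trans (fx z Fz) _.
    by apply: le_trans (ler_enormB x y z) _; rewrite lerD2l ltW.
  apply: hausdorff2_le => x [[Xx fx]|[Xx [fx _]]]; split => //.
  by apply: far_le fx; rewrite leqW.
pose a k := hausdorff2 (D k.+1).
have half b N : \sum_(k < N) a (k.*2 + b)%N <= hausdorff2 (X `&` far (N.*2 + b)%N).
  elim: N => [|N ih]; first by rewrite big_ord0.
  rewrite big_ord_recr/= doubleS !addSn.
  by apply: le_trans (sep _); exact: leeD.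
have sumN N : \sum_(0 <= k < N.*2) a k <= hausdorff2 X + hausdorff2 X.
  have -> : \sum_(0 <= k < N.*2) a k =
      \sum_(k < N) a (k.*2 + 0)%N + \sum_(k < N) a (k.*2 + 1)%N.
    elim: N => [|N ih]; first by rewrite !big_ord0 big_nil adde0.
    rewrite doubleS !big_nat_recr//= ih !big_ord_recr/= addn0 addn1.
    by rewrite -!addeA; congr (_ + _); rewrite addeCA.
  by apply: leeD; apply: le_trans (half _ _) _; apply: hausdorff2_le => x [].
have suma : \sum_(k <oo) a k < +oo.
  apply: (@le_lt_trans _ _ (hausdorff2 X + hausdorff2 X)); last first.
    by rewrite lte_add_pinfty.
  apply: lime_le.
    by apply: is_cvg_nneseries => k _ _; exact: hausdorff2_ge0.
  apply: nearW => N; apply: le_trans (sumN N).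
  apply: lee_sum_nneg_natr; last by rewrite -addnn leq_addr.
  by move=> k _ _; exact: hausdorff2_ge0.
have main n : hausdorff2 (X `&` F) + hausdorff2 (X `&` ~` F) <=
    hausdorff2 X + \sum_(n <= k <oo) a k.
  have sub : X `&` ~` F `<=` (X `&` far n.+1) `|` \bigcup_(k in ~` `I_n) D k.+1.
    move=> x [Xx nFx]; have [m fm] := enorm_small cF nFx.
    have [|nfn] := pselect (far n.+1 x); first by left.
    right; have ex : exists m, `[< far m x >] by exists m; apply/asboolP.
    case: (ex_minnP ex) => -[|k] /asboolP fk kmin.
      by exfalso; apply: nfn; exact: far_le fk.
    have nk : (n < k)%N.
      by rewrite ltnNge; apply/negP => kn; apply: nfn; exact: far_le fk.
    case: k nk fk kmin => // k nk fk kmin; exists k.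
      by apply/negP; rewrite -leqNgt.
    by split => //; split => // /asboolP /kmin; rewrite ltnn.
  apply: (@le_trans _ _ (hausdorff2 (X `&` F) + (hausdorff2 (X `&` far n.+1) +
      \sum_(n <= k <oo) a k))).
    rewrite leeD2l//; apply: le_trans (hausdorff2_le sub) _.
    apply: le_trans (outer_measureU2 _ _ _) _; rewrite leeD2l//.
    exact: (outer_measure_sigma_subadditive_tail _ n (fun k => D k.+1)).
  rewrite addeA leeD2r//.
  apply: (@le_trans _ _ (hausdorff2 ((X `&` F) `|` (X `&` far n.+1)))).
    apply: (@hausdorff2_metric _ _ n.+2%:R^-1%R) => [|x y [_ Fx] [_ fy]].
      by rewrite invr_gt0.
    by rewrite enormB fy.
  by apply: hausdorff2_le => x [[]|[]].
have tail := nneseries_tail_cvg suma (fun k _ => hausdorff2_ge0 _).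
have : hausdorff2 X + \sum_(n <= k <oo) a k @[n --> \oo] --> hausdorff2 X + 0.
  apply: cvgeD => //; last exact: cvg_cst.
  by rewrite fin_num_adde_defl.
rewrite adde0 => cv.
rewrite -(cvg_lim _ cv)//; apply: lime_ge; first by apply/cvg_ex; eexists; exact: cv.
exact: nearW.
Qed.

Lemma hausdorff2_borel A : measurable A -> hausdorff2.-caratheodory A.
Proof.
pose cara : set (set V) := hausdorff2.-caratheodory.
suff : <<s open >> `<=` cara by apply.
apply: smallest_sub.
  split=> [|B mB|B mB]; first exact: caratheodory_measurable_set0.
    by rewrite setTD; exact: caratheodory_measurable_setC.
  exact: caratheodory_measurable_bigcup.
move=> B oB; rewrite -(setCK B); apply: caratheodory_measurable_setC.
by apply: hausdorff2_closed; exact: open_closedC.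
Qed.

Let hausdorff2_semi_sigma_additive :
  semi_sigma_additive (hausdorff2 : set V -> \bar R).
Proof.
move=> F mF tF mUF.
apply: (@caratheodory_measure_sigma_additive R V hausdorff2) => //.
  by move=> i; exact: hausdorff2_borel.
exact: hausdorff2_borel.
Qed.

HB.instance Definition _ := isMeasure.Build _ V R hausdorff2
  hausdorff2_0 hausdorff2_ge0 hausdorff2_semi_sigma_additive.

End hausdorff.

Section sphere.
Context {R : realType}.
Notation V := 'rV[R]_3.
Implicit Types (x y : V) (psi : V -> R) (v : V -> V).

Definition sphere : set V := [set x | enorm x = 1].

(* tangent to the sphere at x: the component of a orthogonal to x *)
Definition tproj x (a : V) : V := a - dotp a x *: x.

(* A function on the sphere is represented by a function on R^3, of which only
   the values on the sphere matter.  It is differentiated through its extension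
   that is constant along rays: at a point x of the sphere, the derivative of
   the extension vanishes in the direction x and agrees with the derivative on
   the sphere in the tangent directions. *)
Definition radial_ext {W : Type} (f : V -> W) (y : V) : W :=
  f ((enorm y)^-1 *: y).

Definition sphere_C1 {W : normedModType R} (f : V -> W) : Prop :=
  forall y, y != 0 -> differentiable (radial_ext f) y /\
    forall a : V, {for y, continuous (fun z => 'D_a (radial_ext f) z)}.

Definition sphere_C1_field v : Prop :=
  sphere_C1 v /\ forall x, sphere x -> dotp (v x) x = 0.

Definition sphere_grad psi x : V :=
  \row_(i < 3) 'D_(delta_mx 0 i) (radial_ext psi) x.

(* Levi-Civita derivative D_a v at x *)
Definition sphere_D v x (a : V) : V := tproj x ('D_a (radial_ext v) x).

(* (Dv)_ij = (e_i, D_{e_j} v); the direction x contributes 0, so that the trace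
   of this 3 x 3 matrix is the trace of Dv on the tangent plane. *)
Definition sphere_Dmx v x : 'M[R]_3 :=
  \matrix_(i < 3, j < 3) sphere_D v x (delta_mx 0 j) 0 i.

Definition sphere_div v x : R := \tr (sphere_Dmx v x).

End sphere.

Section cone.
Context {R : realType}.
Notation V := 'rV[R]_3.
Implicit Types (th alpha s : R) (x : V).

Definition sph_point (th ph : R) : V :=
  row3 (cos th) (sin th * cos ph) (sin th * sin ph).

Definition Con th0 : set V :=
  [set x | exists th ph, [/\ 0 <= th <= th0, - pi <= ph <= pi
                           & x = sph_point th ph]].

Definition Omega th0 : set V := sphere `\` Con th0.

Definition clOmega th0 : set V := closure (Omega th0).

Definition C_length th0 : R := 2 * pi * sin th0.

(* arc-length parametrization of C *)
Definition C_point th0 s : V := sph_point th0 (s / sin th0).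

Definition C_curve th0 : set V := C_point th0 @` `[0, C_length th0].

Definition C_arc th0 x : R :=
  xget 0 [set s | 0 <= s < C_length th0 /\ C_point th0 s = x].

Definition C_tangent th0 s : V := derive1 (C_point th0) s.

(* Omega is the side of increasing theta, so - d/dtheta points out of it. *)
Definition C_normal th0 s : V :=
  - derive1 (fun th => sph_point th (s / sin th0)) th0.

(* D_t n *)
Definition C_Dt_normal th0 s : V :=
  tproj (C_point th0 s) (derive1 (C_normal th0) s).

(* the measure W delta_C *)
Definition dirac_C th0 (W : R -> R) (A : set V) : \bar R :=
  (\int[lebesgue_measure]_(s in `[0%R, C_length th0] `&` C_point th0 @^-1` A)
     (W s)%:E)%E.

Definition rho0 : R := 1.

Definition V0 alpha0 : V := row3 (cos alpha0) (sin alpha0) 0.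

(* On the unit sphere the radial vector d x / d r at x is x itself. *)
Definition w0 alpha0 x : R := dotp (V0 alpha0) x.

Definition u0 alpha0 x : V := V0 alpha0 - w0 alpha0 x *: x.

End cone.

Section radon_solution.
Context {R : realType}.
Notation V := 'rV[R]_3.
Notation charge3 := (charge V R).
Notation finite_measure3 := {finite_measure set V -> \bar R}.
Implicit Types (th : R) (nu : charge3).

Definition hahn_sets nu :
    {PN : set V * set V | hahn_decomposition nu PN.1 PN.2} :=
  let hP := cid (Hahn_decomposition nu) in
  let hN := cid (svalP hP) in
  exist (fun PN => hahn_decomposition nu PN.1 PN.2)
    (sval hP, sval hN) (svalP hN).

Definition cintegral nu (D : set V) (f : V -> R) : R :=
  \int[jordan_pos (svalP (hahn_sets nu))]_(x in D) f x -
  \int[jordan_neg (svalP (hahn_sets nu))]_(x in D) f x.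

(* Pairings of vector- and matrix-valued measures, given by their components
   in R^3 *)
Definition cintegral_vec (m : 'I_3 -> charge3) D (f : V -> V) : R :=
  \sum_(i < 3) cintegral (m i) D (fun x => f x 0 i).

Definition cintegral_mx (m : 'I_3 -> 'I_3 -> charge3) D (f : V -> 'M[R]_3) : R :=
  \sum_(i < 3) \sum_(j < 3) cintegral (m i j) D (fun x => f x i j).

Definition RNd nu (mu : finite_measure3) (x : V) : R :=
  fine (Radon_Nikodym nu mu x).

(* f is the density of mu with respect to the Hausdorff measure of the closure
   of Omega *)
Definition hausdorff_density th0 (mu : finite_measure3) (f : V -> R) : Prop :=
  [/\ measurable_fun setT f, (forall x, 0 <= f x) &
    forall A, measurable A ->
      mu A = (\int[hausdorff2]_(x in A `&` clOmega th0) (f x)%:E)%E].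

Definition half_ball (x e : V) (r : R) : set V :=
  [set y | enorm (y - x) < r /\ 0 < dotp (y - x) e].

(* approximate limit a of f at x from the side of the tangent vector e; it does
   not depend on the representative of f modulo null sets *)
Definition one_sided_limit th0 (x e : V) (f : V -> R) (a : R) : Prop :=
  ((r ^- 2)%:E * \int[hausdorff2]_(y in Omega th0 `&` half_ball x e r)
     `|f y - a|%:E)%E @[r --> 0^'+] --> 0%E.

Definition one_sided_state th0 (x e : V) (rho : V -> R) (u : V -> V)
    (w E : V -> R) (r : R) (a : V) (b c : R) : Prop :=
  [/\ one_sided_limit th0 x e rho r,
      (forall i, one_sided_limit th0 x e (fun y => u y 0 i) (a 0 i)),
      one_sided_limit th0 x e w b & one_sided_limit th0 x e E c].

(* If gas crosses a discontinuity with normal e, from the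
   side - e to the side e, then it is compressed. *)
Definition entropy_condition th0 (rho : V -> R) (u : V -> V) (w E : V -> R) :
    Prop :=
  forall (x e : V) (r1 r2 b1 b2 c1 c2 : R) (a1 a2 : V),
    Omega th0 x -> dotp e x = 0 -> enorm e = 1 ->
    one_sided_state th0 x (- e) rho u w E r1 a1 b1 c1 ->
    one_sided_state th0 x e rho u w E r2 a2 b2 c2 ->
    0 < r1 * dotp a1 e -> 0 < r2 * dotp a2 e -> r1 <= r2.

(* Only varrho is asked explicitly to be carried by the closure of Omega: the
   other measures are absolutely continuous with respect to varrho. *)
Definition radon_measure_solution th0 (ptilde : R -> R -> R)
    (varrho : finite_measure3) (u : V -> V) (w E : V -> R)
    (wp : finite_measure3) (WC : R -> R) : Prop :=
  let D := clOmega th0 in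
  let L := C_length th0 in
  exists (ma me mr : 'I_3 -> charge3) (mt : 'I_3 -> 'I_3 -> charge3)
    (na ne nr nt : charge3),
  [/\ varrho (~` D) = 0%E,
      (forall s, 0 <= s <= L -> 0 < WC s) /\
        lebesgue_measure.-integrable `[0, L] (EFin \o WC),
      [/\ forall psi, sphere_C1 psi ->
            cintegral_vec ma D (sphere_grad psi) = 2 * cintegral na D psi,
          forall psi, sphere_C1 psi ->
            cintegral_vec me D (sphere_grad psi) = 2 * cintegral ne D psi,
          forall psi, sphere_C1 psi ->
            cintegral_vec mr D (sphere_grad psi) =
            2 * cintegral nr D psi - cintegral nt D psi &
          forall v, sphere_C1_field v ->
            cintegral_mx mt D (sphere_Dmx v) + \int[wp]_(x in D) sphere_div v x =
            3 * cintegral_vec mr D v +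
            \int[lebesgue_measure]_(s in `[0, L])
              (WC s * dotp (C_normal th0 s) (v (C_point th0 s)))],
      [/\ [/\ forall i, [/\ ma i `<< varrho, me i `<< varrho & mr i `<< varrho],
              forall i j, mt i j `<< varrho,
              [/\ na `<< varrho, ne `<< varrho, nr `<< varrho & nt `<< varrho] &
              wp `<< varrho],
          [/\ forall i, measurable_fun setT (fun x => u x 0 i),
              {ae varrho, forall x, dotp (u x) x = 0},
              measurable_fun setT w & measurable_fun setT E],
          {ae varrho, forall x,
            [/\ forall i, RNd (mr i) varrho x = w x * RNd (ma i) varrho x,
                RNd nr varrho x = w x * RNd na varrho x &
                RNd na varrho x = w x]},
          {ae varrho, forall x,
            (forall i, RNd (me i) varrho x = E x * RNd (ma i) varrho x) /\
            RNd ne varrho x = E x * RNd na varrho x} &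
          {ae varrho, forall x,
            [/\ forall i, RNd (ma i) varrho x = u x 0 i,
                RNd nt varrho x = dotp (u x) (u x) &
                forall i j, RNd (mt i j) varrho x = u x 0 i * u x 0 j]}] &
      varrho `<< hausdorff2 -> wp `<< hausdorff2 ->
        forall rho p, hausdorff_density th0 varrho rho ->
          hausdorff_density th0 wp p ->
          {ae hausdorff2, forall x, D x -> p x = ptilde (rho x) (E x)} /\
          entropy_condition th0 rho u w E].

End radon_solution.

Section solution.
Context {R : realType}.
Notation V := 'rV[R]_3.

Definition u_sol (th0 alpha0 : R) (ut : R -> R) (x : V) : V :=
  \1_(Omega th0) x *: u0 alpha0 x +
  (\1_(C_curve th0) x * ut (C_arc th0 x)) *: C_tangent th0 (C_arc th0 x).

Definition w_sol (th0 alpha0 : R) (wC : R -> R) (x : V) : R :=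
  w0 alpha0 x * \1_(Omega th0) x + wC (C_arc th0 x) * \1_(C_curve th0) x.

Definition E_sol (th0 E0 : R) (x : V) : R :=
  E0 * \1_(Omega th0) x + E0 * \1_(C_curve th0) x.

Definition WC_sol (th0 alpha0 E0 : R) (ptilde : R -> R -> R) (wrho ut : R -> R)
    (s : R) : R :=
  wrho s * ut s ^+ 2 * dotp (C_tangent th0 s) (C_Dt_normal th0 s) +
  rho0 * dotp (u0 alpha0 (C_point th0 s)) (C_normal th0 s) ^+ 2 +
  ptilde rho0 E0.

End solution.

(* Main.v *)
From HB Require Import structures.
Require Import Defs.
From mathcomp Require Import all_boot all_order all_algebra.
From mathcomp Require Import all_classical all_reals all_analysis.
From mathcomp Require Import measurable_realfun ring lra.

Set Implicit Arguments.
Unset Strict Implicit.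
Unset Printing Implicit Defensive.

Import Order.TTheory GRing.Theory Num.Theory.
Import numFieldNormedType.Exports.

Local Open Scope classical_set_scope.
Local Open Scope ring_scope.

(** The upcoming flow is constant in $\mathbb R^3$, and the solution keeps it
    unchanged in $\Omega$, so that everything rests on one divergence theorem on
    the spherical domain $\Omega$.  For a constant vector $a$ the tangential
    field $a-(a,x)x$ has divergence $-2(a,x)$, whence, for $\psi$ of class $C^1$,
    $$\int_\Omega\big((a,\nabla\psi)-2(a,x)\psi\big)\,d\mathcal H^2
      =\int_C\psi\,(a,\mathbf n)\,ds ,$$
    which is [divergence_cap].  With $a=V_0$, the choices $\psi$, $w_0\psi$ and
    $(V_0,v)$ of the test function give the equations of mass, of radial momentum
    and of tangential momentum for the uniform flow, up to a term on $C$: one uses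
    $(V_0,\nabla w_0)=|u_0|^2$ and $(x,D_{u_0}v)=-(u_0,v)$.  The energy is $E_0$
    times the mass, and the choices $a=e_i$, $\psi=v_i$, added up, give the
    divergence theorem needed for the constant pressure.  On $C$ the terms in
    $(a,\mathbf n)$ that remain are cancelled by the mass concentrated there: by
    the three differential equations the sum of the two is the derivative along
    $C$ of $w_\rho u^t\psi$, of $w_\rho u^tw\,\psi$ or of
    $w_\rho(u^t)^2(\mathbf t,v)$, and these are periodic.  The lemma [balance]
    states this mechanism; in the last case the geodesic curvature of $C$ makes
    $w_\rho(u^t)^2(\mathbf t,D_{\mathbf t}\mathbf n)$ appear in $W_C$.

    The integrals are taken with respect to the Hausdorff measure, defined by
    coverings, and a good part of the text identifies it on the sphere with the
    area [sphere_area] carried over from the circumscribed cylinder by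
    Archimedes' projection ([hausdorff_sphereE]).  The area is at most
    $\mathcal H^2$ by an isodiametric inequality on the sphere
    ([isodiametric_sphere]), in the manner of Littlewood's proof in the plane.
    Conversely the total masses agree.  Both measures are invariant under
    rotations, hence proportional on the spherical caps, by counting in two ways
    the pairs of points at distance less than $r$ ([cap_ratio]); and if
    $\mathcal H^2$ gave more than their area to the small caps, covering by a
    maximal packing of caps would be cheaper than possible
    ([hausdorff_sphere_le]).  Once this is known, the divergence theorem is the
    fundamental theorem of calculus in each of the two angles.

    The measures of the solution are charges with bounded densities with respect
    to $\varrho$, and integrals against the Jordan components of such a charge
    are brought back to $\varrho$ by [cintegral_density_charge].  Finally, if
    $\varrho$ has a density with respect to $\mathcal H^2$, this density is $1$
    almost everywhere in $\Omega$, and half of a small cap has an area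
    proportional to the square of its radius.  So the one-sided limits of the
    density at a point of $\Omega$ are both equal to $1$, and the entropy
    condition holds. *)

(** * Borel sets of the space *)

Section borel_rV.
Context {R : realType}.
Notation V := 'rV[R]_3.

Lemma measurable_openV (U : set V) : open U -> measurable U.
Proof. by move=> oU; exact: sub_sigma_algebra. Qed.

Lemma measurable_closedV (U : set V) : closed U -> measurable U.
Proof.
move=> cU; rewrite -(setCK U); apply: measurableC.
by apply: measurable_openV; exact: closed_openC.
Qed.

Lemma measurable_fun_contV (f : V -> R) : continuous f -> measurable_fun setT f.
Proof.
move=> cf; apply: (measurability _ (measurable_realfun.RGenOpens.measurableE R)).
move=> _ [_ [a [b ->] <-]]; rewrite setTI; apply: measurable_openV.
by apply: open_comp => [x _|]; [exact: cf|exact: interval_open].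
Qed.

Lemma measurable_coordV i : measurable_fun setT (fun x : V => x 0 i).
Proof. by apply: measurable_fun_contV; exact: coord_continuous. Qed.

(** Open sets are countable unions of rational cubes, whose preimages are
   finite intersections of preimages of intervals. *)
Lemma measurable_fun_coordV d (T : measurableType d) (f : T -> V) :
  (forall i, measurable_fun setT (fun t => f t 0 i)) -> measurable_fun setT f.
Proof.
move=> mf; have/(_ _)/= H := @measurability d _ T V setT f (@open V) (erefl _).
apply: H => _ [U oU <-].
rewrite setTI.
pose cube (c : 'rV[rat]_3 * nat) : set V := ball (map_mx (@ratr R) c.1 : V) c.2.+1%:R^-1.
have -> : U = \bigcup_(c in [set c | cube c `<=` U]) cube c.
  apply/seteqP; split; last by move=> x [c cU] /cU.
  move=> x Ux; move: (oU); rewrite openE => /(_ x Ux) /nbhs_ballP[e /= e0 eU].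
  pose n := Num.truncn ((e / 2)^-1).
  have ne : n.+1%:R^-1 <= e / 2.
    rewrite -[leRHS]invrK lef_pV2 ?posrE ?invr_gt0 ?divr_gt0//.
    by rewrite ltW// truncnS_gt.
  have n0 : 0 < n.+1%:R^-1 :> R by rewrite invr_gt0.
  have /choice[q qP] : forall i : 'I_3, exists q : rat,
      ball (ratr q : R) n.+1%:R^-1 (x 0 i).
    move=> i; have /rat_in_itvoo[q] : x 0 i - n.+1%:R^-1 < x 0 i + n.+1%:R^-1.
      by rewrite ltrBlDr -addrA ltrDl addr_gt0.
    rewrite in_itv/= => /andP[q1 q2]; exists q.
    by rewrite /ball/= ltr_distl; apply/andP; move: (n.+1%:R^-1 : R) q1 q2 => ? ? ?; split; lra.
  have xb : cube (\row_i q i, n) x.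
    by split => //= i j; rewrite !mxE ord1; exact: qP.
  exists (\row_i q i, n) => //= y [_ /= yb]; apply: eU; split => // i j.
  have := yb i j; case: xb => _ /(_ i j)/=; rewrite !mxE /ball/=.
  move: (ratr _ : R) => a xa ay.
  rewrite -(subrKA a); apply: le_lt_trans (ler_normD _ _) _.
  by rewrite distrC; move: (n.+1%:R^-1 : R) xa ay ne => ? ? ? ?; lra.
rewrite preimage_bigcup bigcup_mkcond.
apply: countable_bigcupT_measurable => // c.
case: ifPn => // _.
have -> : f @^-1` cube c =
    \bigcap_(i in [set: 'I_3]) (fun t => f t 0 i) @^-1` ball (ratr (c.1 0 i) : R) c.2.+1%:R^-1.
  apply/seteqP; split => t /=.
    by move=> [_ /= h] i _; have := h 0 i; rewrite !mxE.
  move=> h; split => //= i j; rewrite !mxE ord1; exact: h.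
apply: fin_bigcap_measurable => // i _.
rewrite -[X in measurable X]setTI; apply: mf => //.
by apply: open_measurable; exact: ball_open.
Qed.

End borel_rV.

(** * Images of measures and the Lebesgue measure of the line *)

Definition image_measure d d' (T : measurableType d) (T' : measurableType d')
    (R : realType) (m : {measure set T -> \bar R}) (f : T -> T')
    (mf : measurable_fun setT f) : {measure set T' -> \bar R} :=
  measure_function_pushforward__canonical__measure_function_Measure m mf.

Section lebesgue_line.
Context {R : realType}.
Notation leb := (@lebesgue_measure R).

Lemma lebesgue_measure_translate (c : R) (A : set R) : measurable A ->
  leb ((fun x => x + c) @^-1` A) = leb A.
Proof.
move=> mA.
have mf : measurable_fun [set: measurableTypeR R]
    ((fun x => x + c) : measurableTypeR R -> measurableTypeR R).
  by apply: measurable_funD => //; exact: measurable_cst.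
pose m : {measure set (measurableTypeR R) -> \bar R} := image_measure leb mf.
rewrite [RHS](@lebesgue_measure_unique R m)// => _ [[a b] _ <-].
rewrite /m /= /pushforward.
rewrite (_ : _ @^-1` _ = `]a - c, b - c]%classic).
  by rewrite !lebesgue_measure_itv/= !lte_fin ltrBlDr subrK; case: ifP => // _;
     rewrite -!EFinB; congr (_%:E); lra.
by apply/seteqP; split => x /=; rewrite !in_itv/= ltrBlDr lerBrDr.
Qed.

Lemma lebesgue_measure_flip (c : R) (A : set R) : measurable A ->
  leb ((fun x => c - x) @^-1` A) = leb A.
Proof.
move=> mA.
have mf : measurable_fun [set: measurableTypeR R]
    ((fun x => c - x) : measurableTypeR R -> measurableTypeR R).
  by apply: measurable_funB => //; exact: measurable_cst.
pose m : {measure set (measurableTypeR R) -> \bar R} := image_measure leb mf.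
rewrite [RHS](@lebesgue_measure_unique R m)// => _ [[a b] _ <-].
rewrite /m /= /pushforward.
rewrite (_ : _ @^-1` _ = `[c - b, c - a[%classic).
  rewrite !lebesgue_measure_itv/= !lte_fin ltrD2l ltrN2; case: ifP => // _.
  by rewrite -!EFinB; congr (_%:E); lra.
by apply/seteqP; split => x /=; rewrite !in_itv/= => /andP[? ?]; apply/andP; split; lra.
Qed.

(** The interval is cut at $T-a$: one piece is translated by $a$, the other by
    $a-T$, and $B$ does not see the difference. *)
Lemma lebesgue_measure_circle_shift (T a : R) (B : set R) : measurable B ->
  0 <= a <= T -> (forall x, B (x + T) <-> B x) ->
  leb (`[0, T[ `&` (fun x => x + a) @^-1` B) = leb (`[0, T[ `&` B).
Proof.
move=> mB /andP[a0 aT] BT.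
have mI (b c : R) : measurable (`[b, c[ `&` B) by exact: measurableI.
have cut (b c d : R) : b <= c -> c <= d ->
    leb (`[b, d[ `&` B) = (leb (`[b, c[ `&` B) + leb (`[c, d[ `&` B))%E.
  move=> bc cd; rewrite -measureU; [|exact: mI|exact: mI|].
    rewrite -setIUl; congr (leb (_ `&` _)).
    apply/seteqP; split => x /=; rewrite !in_itv/=.
      by move=> /andP[-> ->]; case: (ltP x c) => _; [left|right].
    by case=> /andP[h1 h2]; apply/andP; split; lra.
  rewrite -subset0 => x /= [[]]; rewrite !in_itv/= => /andP[_ h] _ [].
  by move=> /andP[h' _] _; lra.
have -> : `[0, T[ `&` (fun x => x + a) @^-1` B =
    (fun x => x + a) @^-1` (`[a, T + a[ `&` B).
  by apply/seteqP; split => x /=; rewrite !in_itv/= lerDr ltrD2r.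
rewrite lebesgue_measure_translate// (cut a T)//; last by rewrite lerDl.
rewrite -(@lebesgue_measure_translate T (`[T, _[ `&` _))//.
have -> : (fun x => x + T) @^-1` (`[T, T + a[ `&` B) = `[0, a[ `&` B.
  by apply/seteqP; split => x /=; rewrite !in_itv/= lerDr (addrC x) ltrD2l;
    move=> [-> h]; split => //; move: h; rewrite (addrC T) => /BT.
by rewrite (cut 0 a T)// addeC.
Qed.

End lebesgue_line.

(** * Measures with a density, and the distribution of the cosine *)

Section density.
Context d (T : measurableType d) (R : realType) (mu : {measure set T -> \bar R}).
Variable f : T -> R.
Hypotheses (mf : measurable_fun setT f) (f0 : forall x, 0 <= f x).

Let dens (A : set T) : \bar R := (\int[mu]_(x in A) (f x)%:E)%E.

Let dens0 : dens set0 = 0%E. Proof. exact: integral_set0. Qed.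

Let dens_ge0 A : (0 <= dens A)%E.
Proof. by apply: integral_ge0 => x _; rewrite lee_fin. Qed.

Let dens_sigma_additive : semi_sigma_additive dens.
Proof.
apply: semi_sigma_additive_nng_induced => [|x]; last by rewrite lee_fin.
exact/measurable_EFinP.
Qed.

HB.instance Definition _ :=
  isMeasure.Build _ _ _ dens dens0 dens_ge0 dens_sigma_additive.

Definition density_measure : {measure set T -> \bar R} := dens.

Lemma density_measureE A : density_measure A = (\int[mu]_(x in A) (f x)%:E)%E.
Proof. by []. Qed.

End density.

Section cosine_pushforward.
Context {R : realType}.
Notation leb := (@lebesgue_measure R).

Lemma measurable_inv_sqrt d (T : measurableType d) (g : T -> R) :
  measurable_fun setT g ->
  measurable_fun setT (fun y => (Num.sqrt (g y))^-1).
Proof.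
move=> mg; rewrite (_ : (fun _ => _) = (fun y => Num.sqrt (g y) `^ (-1))).
  apply: (measurableT_comp (@measurable_powR R (-1))).
  apply: (measurableT_comp _ mg); apply: continuous_measurable_fun.
  exact: sqrt_continuous.
by apply/funext => y; rewrite powR_inv1// sqrtr_ge0.
Qed.

Variable s : R.
Hypothesis s0 : 0 < s.

Let g (y : R) := (Num.sqrt (s ^+ 2 - y ^+ 2))^-1.

Let mg : measurable_fun setT g.
Proof.
apply: measurable_inv_sqrt; apply: measurable_funB; first exact: measurable_cst.
by apply: measurable_funX; exact: measurable_id.
Qed.

Let g0 y : 0 <= g y. Proof. by rewrite invr_ge0 sqrtr_ge0. Qed.

Let cos_s (x : R) := s * cos x.

Let mcos : measurable_fun [set: measurableTypeR R]
  (cos_s : measurableTypeR R -> measurableTypeR R).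
Proof.
apply: measurable_funM; first exact: measurable_cst.
by apply: continuous_measurable_fun; exact: continuous_cos.
Qed.

Let int_g (a b : R) : - s < a -> a <= b -> b < s ->
  (\int[leb]_(y in `]a, b]) (g y)%:E = (acos (a / s) - acos (b / s))%:E)%E.
Proof.
move=> sa ab bs.
rewrite integral_itv_obnd_cbnd; last first.
  by apply/measurable_EFinP; exact: (measurable_funTS mg).
move: ab; rewrite le_eqVlt => /predU1P[<-|ab].
  by rewrite set_itv1 integral_set1 subrr.
pose F (y : R) := - acos (y * s^-1).
have dF (y : R) : - s < y < s -> is_derive y 1 F (g y).
  move=> /andP[sy ys].
  have y1 : -1 < y * s^-1 < 1.
    by rewrite ltr_pdivrMr// mul1r ltr_pdivlMr// mulN1r sy ys.
  have h := is_derive1_acos y1.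
  have h2 : is_derive y 1 (fun z : R => z * s^-1) s^-1.
    apply: (@is_derive_eq _ _ _ (fun z : R => z * s^-1)) => //.
    by rewrite scaler0 add0r scaler1.
  have h3 := @is_derive1_comp R (@acos R) (fun z => z * s^-1) y _ _ h h2.
  have := is_deriveN h3.
  rewrite (_ : - (- _ / s) = g y)//.
  have ? : 0 < 1 - (y / s) ^+ 2 by move: y1 => /andP[h4 h5]; nra.
  rewrite mulNr opprK /g -invfM; congr (_^-1).
  rewrite -[X in _ * X]gtr0_norm// -sqrtr_sqr -sqrtrM ?ltW//.
  by congr Num.sqrt; field; rewrite gt_eqF.
have iab (y : R) : a <= y <= b -> - s < y < s.
  by move=> /andP[? ?]; apply/andP; split; lra.
rewrite (@continuous_FTC2 _ g F a b)//.
- by rewrite /F -EFinB; congr (_%:E); lra.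
- apply: continuous_in_subspaceT => y; rewrite inE/= in_itv/= => /iab/andP[? ?].
  apply: cvgV.
    by rewrite gt_eqF// sqrtr_gt0; nra.
  suff h : continuous (fun z : R => Num.sqrt (s ^+ 2 - z ^+ 2)) by exact: h.
  move=> z; apply: (@continuous_comp R R R (fun z => s ^+ 2 - z ^+ 2) Num.sqrt).
    by apply: cvgB; [exact: cvg_cst|exact: exprn_continuous].
  exact: sqrt_continuous.
- split => [y||].
  + rewrite in_itv/= => /andP[ay yb].
    by have [] : is_derive y 1 F (g y) by apply: dF; apply: iab; lra.
  + apply: cvg_at_right_filter; apply/differentiable_continuous/derivable1_diffP.
    by have [] : is_derive a 1 F (g a) by apply: dF; apply: iab; lra.
  + apply: cvg_at_left_filter; apply/differentiable_continuous/derivable1_diffP.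
    by have [] : is_derive b 1 F (g b) by apply: dF; apply: iab; lra.
- move=> y; rewrite in_itv/= => /andP[ay yb]; rewrite derive1E.
  by apply: derive_val; apply: dF; apply: iab; lra.
Qed.

Let cos_s_itv (a b x : R) : - s <= a -> b <= s -> a <= s -> - s <= b -> 0 < x < pi ->
  (a < cos_s x <= b) = (acos (b / s) <= x < acos (a / s)).
Proof.
move=> sa bs as' sb /andP[x0 xpi]; rewrite /cos_s andbC.
have xI : x \in `[0, pi] by rewrite in_itv/= !ltW.
have cI (c : R) : - s <= c -> c <= s -> acos (c / s) \in `[0, pi].
  move=> sc cs; have ? : -1 <= c / s <= 1.
    by rewrite ler_pdivrMr// mul1r ler_pdivlMr// mulN1r sc cs.
  by rewrite in_itv/= acos_ge0 ?acos_lepi.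
have cK (c : R) : - s <= c -> c <= s -> cos (acos (c / s)) = c / s.
  move=> sc cs; apply: acosK.
  by rewrite in_itv/= ler_pdivrMr// mul1r ler_pdivlMr// mulN1r sc cs.
congr andb.
  rewrite [LHS]leNgt [RHS]leNgt; congr (~~ _).
  by rewrite -[RHS]ltr_cos ?cI// cK// ltr_pdivrMr// mulrC.
by rewrite -[RHS]ltr_cos ?cI// cK// ltr_pdivrMr// mulrC.
Qed.

Let trunc (t : R) (B : set R) : 0 < t < s -> measurable B ->
  leb (`]0, pi[ `&` cos_s @^-1` (`]- t, t] `&` B)) =
  (\int[leb]_(y in `](- t)%R, t] `&` B) (g y)%:E)%E.
Proof.
move=> /andP[t0 ts] mB.
have mD : measurable (`]0, pi[ `&` cos_s @^-1` `]- t, t] : set (measurableTypeR R)).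
  by apply: measurableI => //; rewrite -[X in measurable X]setTI; exact: mcos.
have mT : measurable (`]- t, t]%classic : set (measurableTypeR R)).
  exact: measurable_itv.
pose m1 : {measure set (measurableTypeR R) -> \bar R} :=
  image_measure (mrestr leb mD) mcos.
pose m2 : {measure set (measurableTypeR R) -> \bar R} :=
  mrestr (density_measure leb mg g0) mT.
have m1E X : m1 X = leb (`]0, pi[ `&` cos_s @^-1` (`]- t, t] `&` X)).
  rewrite -[LHS]/(leb (cos_s @^-1` X `&` (`]0, pi[ `&` cos_s @^-1` `]- t, t]))).
  by rewrite setIC -setIA -preimage_setI.
have m2E X : m2 X = (\int[leb]_(y in `](- t)%R, t] `&` X) (g y)%:E)%E.
  rewrite -[LHS]/(\int[leb]_(y in X `&` `](- t)%R, t]) (g y)%:E)%E.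
  by rewrite setIC.
rewrite -m1E -m2E.
apply: (@measure_unique _ R (measurableTypeR R) (@ocitv R)
  (fun n => `]- n%:R, n%:R]%classic) (erefl _) (@ocitvI R)) => //.
- by move=> n; exact: is_ocitv.
- rewrite -subTset => x _; exists (Num.truncn `|x|).+1 => //=.
  have := truncnS_gt `|x|; rewrite in_itv/= ltr_norml => /andP[-> /ltW ->//].
- move=> _ [[a0 b0] _ <-]; rewrite m1E m2E /=.
  pose a := Num.max (- t) a0; pose b := Num.min t b0.
  have -> : `]- t, t] `&` `]a0, b0] = `]a, b]%classic.
    by apply/seteqP; split => x /=; rewrite !in_itv/= /a /b gt_max le_min;
      [move=> [/andP[-> ->] /andP[-> ->]]|move=> /andP[/andP[-> ->] /andP[-> ->]]].
  have [ba|ab] := ltP b a.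
    rewrite (_ : `]a, b]%classic = set0) ?preimage_set0 ?setI0 ?measure0 ?integral_set0//.
    by apply/seteqP; split => x //=; rewrite in_itv/=; lra.
  have ta : - t <= a by rewrite le_max lexx.
  have bt : b <= t by rewrite ge_min lexx.
  rewrite int_g//; [|lra|lra].
  have cI (c : R) : - t <= c -> c <= t -> -1 < c / s < 1.
    by move=> h1 h2; rewrite ltr_pdivrMr// mul1r ltr_pdivlMr// mulN1r; apply/andP; split; lra.
  have /andP[ca1 ca2] := cI a ta (le_trans ab bt).
  have /andP[cb1 cb2] := cI b (le_trans ta ab) bt.
  have -> : `]0, pi[ `&` cos_s @^-1` `]a, b] =
      `[acos (b / s), acos (a / s)[%classic.
    apply/seteqP; split => x /=.
      by move=> [+]; rewrite !in_itv/= => h; rewrite cos_s_itv; lra.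
    rewrite !in_itv/= => /andP[h1 h2].
    have h : 0 < x < pi.
      rewrite (lt_le_trans _ h1) ?(lt_le_trans h2)//.
        by apply: acos_lepi; rewrite !ltW.
      by apply: acos_gt0; rewrite ltW.
    by split => //; rewrite cos_s_itv//; lra.
  have le_acos : acos (b / s) <= acos (a / s).
    rewrite leNgt; apply/negP => h.
    have : cos (acos (b / s)) < cos (acos (a / s)).
      by rewrite ltr_cos// in_itv/= acos_ge0 ?acos_lepi// !ltW.
    rewrite !acosK ?in_itv/= ?ltW// ltr_pM2r ?invr_gt0//; lra.
  rewrite lebesgue_measure_itv/= lte_fin -EFinB.
  by case: ltP => // h; rewrite (le_anti (introT andP (conj le_acos h))) subrr.
- move=> n; rewrite /= /pushforward /mrestr.
  apply: (@le_lt_trans _ _ (leb (`]0%R, pi[ : set R))).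
    by apply: le_measure; rewrite ?inE//; [apply: measurableI => //; 
     rewrite -[X in measurable X]setTI; exact: mcos|move=> x [_ []]].
  rewrite lebesgue_measure_itv/= lte_fin pi_gt0 -EFinB; exact: ltry.
Qed.

(** The substitution $y=s\cos x$.  The density blows up at $\pm s$, so that
    the formula is first proved away from the two ends and then extended by
    monotonicity. *)
Lemma lebesgue_measure_cos (B : set R) : measurable B ->
  leb (`]0, pi[ `&` (fun x => s * cos x) @^-1` B) =
  (\int[leb]_(y in `](- s)%R, s[ `&` B) ((Num.sqrt (s ^+ 2 - y ^+ 2))^-1)%:E)%E.
Proof.
move=> mB.
pose t (n : nat) := s * (1 - n.+2%:R^-1).
have t1 n : 0 < t n < s.
  have h : (n.+2%:R^-1 : R) < 1 by rewrite invf_lt1// ltr1n.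
  have h0 : 0 < (n.+2%:R^-1 : R) by rewrite invr_gt0.
  by rewrite /t mulr_gt0 ?subr_gt0//= gtr_pMr// gtrBl.
have tnd : {homo t : n m / (n <= m)%N >-> n <= m}.
  move=> n m nm; rewrite /t ler_pM2l// lerD2l lerN2 lef_pV2 ?posrE//.
  by rewrite ler_nat !ltnS.
have cover (x : R) : - s < x < s -> exists n, - t n < x <= t n.
  move=> /andP[sx xs].
  pose e := Num.min (1 - x / s) (1 + x / s).
  have e0 : 0 < e.
    by rewrite lt_min subr_gt0 ltr_pdivrMr// mul1r xs/= addrC -ltrBlDr sub0r
      ltr_pdivlMr// mulN1r.
  exists (Num.truncn e^-1).
  have : (Num.truncn e^-1).+2%:R^-1 < e.
    rewrite -[ltRHS]invrK ltf_pV2 ?posrE ?invr_gt0//.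
    by apply: lt_trans (truncnS_gt _) _; rewrite ltr_nat.
  rewrite lt_min /t; move: ((Num.truncn e^-1).+2%:R^-1 : R) => d /andP[h1 h2].
  have xE : x = s * (x / s) by field; rewrite gt_eqF.
  by rewrite {1 2}xE -mulrN ltr_pM2l// ler_pM2l//; apply/andP; split; lra.
pose F (n : nat) : set R := `]- t n, t n] `&` B.
have mF n : measurable (F n) by exact: measurableI.
have UF : \bigcup_n F n = `]- s, s[ `&` B.
  rewrite -setI_bigcupl; congr setI; apply/seteqP; split => x /=.
    by move=> [n _] /=; have := t1 n; rewrite !in_itv/=; lra.
  by rewrite in_itv/= => /cover[n h]; exists n => //=; rewrite in_itv.
have ndF : nondecreasing_seq F.
  move=> n m nm; apply/subsetPset => x /= [h Bx]; split => //; move: h.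
  by rewrite /= !in_itv/=; have := tnd _ _ nm; lra.
pose m1 : {measure set (measurableTypeR R) -> \bar R} :=
  image_measure (mrestr leb (measurable_itv `]0, pi[)) mcos.
pose m2 : {measure set (measurableTypeR R) -> \bar R} := density_measure leb mg g0.
have c1 : (m1 \o F) n @[n --> \oo] --> m1 (\bigcup_n F n).
  by apply: nondecreasing_cvg_mu => //; exact: bigcupT_measurable.
have c2 : (m2 \o F) n @[n --> \oo] --> m2 (\bigcup_n F n).
  by apply: nondecreasing_cvg_mu => //; exact: bigcupT_measurable.
have m12 : m1 \o F = m2 \o F.
  by apply/funext => n; rewrite /= /pushforward /mrestr setIC trunc.
rewrite m12 UF in c1; rewrite UF in c2.
have := cvg_unique _ c1 c2; rewrite /m1 /m2 /= /pushforward /mrestr => <-//.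
congr (leb _); apply/seteqP; split => x /=; last by move=> [[]].
move=> [xpi Bx]; split => //; split => //; move: xpi; rewrite !in_itv/=.
move=> /andP[x0 xpi]; have xI : x \in `[0, pi] by rewrite in_itv/= !ltW.
have c1' : cos x < 1.
  by rewrite -(@cos0 R) ltr_cos// in_itv/= lexx pi_ge0.
have c2' : -1 < cos x.
  by rewrite -(@cospi R) ltr_cos// in_itv/= lexx pi_ge0.
by rewrite /cos_s gtr_pMr// c1' andbT -mulrN1 ltr_pM2l.
Qed.

End cosine_pushforward.

(** * Linear algebra in dimension three *)

Section coordinates.
Context {R : realType}.
Notation V := 'rV[R]_3.

Lemma row30 (a b c : R) : row3 a b c 0 0 = a. Proof. by rewrite mxE. Qed.
Lemma row31 (a b c : R) : row3 a b c 0 1 = b. Proof. by rewrite mxE. Qed.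
Lemma row32 (a b c : R) : row3 a b c 0 2%:R = c. Proof. by rewrite mxE. Qed.
Definition row3_coord := (row30, row31, row32).

Lemma ord3P (P : 'I_3 -> Prop) : P 0 -> P 1 -> P 2%:R -> forall i, P i.
Proof.
move=> P0 P1 P2 [[|[|[|//]]] i3].
- by rewrite (_ : Ordinal i3 = 0)//; exact/val_inj.
- by rewrite (_ : Ordinal i3 = 1)//; exact/val_inj.
- by rewrite (_ : Ordinal i3 = 2%:R)//; exact/val_inj.
Qed.

Lemma row3P (x y : V) :
  x 0 0 = y 0 0 -> x 0 1 = y 0 1 -> x 0 2%:R = y 0 2%:R -> x = y.
Proof. by move=> ? ? ?; apply/rowP; exact: ord3P. Qed.

Lemma sum3E (F : 'I_3 -> R) : \sum_i F i = F 0 + F 1 + F 2%:R.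
Proof.
rewrite !big_ord_recr big_ord0 /= add0r.
by congr (F _ + F _ + F _); exact/val_inj.
Qed.

Lemma dotp_mulmx (x y : V) : dotp x y = (x *m y^T) 0 0.
Proof. by rewrite mxE /dotp; apply: eq_bigr => i _; rewrite !mxE. Qed.

Lemma dotpC (x y : V) : dotp x y = dotp y x.
Proof. by rewrite !dotpE; ring. Qed.

Lemma enorm_sq (x : V) : enorm x ^+ 2 = dotp x x.
Proof. by rewrite sqr_sqrtr// dotpp_ge0. Qed.

Lemma sphereE (x : V) : sphere x = (dotp x x = 1).
Proof.
apply/propext; rewrite /sphere/=; split => h; first by rewrite -enorm_sq h expr1n.
by rewrite /enorm h sqrtr1.
Qed.

Lemma enorm_sphereB (x y : V) : sphere x -> sphere y ->
  enorm (x - y) ^+ 2 = 2 - 2 * dotp x y.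
Proof.
rewrite !sphereE enorm_sq !dotpE !mxE => hx hy.
by lra.
Qed.

Definition mx3 (a b c : V) : 'M[R]_3 := \matrix_(i < 3) nth 0 [:: a; b; c] i.

Lemma mul_mx3 (x a b c : V) :
  x *m mx3 a b c = x 0 0 *: a + x 0 1 *: b + x 0 2%:R *: c.
Proof.
apply/rowP => j; rewrite !mxE sum3E.
by congr (_ * _ + _ * _ + _ * _); rewrite !mxE.
Qed.

Definition orthogonal (M : 'M[R]_3) := M *m M^T = 1%:M.

Lemma orthogonal_mul M N : orthogonal M -> orthogonal N -> orthogonal (M *m N).
Proof.
by rewrite /orthogonal => hM hN; rewrite trmx_mul mulmxA -(mulmxA M) hN mulmx1.
Qed.

Lemma dotp_orthogonal M x y : orthogonal M -> dotp (x *m M) (y *m M) = dotp x y.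
Proof.
by move=> hM; rewrite !dotp_mulmx trmx_mul mulmxA -(mulmxA x) hM mulmx1.
Qed.

Lemma enorm_orthogonal M x : orthogonal M -> enorm (x *m M) = enorm x.
Proof. by move=> hM; rewrite /enorm dotp_orthogonal. Qed.

Lemma mx3_orthogonal a b c : dotp a a = 1 -> dotp b b = 1 -> dotp c c = 1 ->
  dotp a b = 0 -> dotp a c = 0 -> dotp b c = 0 -> orthogonal (mx3 a b c).
Proof.
move=> aa bb cc ab ac bc; apply/matrixP.
have E i j : (mx3 a b c *m (mx3 a b c)^T) i j =
   dotp (nth 0 [:: a; b; c] i) (nth 0 [:: a; b; c] j).
  by rewrite mxE /dotp; apply: eq_bigr => k _; rewrite !mxE.
by elim/ord3P => //; elim/ord3P => //; rewrite E mxE //= dotpC.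
Qed.

Lemma measurable_mulmx (M : 'M[R]_3) : measurable_fun setT (fun x : V => x *m M).
Proof.
apply: measurable_fun_coordV => i.
rewrite (_ : (fun _ => _) = (fun x : V => x 0 0 * M 0 i + x 0 1 * M 1 i
    + x 0 2%:R * M 2%:R i)); last by apply/funext => x; rewrite mxE sum3E.
by apply: measurable_funD; [apply: measurable_funD|]; apply: measurable_funM => //;
  exact: measurable_coordV.
Qed.

Lemma measurable_row3 d (T : measurableType d) (a b c : T -> R) :
  measurable_fun setT a -> measurable_fun setT b -> measurable_fun setT c ->
  measurable_fun setT (fun t => row3 (a t) (b t) (c t)).
Proof.
move=> ma mb mc; apply: measurable_fun_coordV.
by elim/ord3P; under eq_fun do rewrite row3_coord.
Qed.

Lemma unit_circle_angle (x y : R) : x ^+ 2 + y ^+ 2 = 1 ->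
  exists2 t, 0 <= t <= 2 * pi & x = cos t /\ y = sin t.
Proof.
move=> h; have x1 : -1 <= x <= 1.
  by have y2 := sqr_ge0 y; apply/andP; split; nra.
have xI : x \in `[(-1), 1] by rewrite in_itv.
have sE : sin (acos x) = `|y|.
  rewrite sin_acos// -sqrtr_sqr; congr Num.sqrt; lra.
have a0 := acos_ge0 x1; have api := acos_lepi x1.
have pi0 := @pi_gt0 R.
case: (leP 0 y) => y0.
  exists (acos x); first by apply/andP; split; lra.
  by rewrite acosK// sE ger0_norm.
exists (2 * pi - acos x); first by apply/andP; split; lra.
rewrite -[2 * pi - _]opprB cosN sinN mulr_natl.
rewrite -(cosD2pi (_ - _)) -(sinD2pi (_ - _)) subrK acosK// sE ltr0_norm//.
by rewrite opprK.
Qed.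

End coordinates.

(** * The area of the sphere *)

Section cylinder.
Context {R : realType}.
Notation V := 'rV[R]_3.
Notation leb := (@lebesgue_measure R).
Notation mR := (measurableTypeR R).
Notation leb2 := (@lebesgue_measure R \x @lebesgue_measure R)%E.

(** Fubini's theorem for indicator functions, written with slices. *)
Lemma prod_rectE (X Y : set mR) (B : set (mR * mR)) :
  measurable X -> measurable Y -> measurable B ->
  leb2 (B `&` X `*` Y) =
  (\int[leb]_(x in X) leb (Y `&` [set y | B (x, y)]))%E.
Proof.
move=> mX mY mB; rewrite /product_measure1/= [RHS]integral_mkcond.
apply: eq_integral => x _; rewrite patchE.
case: ifPn => [|/negP] xX.
  rewrite inE in xX; congr (leb _); rewrite /xsection; apply/seteqP; split => y /=.
    by rewrite inE/= => -[? []].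
  by rewrite inE/= => -[].
rewrite (_ : xsection _ _ = set0) ?measure0//.
apply/seteqP; split => y //=; rewrite /xsection/= inE/= => -[_ [h _]].
by apply: xX; rewrite inE.
Qed.

Lemma prod_rectE2 (X Y : set mR) (B : set (mR * mR)) :
  measurable X -> measurable Y -> measurable B ->
  leb2 (B `&` X `*` Y) =
  (\int[leb]_(y in Y) leb (X `&` [set x | B (x, y)]))%E.
Proof.
move=> mX mY mB.
have mI : measurable (B `&` X `*` Y) by apply: measurableI => //; exact: measurableX.
have -> : leb2 (B `&` X `*` Y) = (@lebesgue_measure R \x^ @lebesgue_measure R)%E (B `&` X `*` Y).
  by apply: product_measure_unique => // C D mC mD/=; rewrite product_measure2E.
rewrite /product_measure2/= [RHS]integral_mkcond.
apply: eq_integral => y _; rewrite patchE.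
case: ifPn => [|/negP] yY.
  rewrite inE in yY; congr (leb _); rewrite /ysection; apply/seteqP; split => x /=.
    by rewrite inE/= => -[? []].
  by rewrite inE/= => -[].
rewrite (_ : ysection _ _ = set0) ?measure0//.
apply/seteqP; split => x //=; rewrite /ysection/= inE/= => -[_ [_ h]].
by apply: yY; rewrite inE.
Qed.

Definition lat (h : R) : R := Num.sqrt (1 - h ^+ 2).

Definition cyl (p : mR * mR) : V :=
  row3 p.1 (lat p.1 * cos p.2) (lat p.1 * sin p.2).

Lemma measurable_lat : measurable_fun setT lat.
Proof.
apply: (measurableT_comp (f := @Num.sqrt R)).
  by apply: continuous_measurable_fun; exact: sqrt_continuous.
apply: measurable_funB; first exact: measurable_cst.
by apply: measurable_funX; exact: measurable_id.
Qed.

Lemma measurable_cyl : measurable_fun setT cyl.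
Proof.
apply: measurable_row3; first exact: measurable_fst.
  apply: measurable_funM; first exact: (measurableT_comp measurable_lat).
  apply: (measurableT_comp _ measurable_snd).
  by apply: continuous_measurable_fun; exact: continuous_cos.
apply: measurable_funM; first exact: (measurableT_comp measurable_lat).
apply: (measurableT_comp _ measurable_snd).
by apply: continuous_measurable_fun; exact: continuous_sin.
Qed.

Lemma lat_sq h : -1 <= h <= 1 -> lat h ^+ 2 = 1 - h ^+ 2.
Proof. by move=> /andP[? ?]; rewrite sqr_sqrtr//; nra. Qed.

Lemma cyl_sphere h t : -1 <= h <= 1 -> sphere (cyl (h, t)).
Proof.
move=> h1; rewrite sphereE dotpE /cyl !row3_coord/=.
have := cos2Dsin2 t; have := lat_sq h1; move: (lat h) (cos t) (sin t) => l c s.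
by move=> h2 h3; nra.
Qed.

Definition rect : set (mR * mR) := `[-1, 1]%classic `*` `[0, 2 * pi[%classic.

Lemma measurable_rect : measurable rect.
Proof. exact: measurableX. Qed.

(** The area of the sphere, by Archimedes' projection onto the circumscribed
   cylinder. *)
Definition sphere_area : {measure set V -> \bar R} :=
  image_measure (mrestr leb2 measurable_rect) measurable_cyl.

Lemma measurable_preimage_cyl A : measurable A -> measurable (cyl @^-1` A).
Proof. by move=> mA; rewrite -[X in measurable X]setTI; exact: measurable_cyl. Qed.

Lemma sphere_areaE A : measurable A -> sphere_area A =
  (\int[leb]_(h in `[(-1)%R, 1%R])
     leb (`[0%R, (2 * pi)%R[ `&` [set t | A (cyl (h, t))]))%E.
Proof. by move=> mA; apply: prod_rectE => //; exact: measurable_preimage_cyl. Qed.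

Lemma sphere_areaE2 A : measurable A -> sphere_area A =
  (\int[leb]_(t in `[0%R, (2 * pi)%R[)
     leb (`[(-1)%R, 1%R] `&` [set h | A (cyl (h, t))]))%E.
Proof. by move=> mA; apply: prod_rectE2 => //; exact: measurable_preimage_cyl. Qed.

Lemma measurable_sphere : measurable (sphere : set V).
Proof.
rewrite (_ : sphere = (fun x : V => dotp x x) @^-1` [set 1]).
  rewrite -[X in measurable X]setTI.
  suff mf : measurable_fun setT (fun x : V => dotp x x) by apply: mf.
  under eq_fun do rewrite dotpE.
  apply: measurable_funD; [apply: measurable_funD|]; apply: measurable_funM;
    exact: measurable_coordV.
by apply/seteqP; split => x /=; rewrite sphereE.
Qed.

Lemma sphere_areaT : sphere_area setT = (4 * pi)%:E.
Proof.
rewrite sphere_areaE//.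
rewrite (eq_integral (fun=> (2 * pi)%:E)); last first.
  move=> h _; rewrite setIidl//.
  rewrite lebesgue_measure_itv/= lte_fin mulr_gt0 ?pi_gt0//.
  by rewrite -EFinB subr0.
rewrite integral_cst//= lebesgue_measure_itv/= lte_fin ifT; last by lra.
by rewrite -EFinB -EFinM; congr (_%:E); lra.
Qed.

Lemma sphere_area_sphere A : measurable A ->
  sphere_area (A `&` sphere) = sphere_area A.
Proof.
move=> mA; rewrite !sphere_areaE//; last by apply: measurableI => //; exact: measurable_sphere.
apply: eq_integral => h; rewrite inE/= in_itv/= => h1.
by congr (leb (_ `&` _)); apply/seteqP; split => t /= => [[]//|?]; split => //;
  exact: cyl_sphere.
Qed.

Lemma sphere_area_lty A : measurable A -> (sphere_area A < +oo)%E.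
Proof.
move=> mA; apply: (@le_lt_trans _ _ (sphere_area setT)).
  by apply: le_measure; rewrite ?inE.
by rewrite sphere_areaT ltry.
Qed.

Definition area_preserving (f : V -> V) :=
  forall A, measurable A -> sphere_area (f @^-1` A) = sphere_area A.

Lemma area_preserving_comp f g : measurable_fun setT f -> measurable_fun setT g ->
  area_preserving f -> area_preserving g -> area_preserving (f \o g).
Proof.
move=> mf mg hf hg A mA; rewrite comp_preimage hg ?hf//.
by rewrite -[X in measurable X]setTI; exact: mf.
Qed.

Definition axial_rot (u v : R) : 'M[R]_3 :=
  mx3 (row3 1 0 0) (row3 0 u v) (row3 0 (- v) u).

Lemma mul_axial_rot (x : V) u v : x *m axial_rot u v =
  row3 (x 0 0) (x 0 1 * u - x 0 2%:R * v) (x 0 1 * v + x 0 2%:R * u).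
Proof.
by rewrite mul_mx3; apply: row3P; rewrite !mxE /=; ring.
Qed.

Lemma axial_rot_orthogonal u v : u ^+ 2 + v ^+ 2 = 1 -> orthogonal (axial_rot u v).
Proof.
by move=> h; apply: mx3_orthogonal; rewrite dotpE !row3_coord; lra.
Qed.

(** Rotating about the first axis shifts the longitude. *)
Lemma axial_rot_area u v : u ^+ 2 + v ^+ 2 = 1 ->
  area_preserving (fun x => x *m axial_rot u v).
Proof.
move=> /unit_circle_angle[a a2pi [-> ->]] A mA.
have mf := measurable_mulmx (axial_rot (cos a) (sin a)).
have mfA : measurable ((fun x : V => x *m axial_rot (cos a) (sin a)) @^-1` A).
  by rewrite -[X in measurable X]setTI; exact: mf.
rewrite !sphere_areaE//; apply: eq_integral => h _.
pose B : set mR := [set t | A (cyl (h, t))].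
have mB : measurable B.
  rewrite -[X in measurable X]setTI.
  have mc : measurable_fun [set: mR] (fun t : mR => cyl (h, t)).
    exact: measurable_fun_pair2 measurable_cyl.
  exact: mc.
rewrite -(@lebesgue_measure_circle_shift _ (2 * pi) a B)//; last first.
  move=> t; rewrite /B/= /cyl/=.
  by rewrite mulr_natl cosD2pi sinD2pi.
have E t : cyl (h, t) *m axial_rot (cos a) (sin a) = cyl (h, t + a).
  rewrite mul_axial_rot /cyl !row3_coord/= cosD sinD.
  by congr row3; ring.
by congr (leb (_ `&` _)); apply/seteqP; split => t /=; rewrite E.
Qed.

End cylinder.

(** * Invariance of the area *)

Section swap.
Context {R : realType}.
Notation V := 'rV[R]_3.
Notation leb := (@lebesgue_measure R).
Notation mR := (measurableTypeR R).
Notation leb2 := (@lebesgue_measure R \x @lebesgue_measure R)%E.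

Let zco (p : mR * mR) : R := Num.sqrt (1 - p.1 ^+ 2 - p.2 ^+ 2).
Let lift (p : mR * mR) : V := row3 p.1 p.2 (zco p).
Let disk : set (mR * mR) := [set p | p.1 ^+ 2 + p.2 ^+ 2 < 1].
Let dens A (p : mR * mR) : R := \1_(disk `&` lift @^-1` A) p * (zco p)^-1.

Let msq : measurable_fun setT (fun p : mR * mR => 1 - p.1 ^+ 2 - p.2 ^+ 2).
Proof.
apply: measurable_funB; [apply: measurable_funB; first exact: measurable_cst|];
  apply: measurable_funX; [exact: measurable_fst|exact: measurable_snd].
Qed.

Let mlift : measurable_fun setT lift.
Proof.
apply: measurable_row3; [exact: measurable_fst|exact: measurable_snd|].
apply: (measurableT_comp _ msq); apply: continuous_measurable_fun.
exact: sqrt_continuous.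
Qed.

Let mdisk : measurable disk.
Proof.
rewrite (_ : disk = (fun p : mR * mR => 1 - p.1 ^+ 2 - p.2 ^+ 2) @^-1` `]0, +oo[).
  by rewrite -[X in measurable X]setTI; exact: msq.
apply/seteqP; split => p; rewrite /disk/= in_itv/= andbT; lra.
Qed.

Let mdens A : measurable A -> measurable_fun setT (dens A).
Proof.
move=> mA; apply: measurable_funM; last exact: measurable_inv_sqrt.
apply: measurable_indic; apply: measurableI => //.
by rewrite -[X in measurable X]setTI; exact: mlift.
Qed.

Let dens0 A p : 0 <= dens A p.
Proof. by rewrite mulr_ge0// ?invr_ge0 ?sqrtr_ge0// indicE. Qed.

Let upper : set V := [set x | 0 < x 0 2%:R].
Let lower : set V := [set x | x 0 2%:R < 0].

Let mupper : measurable upper.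
Proof.
rewrite (_ : upper = (fun x : V => x 0 2%:R) @^-1` `]0, +oo[).
  by rewrite -[X in measurable X]setTI; exact: measurable_coordV.
by apply/seteqP; split => x; rewrite /upper/= in_itv/= andbT.
Qed.

Let mlower : measurable lower.
Proof.
rewrite (_ : lower = (fun x : V => x 0 2%:R) @^-1` `]-oo, 0[).
  by rewrite -[X in measurable X]setTI; exact: measurable_coordV.
by apply/seteqP; split => x; rewrite /lower/= in_itv/=.
Qed.

Lemma sin_gt0_itv (t : R) : 0 <= t < 2 * pi -> (0 < sin t) = (0 < t < pi).
Proof.
move=> /andP[t0 t2]; apply/idP/idP => [st|]; last exact: sin_gt0_pi.
rewrite lt_neqAle t0 andbT; apply/andP; split.
  by apply/eqP => t00; move: st; rewrite -t00 sin0 ltxx.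
rewrite ltNge; apply/negP => pit.
have : 0 <= sin (t - pi) by apply: sin_ge0_pi; apply/andP; split; lra.
by rewrite -[t in sin t](subrK pi) sinDpi in st; lra.
Qed.

Let upper_area A : measurable A -> sphere_area (A `&` upper) =
  (\int[leb]_h \int[leb]_y (dens A (h, y))%:E)%E.
Proof.
move=> mA; rewrite sphere_areaE; last exact: measurableI.
rewrite integral_mkcond; apply: eq_integral => h _; rewrite patchE.
have [hI|hI] := boolP (-1 < h < 1); last first.
  rewrite (@integral0_eq _ _ _ _ _ (fun y : mR => (dens A (h, y))%:E)).
    case: ifPn => //; rewrite inE/= in_itv/= => h1.
    rewrite (_ : _ `&` _ = set0) ?measure0//.
    apply/seteqP; split => t //= -[_ [_]].
    rewrite /upper/= /cyl row3_coord/= (_ : lat h = 0) ?mul0r ?ltxx//.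
    rewrite /lat; apply/eqP; rewrite sqrtr_eq0.
    by move: hI => /negP; case: (ltgtP h 1) h1; case: (ltgtP (-1) h) => //; nra.
  move=> y _; congr (_%:E); rewrite /dens indicE memNset ?mul0r// /disk/= => -[h1 _].
  apply: (negP hI); have := sqr_ge0 y; nra.
have hI' : h \in `[-1, 1]%classic by rewrite inE/= in_itv/=; lra.
rewrite hI'.
have hh : -1 <= h <= 1 by lra.
have s0 : 0 < lat h by rewrite sqrtr_gt0; nra.
pose B : set R := [set y | A (lift (h, y))].
have mB : measurable B.
  rewrite -[X in measurable X]setTI.
  have mc : measurable_fun [set: mR] (fun t : mR => lift (h, t)).
    exact: measurable_fun_pair2 mlift.
  exact: mc.
have -> : `[0, 2 * pi[ `&` [set t | (A `&` upper) (cyl (h, t))] =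
    `]0, pi[ `&` (fun t => lat h * cos t) @^-1` B.
  have E t : 0 < t < pi -> lift (h, lat h * cos t) = cyl (h, t).
    move=> t0; rewrite /lift /cyl; congr row3; rewrite /zco/=.
    have st := sin_gt0_pi t0.
    rewrite -[RHS]ger0_norm ?mulr_ge0 ?ltW// -sqrtr_sqr; congr Num.sqrt.
    by rewrite !exprMn lat_sq// sin2cos2; ring.
  have pi0 := @pi_gt0 R.
  apply/seteqP; split => t /=; rewrite !in_itv/=.
    move=> [t0 [At]]; rewrite /upper/= /cyl row3_coord/= pmulr_rgt0// sin_gt0_itv//.
    by move=> t1; split => //; rewrite /B/= E.
  move=> [t0]; rewrite /B/= E// => At; split; first by lra.
  by split => //; rewrite /upper/= /cyl row3_coord/= mulr_gt0// sin_gt0_pi.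
rewrite lebesgue_measure_cos// integral_mkcond.
apply: eq_integral => y _; rewrite patchE /dens indicE.
have -> : (y \in `](- lat h)%R, (lat h)%R[ `&` B) =
    ((h, y) \in disk `&` lift @^-1` A).
  apply/idP/idP; rewrite !inE /= /disk/= in_itv/= => -[h1 h2]; split => //.
    by have := lat_sq hh; nra.
  by have := lat_sq hh; move=> h3; apply/andP; split; nra.
case: ifP => _; last by rewrite mul0r.
by rewrite mul1r /zco/= lat_sq.
Qed.

Let mirror (x : V) := row3 (x 0 0) (x 0 1) (- x 0 2%:R).

Let mmirror : measurable_fun setT mirror.
Proof.
apply: measurable_row3; try exact: measurable_coordV.
by apply: measurable_funN; exact: measurable_coordV.
Qed.

Let measurable_slice A h : measurable A -> measurable [set t : mR | A (cyl (h, t))].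
Proof.
move=> mA; rewrite -[X in measurable X]setTI.
have mc : measurable_fun [set: mR] (fun t : mR => cyl (h, t)).
  exact: measurable_fun_pair2 measurable_cyl.
exact: mc.
Qed.

Let flip_itv (t : R) : sin t != 0 ->
  (0 <= - (t - pi *+ 2) < pi *+ 2) = (0 <= t < pi *+ 2).
Proof.
move=> st; have : t != 0 by apply: contra_neq st => ->; rewrite sin0.
have : t != pi *+ 2.
  by apply: contra_neq st => ->; rewrite -[_ *+ _]add0r sinD2pi sin0.
move: (@pi R) => p; rewrite !neq_lt => /orP[t1|t1] /orP[t0|t0];
  by apply/idP/idP => /andP[? ?]; apply/andP; split; lra.
Qed.

Let lower_area A : measurable A ->
  sphere_area (A `&` lower) = sphere_area (mirror @^-1` A `&` upper).
Proof.
move=> mA.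
have mmA : measurable (mirror @^-1` A).
  by rewrite -[X in measurable X]setTI; exact: mmirror.
rewrite !sphere_areaE; [|exact: measurableI..].
apply: eq_integral => h _.
rewrite -(@lebesgue_measure_flip _ (2 * pi)); last first.
  apply: measurableI => //; apply: measurable_slice; exact: measurableI.
congr (leb _); apply/seteqP; split => t /=;
  rewrite !in_itv/= /mirror /cyl /lower /upper/= !row3_coord/=
    -[2 * pi - t]opprB cosN sinN mulr_natl
    -(cosD2pi (t - _)) -(sinD2pi (t - _)) subrK.
  move=> [h1 [h2 h3]]; have t0 : sin t != 0 by apply/eqP => t0; move: h3; rewrite t0; lra.
  by split; [rewrite -(flip_itv t0)|rewrite -mulrN; split => //; lra].
move=> [h1 [h2 h3]]; have t0 : sin t != 0 by apply/eqP => t0; move: h3; rewrite t0; lra.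
by split; [rewrite (flip_itv t0)|rewrite mulrN; split => //; lra].
Qed.

(** Needed because the formula of [swap12_area] is obtained separately on the
    two open hemispheres. *)
Lemma equator_area (A : set V) : measurable A ->
  (forall x, A x -> x 0 2%:R = 0) -> sphere_area A = 0%E.
Proof.
move=> mA A2.
have mB : measurable (cyl @^-1` A `&` rect).
  by apply: measurableI; [exact: measurable_preimage_cyl|exact: measurable_rect].
rewrite -[LHS]/(\int[leb]_h leb (xsection (cyl @^-1` A `&` rect) h))%E.
rewrite (ae_eq_integral (cst 0%E)) ?integral0//.
  exact: measurable_fun_xsection.
exists [set -1; 1]; split.
- exact: measurableU.
- exact/countable_lebesgue_measure0/finite_set_countable.
- move=> h /=; apply: contra_notP => /not_orP[/eqP h1 /eqP h2] _.
  have [hI|hI] := boolP (-1 < h < 1); last first.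
    rewrite (_ : xsection _ _ = set0) ?measure0//.
    apply/seteqP; split => t //=; rewrite /xsection/= inE/= => -[_ [+ _]].
    rewrite /= in_itv/= => ?; apply: (negP hI).
    by rewrite !lt_neqAle h2 eq_sym h1.
  apply: (@subset_measure0 _ _ _ leb _ [set 0; pi]).
  + exact: measurable_xsection.
  + exact: measurableU.
  + move=> t; rewrite /xsection/= inE/= => -[/A2]; rewrite /cyl row3_coord/=.
    move=> /eqP; rewrite mulf_eq0 gt_eqF/=; last by rewrite sqrtr_gt0; nra.
    move=> /eqP st [_ ] /=; rewrite in_itv/= => t02.
    have := sin_gt0_itv t02; rewrite st ltxx => /esym/negbT h0.
    have [->|t0] := eqVneq t 0; first by left.
    have [->|tpi] := eqVneq t pi; first by right.
    exfalso; have /sin_gt0_pi : 0 < t - pi < pi.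
      by move: h0 t0 tpi; case: (ltgtP t 0); case: (ltgtP t pi) => //; lra.
    by have := sinDpi (t - pi); rewrite subrK st; lra.
  + exact/countable_lebesgue_measure0/finite_set_countable.
Qed.

Let area_split A : measurable A -> sphere_area A =
  (sphere_area (A `&` upper) + sphere_area (mirror @^-1` A `&` upper))%E.
Proof.
move=> mA; rewrite -lower_area//.
pose E : set V := A `\` (upper `|` lower).
have mU : measurable (A `&` upper) by exact: measurableI.
have mL : measurable (A `&` lower) by exact: measurableI.
have mE : measurable E by apply: measurableD => //; exact: measurableU.
rewrite -measureU//; last first.
  by rewrite -subset0 => x [[_]]; rewrite /upper /lower/= => ? [_]/=; lra.
have -> : A `&` upper `|` A `&` lower = A `\` E.
  rewrite /E setDD -setIUr.
  by [].
rewrite -[in LHS](setDUK (_ : E `<=` A)); last by move=> x [].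
rewrite measureU//; last 2 first.
- exact: measurableD.
- by rewrite setDIK.
rewrite [X in (X + _)%E]equator_area ?add0e// => x [_].
by rewrite /upper /lower/= => /not_orP[]; case: ltgtP.
Qed.

Definition swap12 : 'M[R]_3 := mx3 (row3 0 1 0) (row3 1 0 0) (row3 0 0 1).

Lemma mul_swap12 (x : V) : x *m swap12 = row3 (x 0 1) (x 0 0) (x 0 2%:R).
Proof. by rewrite mul_mx3; apply: row3P; rewrite !mxE /=; ring. Qed.

Lemma swap12_orthogonal : orthogonal swap12.
Proof. by apply: mx3_orthogonal; rewrite dotpE !row3_coord; lra. Qed.

Let upper_swap A : measurable A ->
  sphere_area ((fun x => x *m swap12) @^-1` A `&` upper) = sphere_area (A `&` upper).
Proof.
move=> mA.
have mSA : measurable ((fun x : V => x *m swap12) @^-1` A).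
  by rewrite -[X in measurable X]setTI; exact: measurable_mulmx.
rewrite (upper_area mSA) (upper_area mA).
rewrite [RHS](fubini_tonelli (EFin \o dens A)); last 2 first.
- by apply/measurable_EFinP; exact: mdens.
- by move=> p; rewrite lee_fin.
apply: eq_integral => h _; apply: eq_integral => y _; congr (_%:E).
have zE : zco (h, y) = zco (y, h) by rewrite /zco/=; congr Num.sqrt; ring.
rewrite /dens zE !indicE; congr (_%:R * _); congr (nat_of_bool _).
by apply/idP/idP; rewrite !inE /disk /lift/= mul_swap12 !row3_coord zE addrC.
Qed.

(** Seen from above, the area element of a hemisphere is symmetric in the two
   horizontal coordinates. *)
Lemma swap12_area : area_preserving (fun x => x *m swap12).
Proof.
move=> A mA.
have mmA : measurable (mirror @^-1` A).
  by rewrite -[X in measurable X]setTI; exact: mmirror.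
have mSA : measurable ((fun x : V => x *m swap12) @^-1` A).
  by rewrite -[X in measurable X]setTI; exact: measurable_mulmx.
rewrite (area_split mSA) (area_split mA) -(upper_swap mA) -(upper_swap mmA).
suff -> : mirror @^-1` ((fun x : V => x *m swap12) @^-1` A) =
    (fun x : V => x *m swap12) @^-1` (mirror @^-1` A) by [].
by apply/seteqP; split => x /=; rewrite /mirror !mul_swap12 !row3_coord.
Qed.

End swap.

(** * The isodiametric inequality on the sphere *)

Section frames.
Context {R : realType}.
Notation V := 'rV[R]_3.

Lemma continuous_dotp (c : V) : continuous (fun x : V => dotp x c).
Proof.
rewrite (_ : (fun _ => _) = (fun x : V => x 0 0 * c 0 0 + x 0 1 * c 0 1 +
    x 0 2%:R * c 0 2%:R)); last by apply/funext => x; rewrite dotpE.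
have ci i : continuous (fun y : V => y 0 i) by exact: coord_continuous.
have h i : continuous (fun y : V => y 0 i * c 0 i).
  by move=> x; apply: continuousM; [exact: ci|exact: cst_continuous].
by move=> x; exact: continuousD (continuousD (h 0 x) (h 1 x)) (h 2%:R x).
Qed.

Definition area_isometry (M : 'M[R]_3) :=
  orthogonal M /\ area_preserving (fun x => x *m M).

Lemma area_isometry_mul M N : area_isometry M -> area_isometry N ->
  area_isometry (M *m N).
Proof.
move=> [oM aM] [oN aN]; split; first exact: orthogonal_mul.
rewrite (_ : (fun x : V => x *m (M *m N)) = (fun x : V => x *m N) \o (fun x => x *m M)).
  by apply: area_preserving_comp => //; exact: measurable_mulmx.
by apply/funext => x /=; rewrite mulmxA.
Qed.

Lemma area_isometry_axial u v : u ^+ 2 + v ^+ 2 = 1 -> area_isometry (axial_rot u v).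
Proof. by move=> h; split; [exact: axial_rot_orthogonal|exact: axial_rot_area]. Qed.

Lemma area_isometry_swap : area_isometry (swap12 : 'M[R]_3).
Proof. by split; [exact: swap12_orthogonal|exact: swap12_area]. Qed.

Lemma axial_rot_ex (b c : R) : exists u v, [/\ u ^+ 2 + v ^+ 2 = 1,
  b * u - c * v = 0 & b * v + c * u = Num.sqrt (b ^+ 2 + c ^+ 2)].
Proof.
have [h|h] := eqVneq (b ^+ 2 + c ^+ 2) 0.
  exists 1, 0; rewrite h sqrtr0 expr1n expr0n addr0.
  by have := sqr_ge0 b; have := sqr_ge0 c => ? ?; split=> //; nra.
have h0 : 0 < b ^+ 2 + c ^+ 2 by rewrite lt_neqAle eq_sym h addr_ge0 ?sqr_ge0.
set r := Num.sqrt _; have r0 : r != 0 by rewrite gt_eqF// sqrtr_gt0.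
have rE : r ^+ 2 = b ^+ 2 + c ^+ 2 by rewrite sqr_sqrtr// ltW.
exists (c / r), (b / r); split.
- by rewrite !exprMn -mulrDl addrC -rE -exprMn divff// expr1n.
- by field.
- by apply: (mulIf r0); rewrite -[RHS]expr2 rE; field.
Qed.

(** Composition of rotations about the first axis and of exchanges of the
    first two axes, which generate enough rotations and preserve the area. *)
Lemma orthonormal_to_axes (P N : V) : dotp P P = 1 -> dotp N N = 1 ->
  dotp P N = 0 -> exists M, [/\ area_isometry M, P *m M = row3 1 0 0 &
    N *m M = row3 0 0 1].
Proof.
move=> PP NN PN.
have [u [v [uv uv0 uvr]]] := axial_rot_ex (P 0 1) (P 0 2%:R).
set r := Num.sqrt _ in uvr.
have rE : r ^+ 2 = P 0 1 ^+ 2 + P 0 2%:R ^+ 2 by rewrite sqr_sqrtr// addr_ge0 ?sqr_ge0.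
have h1 : P 0 0 ^+ 2 + (- r) ^+ 2 = 1.
  by rewrite sqrrN rE -PP dotpE; ring.
pose M1 := axial_rot u v *m swap12 *m axial_rot (P 0 0) (- r) *m swap12.
have iM1 : area_isometry M1.
  apply: area_isometry_mul (area_isometry_swap); apply: area_isometry_mul.
    by apply: area_isometry_mul (area_isometry_swap); exact: area_isometry_axial.
  exact: area_isometry_axial.
have PM1 : P *m M1 = row3 1 0 0.
  rewrite /M1 !mulmxA (mul_axial_rot P) uv0 uvr (mul_swap12 (row3 _ _ _)).
  rewrite !row3_coord mul_axial_rot !row3_coord mul_swap12 !row3_coord.
  by rewrite sqrrN in h1; congr row3; nra.
have n0 : (N *m M1) 0 0 = 0.
  have := dotp_orthogonal P N iM1.1; rewrite PN PM1 dotpE !row3_coord.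
  by rewrite mul1r !mul0r !addr0.
have nn : (N *m M1) 0 1 ^+ 2 + (N *m M1) 0 2%:R ^+ 2 = 1.
  by rewrite -NN -(dotp_orthogonal N N iM1.1) dotpE n0; ring.
have [u' [v' [uv' uv0' uvr']]] := axial_rot_ex ((N *m M1) 0 1) ((N *m M1) 0 2%:R).
exists (M1 *m axial_rot u' v'); split.
- by apply: area_isometry_mul; [exact: iM1|exact: area_isometry_axial].
- rewrite mulmxA PM1 mul_axial_rot !row3_coord.
  by congr row3; ring.
- by rewrite mulmxA mul_axial_rot n0 uv0' uvr' nn sqrtr1.
Qed.

End frames.

Section isodiametric.
Context {R : realType}.
Notation V := 'rV[R]_3.
Notation leb := (@lebesgue_measure R).
Notation mR := (measurableTypeR R).

(** Each slice lies between its infimum and $1$, so that the two lengths are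
    controlled by the pair of lowest points. *)
Lemma slices_le (S1 S2 : set R) (B : R) : measurable S1 -> measurable S2 ->
  S1 `<=` `[-1, 1] -> S2 `<=` `[-1, 1] -> S1 1 -> S2 1 ->
  (forall h1 h2, S1 h1 -> S2 h2 -> (1 - h1) + (1 - h2) <= B) ->
  (leb S1 + leb S2 <= B%:E)%E.
Proof.
move=> mS1 mS2 s1 s2 S11 S21 hB.
have bnd (S : set R) : measurable S -> S `<=` `[-1, 1] -> S 1 ->
    (leb S <= (1 - inf S)%:E)%E.
  move=> mS sS S1'; have lS : has_lbound S.
    by exists (-1) => x /sS /=; rewrite in_itv/= => /andP[].
  apply: (@le_trans _ _ (leb `[inf S, 1]%classic)).
    apply: le_measure; rewrite ?inE//= => x Sx /=.
    by rewrite in_itv/= ge_inf//=; have := sS _ Sx; rewrite /= in_itv/= => /andP[].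
  rewrite lebesgue_measure_itv/= lte_fin; case: ifP => _; rewrite -?EFinB//.
  by rewrite lee_fin subr_ge0 ge_inf.
apply: le_trans (leeD (bnd _ mS1 s1 S11) (bnd _ mS2 s2 S21)) _.
rewrite -EFinD lee_fin.
have i2 h1 : S1 h1 -> 2 - B - h1 <= inf S2.
  move=> Sh1; apply: lb_le_inf; first by exists 1.
  by move=> h2 Sh2; have := hB _ _ Sh1 Sh2; lra.
have i1 : 2 - B - inf S2 <= inf S1.
  by apply: lb_le_inf => [|h1 Sh1]; [exists 1|have := i2 _ Sh1; lra].
lra.
Qed.

Let slice (A : set V) (t : R) : set mR := `[-1, 1] `&` [set h | A (cyl (h, t))].

Let measurable_slice A t : measurable A -> measurable (slice A t).
Proof.
move=> mA; apply: measurableI => //; rewrite -[X in measurable X]setTI.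
have mc : measurable_fun [set: mR] (fun h : mR => cyl (h, t)).
  exact: measurable_fun_pair1 measurable_cyl.
exact: mc.
Qed.

Let measurable_fun_slice A : measurable A ->
  measurable_fun setT (fun t : mR => leb (slice A t)).
Proof.
move=> mA.
have mB : measurable (cyl @^-1` A `&` (`[-1, 1]%classic `*` setT) : set (mR * mR)).
  apply: measurableI; [exact: measurable_preimage_cyl|exact: measurableX].
have := measurable_fun_ysection leb mB.
rewrite (_ : _ \o _ = (fun t : mR => leb (slice A t)))//.
apply/funext => t /=; congr (leb _); rewrite /ysection /slice.
by apply/seteqP; split => h /=; rewrite inE/=; [move=> [? []]|move=> [? ?]].
Qed.

Let quarter (t : R) : 0 <= t < 2 * pi -> 0 <= cos t -> 0 <= sin t -> t \in `[0, pi / 2].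
Proof.
move=> /andP[t0 t2] ct st; have pi0 := @pi_gt0 R; rewrite in_itv/= t0/=.
have tpi : t <= pi.
  rewrite leNgt; apply/negP => pit.
  have : 0 < sin (t - pi) by apply: sin_gt0_pi; apply/andP; split; lra.
  by move: st; rewrite -[t in sin t](subrK pi) sinDpi; lra.
rewrite leNgt; apply/negP => h.
suff : cos t < cos (pi / 2) by rewrite cos_pihalf; lra.
by rewrite ltr_cos// in_itv/=; apply/andP; split; lra.
Qed.

Let poles (h : R) : -1 <= h <= 1 -> ~~ (-1 < h < 1) -> [set -1; 1] h.
Proof.
move=> /andP[h1 h2]; have [->|/eqP ?] := eqVneq h 1; first by right.
move=> /negP hI; left; apply/eqP; rewrite eq_le h1 andbT leNgt; apply/negP => h3.
by apply: hI; rewrite h3/= lt_neqAle h2 andbT; apply/eqP.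
Qed.

Let slice_null A t : measurable A -> (forall h, -1 < h < 1 -> ~ A (cyl (h, t))) ->
  leb (slice A t) = 0%E.
Proof.
move=> mA hA; apply: (@subset_measure0 _ _ _ leb _ [set -1; 1]).
- exact: measurable_slice.
- exact: measurableU.
- move=> h [/=]; rewrite in_itv/= => h1 Ah.
  have [hI|hI] := boolP (-1 < h < 1); first by case: (hA h).
  exact: poles.
- exact/countable_lebesgue_measure0/finite_set_countable.
Qed.

(** In the half space above a plane through the pole, split by longitude into
   two quarters and turn one onto the other.  Two points on orthogonal
   meridians, at heights h1 and h2, have scalar product h1 h2, so the two
   slices at the same longitude have a short total length. *)
Let polar_area_le (A : set V) (q : R) : measurable A -> 0 <= q <= 2^-1 ->
  A (row3 1 0 0) -> (forall x, A x -> 0 <= x 0 2%:R) ->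
  (forall x y, A x -> A y -> 1 - q <= dotp x y) ->
  (sphere_area A <= (pi / 2 * (q / (1 - q / 2)))%:E)%E.
Proof.
move=> mA /andP[q0 q1] Ae A2 Aq.
pose A1 := A `&` [set x | 0 <= x 0 1].
pose A2' := A `&` [set x | x 0 1 <= 0].
pose B := (fun x => x *m axial_rot 0 1) @^-1` A2'.
have m1 : measurable ([set x : V | 0 <= x 0 1]).
  rewrite (_ : mkset _ = (fun x : V => x 0 1) @^-1` `[0, +oo[).
    by rewrite -[X in measurable X]setTI; exact: measurable_coordV.
  by apply/seteqP; split => x /=; rewrite in_itv/= andbT.
have m2 : measurable ([set x : V | x 0 1 <= 0]).
  rewrite (_ : mkset _ = (fun x : V => x 0 1) @^-1` `]-oo, 0]).
    by rewrite -[X in measurable X]setTI; exact: measurable_coordV.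
  by apply/seteqP; split => x /=; rewrite in_itv/=.
have mA1 : measurable A1 by exact: measurableI.
have mA2 : measurable A2' by exact: measurableI.
have mB : measurable B by rewrite -[X in measurable X]setTI; exact: measurable_mulmx.
have AU : A `<=` A1 `|` A2'.
  by move=> x Ax; case: (leP 0 (x 0 1)) => h; [left|right]; split => //=; exact: ltW.
have -> : (sphere_area A <= (pi / 2 * (q / (1 - q / 2)))%:E)%E =
   (sphere_area A <= (q / (1 - q / 2))%:E * (pi / 2)%:E)%E.
  by rewrite -EFinM mulrC.
apply: (@le_trans _ _ (sphere_area A1 + sphere_area B)%E).
  rewrite (axial_rot_area _ mA2) ?expr0n ?expr1n ?add0r//.
  apply: le_trans (measureU2 _ mA1 mA2).
  by apply: le_measure => //; rewrite inE//; exact: measurableU.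
rewrite !sphere_areaE2//.
have mS1 := measurable_fun_slice mA1; have mSB := measurable_fun_slice mB.
rewrite -ge0_integralD//; [|exact: measurable_funTS mS1|exact: measurable_funTS mSB].
have pi0 := @pi_gt0 R.
have -> : ((q / (1 - q / 2))%:E * (pi / 2)%:E =
    \int[leb]_(t in `[0%R, (2 * pi)%R[) ((q / (1 - q / 2)) * \1_(`[0, pi / 2]%classic : set R) t)%:E)%E.
  under eq_integral do rewrite EFinM.
  rewrite ge0_integralZl//; last 2 first.
  - by apply/measurable_EFinP; exact: measurable_indic.
  - by rewrite lee_fin divr_ge0//; lra.
  rewrite integral_indic// setIidl; last first.
    by move=> x /=; rewrite !in_itv/= => /andP[? ?]; apply/andP; split; lra.
  congr (_ * _)%E; symmetry.
  apply: etrans (@lebesgue_measure_itv R `[0, pi / 2]) _.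
  by rewrite /= lte_fin divr_gt0// -EFinB subr0.
apply: ge0_le_integral => //.
- by move=> t _; rewrite adde_ge0.
- by apply: emeasurable_funD; [exact: measurable_funTS mS1|exact: measurable_funTS mSB].
- by apply/measurable_EFinP; apply: measurable_funM => //; apply: measurable_indic.
move=> t; rewrite /= in_itv/= => t02.
have BE x : B x <-> A (row3 (x 0 0) (- x 0 2%:R) (x 0 1)) /\ 0 <= x 0 2%:R.
  rewrite /B/= /A2' mul_axial_rot !mulr0 !mulr1 sub0r addr0 /= row3_coord.
  by rewrite oppr_le0.
have latp (h : R) : -1 < h < 1 -> 0 < lat h by move=> h1; rewrite sqrtr_gt0; nra.
rewrite indicE; have [tI|/negP tI] := boolP (t \in (`[0, pi / 2]%classic : set R)); last first.
  rewrite !slice_null ?adde0 ?mulr0// => h h1.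
    move=> /BE[/A2]; rewrite /cyl !row3_coord/= !pmulr_rge0 ?latp// => h2 h3.
    by apply: tI; rewrite inE/=; exact: quarter.
  move=> [/A2]; rewrite /cyl /= !row3_coord/= !pmulr_rge0 ?latp// => h2 h3.
  by apply: tI; rewrite inE/=; exact: quarter.
have l1 : lat 1 = 0 :> R by rewrite /lat expr1n subrr sqrtr0.
rewrite mulr1; apply: slices_le.
- exact: measurable_slice.
- exact: measurable_slice.
- by move=> h [].
- by move=> h [].
- split; first by rewrite /= in_itv/=; lra.
  by rewrite /A1 /cyl /= l1 !mul0r row3_coord.
- split; first by rewrite /= in_itv/=; lra.
  by apply/BE; rewrite /cyl /= l1 !mul0r !row3_coord oppr0.
move=> h1 h2 [h1I [Ah1 _]] [h2I /BE[Ah2 _]].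
have := Aq _ _ Ah1 Ah2; have := Aq _ _ Ah1 Ae; have := Aq _ _ Ah2 Ae.
rewrite !dotpE /cyl/= !row3_coord => k1 k2 k3.
have k : 1 - q <= h1 * h2 by lra.
move: h1I h2I; rewrite /= !in_itv/= => h1I h2I.
have q2 : 0 < 1 - q / 2 by lra.
rewrite ler_pdivlMr//; nra.
Qed.

(** The isodiametric inequality on the sphere, up to a factor close to one.
   The pole is put at a point of K that lies on a great circle having K on one
   side: such a point minimizes the slope (x, b) / (x, a). *)
Lemma isodiametric_sphere (K : set V) (d : R) : compact K -> K `<=` sphere ->
  0 <= d <= 1 -> (forall x y, K x -> K y -> enorm (x - y) <= d) ->
  ((1 - d ^+ 2 / 4)%:E * sphere_area K <= (pi / 4 * d ^+ 2)%:E)%E.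
Proof.
move=> cK Ks /andP[d0 d1] Kd.
have mK : measurable K.
  by apply: measurable_closedV; apply: compact_closed => //; exact: norm_hausdorff.
have pi0 := @pi_gt0 R.
have [->|/set0P[a Ka]] := eqVneq K set0.
  by rewrite measure0 mule0 lee_fin mulr_ge0 ?sqr_ge0//; lra.
have Kdot x y : K x -> K y -> 1 - d ^+ 2 / 2 <= dotp x y.
  move=> Kx Ky; have := enorm_sphereB (Ks _ Kx) (Ks _ Ky).
  have := Kd _ _ Kx Ky; have := enorm_ge0 (x - y); nra.
have aa : dotp a a = 1 by rewrite -sphereE; exact: Ks.
have [b [b0 ab]] : exists b : V, 0 < dotp b b /\ dotp a b = 0.
  have [h|h] := eqVneq (a 0 0 ^+ 2 + a 0 1 ^+ 2) 0.
    exists (row3 1 0 0); rewrite !dotpE !row3_coord; split; first lra.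
    by have := sqr_ge0 (a 0 0); have := sqr_ge0 (a 0 1) => ? ?; nra.
  exists (row3 (- a 0 1) (a 0 0) 0); rewrite !dotpE !row3_coord; split; last by ring.
  suff : 0 < a 0 0 ^+ 2 + a 0 1 ^+ 2 by lra.
  by rewrite lt_neqAle eq_sym h addr_ge0 ?sqr_ge0.
have d2 : d ^+ 2 / 2 <= 2^-1 by nra.
have pos x : K x -> 0 < dotp x a by move=> Kx; have := Kdot _ _ Kx Ka; lra.
have K0 : K !=set0 by exists a.
have cslope : {within K, continuous (fun x : V => dotp x b / dotp x a)}.
  apply: continuous_in_subspaceT => x; rewrite inE => Kx.
  apply: (@continuousM R V (fun y => dotp y b) (fun y => (dotp y a)^-1)).
    exact: continuous_dotp.
  by apply: (@continuousV R V (fun y => dotp y a)); [rewrite gt_eqF ?pos|exact: continuous_dotp].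
have [P] := compact_EVT_min K0 cK cslope.
rewrite inE => KP Pmin.
pose m := dotp P b / dotp P a.
pose nu := b - m *: a.
have dnu x : dotp x nu = dotp x b - m * dotp x a.
  by rewrite !dotpE !mxE; ring.
have Pnu : dotp P nu = 0 by rewrite dnu /m mulfVK ?subrr// gt_eqF ?pos.
have Knu x : K x -> 0 <= dotp x nu.
  move=> Kx; rewrite dnu subr_ge0 -ler_pdivlMr ?pos//.
  by apply: Pmin; rewrite inE.
have nunu : 0 < dotp nu nu.
  rewrite dnu dotpC dnu [dotp nu a]dotpC dnu ab aa dotpC.
  by rewrite ab; have := sqr_ge0 m; lra.
pose N := (enorm nu)^-1 *: nu.
have en0 : 0 < enorm nu by rewrite sqrtr_gt0.
have dN x : dotp x N = (enorm nu)^-1 * dotp x nu by rewrite !dotpE !mxE; ring.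
have NN : dotp N N = 1.
  rewrite dN dotpC dN -enorm_sq; field; lra.
have PP : dotp P P = 1 by rewrite -sphereE; exact: Ks.
have PN : dotp P N = 0 by rewrite dN Pnu mulr0.
have [M [[oM aM] PM NM]] := orthonormal_to_axes PP NN PN.
pose A := (fun x : V => x *m M^T) @^-1` K.
have mA : measurable A by rewrite -[X in measurable X]setTI; exact: measurable_mulmx.
have MM : M^T *m M = 1%:M by exact: mulmx1C.
have KA : K = (fun x : V => x *m M) @^-1` A.
  by apply/seteqP; split => x; rewrite /A/= -mulmxA oM mulmx1.
have dA x y : dotp (x *m M^T) (y *m M^T) = dotp x y.
  by rewrite -(dotp_orthogonal _ _ oM) -!mulmxA MM !mulmx1.
have hA : (sphere_area A <= (pi / 2 * (d ^+ 2 / 2 / (1 - d ^+ 2 / 2 / 2)))%:E)%E.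
  apply: polar_area_le => //.
  - by rewrite d2 andbT divr_ge0// sqr_ge0.
  - by rewrite /A/= -PM -mulmxA oM mulmx1.
  - move=> x Ax; have := Knu _ Ax.
    have -> : x 0 2%:R = dotp (x *m M^T) N.
      by rewrite -(dotp_orthogonal _ _ oM) -mulmxA MM mulmx1 NM dotpE !row3_coord; ring.
    by rewrite dN => h; rewrite mulr_ge0// invr_ge0 ltW.
  - by move=> x y Ax Ay; rewrite -dA; exact: Kdot.
rewrite KA aM//; have d4 : 0 < 1 - d ^+ 2 / 4 by lra.
apply: (@le_trans _ _ ((1 - d ^+ 2 / 4)%:E *
    (pi / 2 * (d ^+ 2 / 2 / (1 - d ^+ 2 / 2 / 2)))%:E)%E).
  by apply: lee_wpmul2l; [rewrite lee_fin ltW|exact: hA].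
rewrite -EFinM lee_fin le_eqVlt; apply/orP; left; apply/eqP.
field.
by apply/eqP => h; lra.
Qed.

End isodiametric.

(** * Comparison of the area with the Hausdorff measure *)

Section continuous_norm.
Context {R : realType}.
Notation V := 'rV[R]_3.

Lemma continuous_dotpp : continuous (fun x : V => dotp x x).
Proof.
have ci i : continuous (fun y : V => y 0 i) by exact: coord_continuous.
have h i : continuous (fun y : V => y 0 i * y 0 i).
  by move=> z; apply: continuousM; exact: ci.
rewrite (_ : (fun _ => _) = (fun y : V => y 0 0 * y 0 0 + y 0 1 * y 0 1 +
    y 0 2%:R * y 0 2%:R)); last by apply/funext => y; rewrite dotpE.
by move=> x; exact: continuousD (continuousD (h 0 x) (h 1 x)) (h 2%:R x).
Qed.

End continuous_norm.

Section area_le.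
Context {R : realType}.
Notation V := 'rV[R]_3.
Local Open Scope ereal_scope.

Lemma closed_sphere : closed (sphere : set V).
Proof.
have -> : sphere = (fun x : V => dotp x x) @^-1` [set 1%R].
  by apply/seteqP; split => x /=; rewrite sphereE.
apply: preimage_closed; last exact: closed_eq.
by move=> x _; exact: continuous_dotpp.
Qed.

Lemma compact_sphereI (F : set V) : closed F -> compact (F `&` sphere).
Proof.
move=> cF; apply: bounded_closed_compact; last by apply: closedI => //; exact: closed_sphere.
exists 1%R; split => // e e1 x [_ sx] /=.
change (mx_norm x <= e)%R; rewrite mx_normrE; apply: bigmax_le => [|[i j] _ /=]; first exact: le_trans (ltW e1).
apply: le_trans (ltW e1); rewrite ord1; move: sx; rewrite sphereE dotpE => sx.
rewrite -sqrtr_sqr -sqrtr1 ler_wsqrtr//.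
have := sqr_ge0 (x 0 0)%R; have := sqr_ge0 (x 0 1)%R; have := sqr_ge0 (x 0 2%:R)%R.
by move: j; elim/ord3P; nra.
Qed.

(** Passing to the closure does not enlarge the diameter, which allows one to
    cover by closed sets, where the isodiametric inequality applies. *)
Lemma ediam_bound (U : set V) (d : R) : (0 <= d)%R -> ediam U <= d%:E ->
  forall x y, closure U x -> closure U y -> (enorm (x - y) <= d)%R.
Proof.
move=> d0 Ud.
have cl y : closed [set x : V | enorm (x - y) <= d]%R.
  have -> : [set x : V | enorm (x - y) <= d]%R =
      (fun x => dotp x x - dotp x (2 *: y))%R @^-1` [set r | r <= d ^+ 2 - dotp y y]%R.
    apply/seteqP; split => x /=;
      have -> : (dotp x x - dotp x (2 *: y) = dotp (x - y) (x - y) - dotp y y)%R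
        by rewrite !dotpE !mxE; ring.
      by rewrite lerD2r -enorm_sq ler_sqr// ?nnegrE ?enorm_ge0.
    by rewrite lerD2r -enorm_sq ler_sqr// ?nnegrE ?enorm_ge0.
  apply: preimage_closed; last exact: closed_le.
  move=> x _; apply: (@continuousB _ _ V (fun x => dotp x x) (fun x => dotp x _)).
    exact: continuous_dotpp.
  exact: continuous_dotp.
have UU x y : U x -> U y -> (enorm (x - y) <= d)%R.
  move=> Ux Uy; rewrite -lee_fin; apply: le_trans Ud.
  by apply: ereal_sup_ubound; right; exists (x, y).
have step x y : closure U x -> U y -> (enorm (x - y) <= d)%R.
  move=> Ux Uy; have sU : U `<=` [set x : V | enorm (x - y) <= d]%R.
    by move=> z Uz; exact: UU.
  by have := closureS sU Ux; rewrite -(closure_id _).1.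
move=> x y Ux Uy; have sU : U `<=` [set y : V | enorm (y - x) <= d]%R.
  by move=> z Uz; rewrite /= enormB; exact: step.
by rewrite enormB; have := closureS sU Uy; rewrite -(closure_id _).1.
Qed.

Lemma area_le_disc (U : set V) (d : R) : (d <= 1)%R -> ediam U <= d%:E ->
  (1 - d ^+ 2 / 4)%:E * sphere_area (closure U `&` sphere) <= disc_area U.
Proof.
move=> d1 Ud; have := ediam_ge0 U; move: (Ud).
case E : (ediam U) => [e| |]//; rewrite !lee_fin => ed e0.
rewrite /disc_area E.
apply: (@le_trans _ _ ((1 - e ^+ 2 / 4)%:E * sphere_area (closure U `&` sphere))).
  by apply: lee_wpmul2r => //; rewrite lee_fin lerD2l lerN2; nra.
apply: isodiametric_sphere.
- by apply: compact_sphereI; exact: closed_closure.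
- by move=> x [].
- by rewrite e0 (le_trans ed).
- by move=> x y [Ux _] [Uy _]; apply: (@ediam_bound U) => //; rewrite E.
Qed.

(** The isodiametric inequality bounds the area of each piece of a covering;
    the factor tends to one with the mesh. *)
Lemma area_le_delta (A : set V) (d : R) : measurable A -> (0 < d <= 1)%R ->
  (1 - d ^+ 2 / 4)%:E * sphere_area A <= hausdorff_delta d A.
Proof.
move=> mA /andP[d0 d1]; apply: le_ereal_inf_tmp => _ [U [AU Ud] <-].
have c0 : (0 <= 1 - d ^+ 2 / 4)%R by nra.
have mK i : measurable (closure (U i) `&` sphere).
  by apply: measurableI; apply: measurable_closedV;
    [exact: closed_closure|exact: closed_sphere].
apply: (@le_trans _ _ ((1 - d ^+ 2 / 4)%:E *
    \sum_(i <oo) sphere_area (closure (U i) `&` sphere))).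
  apply: lee_wpmul2l; first by rewrite lee_fin.
  rewrite -sphere_area_sphere//; apply: measure_sigma_subadditive => //.
    by apply: measurableI => //; exact: measurable_sphere.
  move=> x [/AU[i _ Ux] Sx]; exists i => //; split => //; exact: subset_closure.
rewrite -nneseriesZl//; apply: lee_nneseries => [i _ _|i _]; last exact: area_le_disc.
by rewrite mule_ge0// lee_fin.
Qed.

Lemma area_le_hausdorff (A : set V) : measurable A -> sphere_area A <= hausdorff2 A.
Proof.
move=> mA; have fA := sphere_area_lty mA.
have E : sphere_area A = (fine (sphere_area A))%:E.
  by rewrite fineK// ge0_fin_numE.
set a := fine _ in E.
have a0 : (0 <= a)%R by rewrite -lee_fin -E.
rewrite E; case F : (hausdorff2 A) => [b| |]; last 2 first.
- by rewrite leey.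
- by have : 0 <= hausdorff2 A by []; rewrite F.
rewrite lee_fin leNgt; apply/negP => ba.
have b0 : (0 <= b)%R by rewrite -lee_fin -F.
have a1 : (0 < a)%R by lra.
pose d := ((a - b) / a)%R.
have d0 : (0 < d)%R by rewrite divr_gt0//; lra.
have d1 : (d <= 1)%R by rewrite ler_pdivrMr//; lra.
have dd : (0 < d <= 1)%R by rewrite d0.
have := le_trans (area_le_delta mA dd) (hausdorff_delta_le A d0).
rewrite E F -EFinM lee_fin.
have : (d * a = a - b)%R by rewrite /d mulfVK ?gt_eqF.
nra.
Qed.

End area_le.

Section hausdorff_isometry.
Context {R : realType}.
Notation V := 'rV[R]_3.
Local Open Scope ereal_scope.

(** A covering of the set is carried to a covering of its image by a map that
    does not increase distances. *)
Lemma hausdorff2_image_le (f : V -> V) (A : set V) :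
  (forall x y, enorm (f x - f y) <= enorm (x - y))%R ->
  hausdorff2 (f @` A) <= hausdorff2 A.
Proof.
move=> f1.
have fd U : ediam (f @` U) <= ediam U.
  apply: ge_ereal_sup => _ [->|[[_ _] [/= [x Ux <-] [y Uy <-]] <-]].
    exact: ediam_ge0.
  apply: le_trans (_ : (enorm (x - y))%:E <= _); first by rewrite lee_fin.
  by apply: ereal_sup_ubound; right; exists (x, y).
apply: ge_ereal_sup => _ [d /= d0 <-]; apply: le_trans (hausdorff_delta_le _ d0).
apply: le_ereal_inf_tmp => _ [U [AU Ud] <-].
apply: le_trans (_ : \sum_(i <oo) disc_area (f @` U i) <= _).
  apply: ereal_inf_lbound; exists (fun i => f @` U i) => //; split.
    by move=> _ [x /AU[i _ Ux] <-]; exists i => //; exists x.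
  by move=> i; exact: le_trans (fd _) (Ud i).
apply: lee_nneseries => [i _ _|i _]; first exact: disc_area_ge0.
rewrite /disc_area; apply: lee_wpmul2l; first by rewrite lee_fin divr_ge0 ?pi_ge0.
by rewrite !expe2 lee_pmul// ediam_ge0.
Qed.

Lemma hausdorff2_orthogonal (M : 'M[R]_3) (A : set V) : orthogonal M ->
  hausdorff2 ((fun x => x *m M) @^-1` A) = hausdorff2 A.
Proof.
move=> oM; have oM' : orthogonal M^T by rewrite /orthogonal trmxK; exact: mulmx1C.
have iso N : orthogonal N -> forall x y, (enorm (x *m N - y *m N) <= enorm (x - y))%R.
  by move=> oN x y; rewrite -mulmxBl enorm_orthogonal.
apply/eqP; rewrite eq_le; apply/andP; split.
  have -> : (fun x => x *m M) @^-1` A = (fun x => x *m M^T) @` A.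
    apply/seteqP; split => x /=.
      by move=> Ax; exists (x *m M) => //; rewrite -mulmxA oM mulmx1.
    by move=> [y Ay <-]; rewrite -mulmxA -{2}[M]trmxK oM' mulmx1.
  by apply: hausdorff2_image_le; exact: iso.
have {1}-> : A = (fun x => x *m M) @` ((fun x => x *m M) @^-1` A).
  apply/seteqP; split => x /=; last by move=> [y Ay <-].
  by move=> Ax; exists (x *m M^T); rewrite /= -mulmxA -{2}[M]trmxK oM' mulmx1.
by apply: hausdorff2_image_le; exact: iso.
Qed.

(** Finitely many small pieces are completed to a covering by covering what
    they leave out. *)
Lemma hausdorff_delta_split (d : R) (A : set V) (U : nat -> set V) n : (0 < d)%R ->
  (forall i, (i < n)%N -> ediam (U i) <= d%:E) ->
  hausdorff_delta d A <= \sum_(i < n) disc_area (U i) +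
    hausdorff_delta d (A `\` \bigcup_(i in `I_n) U i).
Proof.
move=> d0 Ud.
have s0 : 0 <= \sum_(i < n) disc_area (U i) by apply: sume_ge0 => i _; exact: disc_area_ge0.
have [->|sfin] := eqVneq (\sum_(i < n) disc_area (U i)) +oo.
  by rewrite addye ?leey// gt_eqF// (lt_le_trans _ (hausdorff_delta_ge0 _ _)).
have fs : \sum_(i < n) disc_area (U i) \is a fin_num.
  by rewrite ge0_fin_numE// ltey.
rewrite -leeBlDl//; apply: le_ereal_inf_tmp => _ [W [AW Wd] <-].
rewrite leeBlDl//.
pose U' i := if (i < n)%N then U i else W (i - n)%N.
apply: le_trans (_ : \sum_(i <oo) disc_area (U' i) <= _).
  apply: ereal_inf_lbound; exists U' => //; split.
    move=> x Ax; have [[i /= ni Ux]|nU] := pselect ((\bigcup_(i in `I_n) U i) x).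
      by exists i => //; rewrite /U' ni.
    have [i _ Wx] : (\bigcup_i W i) x by apply: AW; split.
    by exists (i + n)%N => //; rewrite /U' ltnNge leq_addl/= addnK.
  by move=> i; rewrite /U'; case: ifP => [/Ud//|_]; exact: Wd.
rewrite (nneseries_split _ n); last by move=> *; exact: disc_area_ge0.
rewrite add0n -nneseries_addn; last by move=> *; exact: disc_area_ge0.
rewrite big_mkord; apply: leeD.
  by apply: lee_sum => i _; rewrite /U' ltn_ord.
apply: lee_nneseries => [i _ _|i _]; first exact: disc_area_ge0.
by rewrite /U' ltnNge leq_addl/= addnK.
Qed.

End hausdorff_isometry.

(** * Caps, packings and the equality of the two measures *)

Section caps.
Context {R : realType}.
Notation V := 'rV[R]_3.
Notation leb := (@lebesgue_measure R).
Implicit Types (x y : V) (r : R).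

Definition cap x r : set V := [set y | enorm (y - x) < r].

Lemma capE x r y : 0 < r -> cap x r y = (dotp (y - x) (y - x) < r ^+ 2).
Proof.
by move=> r0; rewrite /cap/= -enorm_sq ltr_sqr// nnegrE ?enorm_ge0// ltW.
Qed.

Let dist2 (p : V * V) := dotp (p.2 - p.1) (p.2 - p.1).

Let mdist2 : measurable_fun setT dist2.
Proof.
rewrite (_ : dist2 = (fun p : V * V => (p.2 0 0 - p.1 0 0) ^+ 2 +
  (p.2 0 1 - p.1 0 1) ^+ 2 + (p.2 0 2%:R - p.1 0 2%:R) ^+ 2)); last first.
  by apply/funext => p; rewrite /dist2 dotpE !mxE; ring.
have mi i : measurable_fun setT (fun p : V * V => (p.2 0 i - p.1 0 i) ^+ 2).
  by apply: measurable_funX; apply: measurable_funB;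
    [apply: (measurableT_comp (measurable_coordV i) measurable_snd)|
     apply: (measurableT_comp (measurable_coordV i) measurable_fst)].
by apply: measurable_funD => //; apply: measurable_funD.
Qed.

Lemma measurable_near_pairs r : 0 < r ->
  measurable [set p : V * V | cap p.1 r p.2].
Proof.
move=> r0; rewrite (_ : mkset _ = dist2 @^-1` `]-oo, r ^+ 2[).
  by rewrite -[X in measurable X]setTI; exact: mdist2.
by apply/seteqP; split => p /=; rewrite capE// in_itv.
Qed.

Lemma measurable_cap x r : 0 < r -> measurable (cap x r).
Proof.
move=> r0; have := measurable_xsection x (measurable_near_pairs r0).
rewrite (_ : xsection _ _ = cap x r)//.
by apply/seteqP; split => y; rewrite /xsection/= inE.
Qed.

Lemma to_pole x : sphere x -> exists M, area_isometry M /\ x *m M = row3 1 0 0.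
Proof.
rewrite sphereE => xx.
have [u [v [uv uv0 uvr]]] := axial_rot_ex (x 0 1) (x 0 2%:R).
have [N [NN xN]] : exists N : V, dotp N N = 1 /\ dotp x N = 0.
  exists (row3 0 u (- v)); rewrite !dotpE !row3_coord; split; last by lra.
  by lra.
by have [M [iM xM _]] := orthonormal_to_axes xx NN xN; exists M.
Qed.

Lemma preimage_cap (M : 'M[R]_3) x r : orthogonal M ->
  (fun y => y *m M) @^-1` cap (x *m M) r = cap x r.
Proof.
move=> oM; apply/seteqP; split => y; rewrite /cap/= -mulmxBl enorm_orthogonal//.
Qed.

Lemma cap_area x r : sphere x -> 0 < r <= 2 -> sphere_area (cap x r) = (pi * r ^+ 2)%:E.
Proof.
move=> sx /andP[r0 r2]; have [M [[oM aM] xM]] := to_pole sx.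
rewrite -(preimage_cap x r oM) aM; last exact: measurable_cap.
rewrite xM sphere_areaE2; last exact: measurable_cap.
have pi0 := @pi_gt0 R.
rewrite (eq_integral (fun=> (r ^+ 2 / 2)%:E)); last first.
  move=> t _.
  rewrite (_ : _ `&` _ = `]1 - r ^+ 2 / 2, 1]%classic); last first.
    have E (h : R) : -1 <= h <= 1 ->
        dotp (cyl (h, t) - row3 1 0 0) (cyl (h, t) - row3 1 0 0) = 2 - 2 * h.
      move=> hI; have := cyl_sphere t hI; rewrite sphereE !dotpE !mxE /=; lra.
    apply/seteqP; split => h /=; rewrite !in_itv/= capE//.
      by move=> [hI]; rewrite E//; lra.
    move=> /andP[h1 h2]; have r24 : r ^+ 2 <= 4 by nra.
    have hI : -1 <= h <= 1 by apply/andP; split; lra.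
    by split => //; rewrite E//; lra.
  apply: etrans (@lebesgue_measure_itv R `]1 - r ^+ 2 / 2, 1]) _.
  rewrite /= lte_fin ifT; last by nra.
  by rewrite -EFinB; congr (_%:E); lra.
rewrite integral_cst//=.
rewrite (_ : lebesgue_measure _ = (2 * pi)%:E); last first.
  apply: etrans (@lebesgue_measure_itv R `[0, 2 * pi[) _.
  by rewrite /= lte_fin mulr_gt0// -EFinB subr0.
by rewrite -EFinM; congr (_%:E); field.
Qed.

Lemma cap_hausdorff x y r : sphere x -> sphere y ->
  hausdorff2 (cap x r `&` sphere) = hausdorff2 (cap y r `&` sphere).
Proof.
have sM (M : 'M[R]_3) : orthogonal M -> (fun y => y *m M) @^-1` sphere = sphere.
  by move=> oM; apply/seteqP; split => z /=; rewrite /sphere/= enorm_orthogonal.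
suff E z : sphere z -> hausdorff2 (cap z r `&` sphere) =
    hausdorff2 (cap (row3 1 0 0) r `&` sphere) by move=> sx sy; rewrite !E.
move=> sz; have [M [[oM _] zM]] := to_pole sz.
by rewrite -zM -(hausdorff2_orthogonal (cap (z *m M) r `&` sphere) oM) preimage_setI preimage_cap// sM.
Qed.

End caps.

Section packing.
Context {R : realType}.
Notation V := 'rV[R]_3.

Definition packing (r : R) (n : nat) (c : nat -> V) :=
  (forall i, (i < n)%N -> sphere (c i)) /\
  (forall i j, (i < j < n)%N -> 2 * r <= enorm (c i - c j)).

Lemma packing_trivIset r n c : packing r n c ->
  trivIset `I_n (fun i => cap (c i) r `&` sphere).
Proof.
move=> [_ cr].
have dis i j x : (i < j < n)%N -> cap (c i) r x -> cap (c j) r x -> False.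
  move=> ij xi xj; have := cr _ _ ij; have := ler_enormB (c i) x (c j).
  by move: xi xj; rewrite /cap/= (enormB x (c i)); lra.
move=> i j /= ni nj [x [[xi _] [xj _]]].
by case: (ltngtP i j) => // ij; exfalso;
  [apply: (dis i j x)|apply: (dis j i x)] => //; rewrite ij.
Qed.

Lemma measurable_capS (x : V) r : 0 < r -> measurable (cap x r `&` sphere).
Proof. by move=> r0; apply: measurableI; [exact: measurable_cap|exact: measurable_sphere]. Qed.

(** The caps of radius $r$ about the centres are disjoint, and their areas add
    up to at most the area of the sphere. *)
Lemma packing_size r n c : 0 < r <= 2 -> packing r n c -> n%:R * r ^+ 2 <= 4.
Proof.
move=> r02 pc; have /andP[r0 r2] := r02.
have : (sphere_area (\big[setU/set0]_(i < n) (cap (c i) r `&` sphere)) <= (4 * pi)%:E)%E.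
  rewrite -sphere_areaT; apply: le_measure; rewrite ?inE//.
  by apply: bigsetU_measurable => i _; exact: measurable_capS.
rewrite (measure_semi_additive_ord_I sphere_area (F := fun i => cap (c i) r `&` sphere))//; last 3 first.
- by move=> i _; exact: measurable_capS.
- exact: packing_trivIset.
- by apply: bigsetU_measurable => i _; exact: measurable_capS.
rewrite (eq_bigr (fun=> (pi * r ^+ 2)%:E)); last first.
  move=> i _; apply: etrans (sphere_area_sphere (measurable_cap _ r0)) _.
  by apply: cap_area => //; exact: pc.1.
rewrite sumEFin lee_fin sumr_const card_ord -[_ *+ n]mulr_natl.
have pi0 := @pi_gt0 R.
by rewrite (mulrC pi) mulrA ler_pM2r.
Qed.

(** A packing with the largest number of centres: a point far from all of them
    could be added. *)
Lemma maximal_packing r : 0 < r <= 2 -> exists n c, packing r n c /\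
  sphere `<=` \bigcup_(i in `I_n) cap (c i) (2 * r).
Proof.
move=> r02; have /andP[r0 r2] := r02.
pose P n := `[< exists c, packing r n c >].
have P0 : exists n, P n.
  exists 0%N; apply/asboolP; exists (fun=> 0);
  by split => // i j; rewrite ltn0 andbF.
have PM n : P n -> (n <= Num.truncn (4 / r ^+ 2))%N.
  move=> /asboolP[c pc]; have := packing_size r02 pc.
  by rewrite truncn_ge_nat ?divr_ge0 ?sqr_ge0// ler_pdivlMr// exprn_gt0.
have [n /asboolP[c pc] nmax] := ex_maxnP P0 PM.
exists n, c; split => // x sx; apply: contrapT => nx.
have : P n.+1.
  apply/asboolP; exists (fun i => if (i < n)%N then c i else x); split.
    by move=> i _; case: ifP => // /(pc.1).
  move=> i j /andP[ij]; rewrite ltnS leq_eqVlt => /predU1P[jn|jn].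
    rewrite -jn ij ltnn leNgt; apply/negP => h; apply: nx; exists i => //=.
      by rewrite -jn.
    by rewrite /cap/= enormB.
  by rewrite (ltn_trans ij jn) jn; apply: pc.2; rewrite ij.
by move=> /nmax; rewrite ltnn.
Qed.

(** The caps of radius $2r$ about the centres cover the sphere, and each of them
    has the area $4\pi r^2$. *)
Lemma maximal_packing_size r n c : 0 < r <= 1 ->
  sphere `<=` \bigcup_(i in `I_n) cap (c i) (2 * r) -> packing r n c ->
  1 <= n%:R * r ^+ 2.
Proof.
move=> /andP[r0 r1] cover pc; have pi0 := @pi_gt0 R.
have r2 : 0 < 2 * r <= 2 by apply/andP; split; lra.
have : (sphere_area sphere <= \sum_(i < n) sphere_area (cap (c i) (2 * r)))%E.
  apply: (@content_subadditive _ _ _ sphere_area sphere (fun i => cap (c i) (2 * r)) n).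
  - by move=> i _; apply: measurable_cap; lra.
  - exact: measurable_sphere.
  - by rewrite -(bigcup_mkord n (fun i => cap (c i) (2 * r))).
rewrite -[sphere in (sphere_area sphere)]setTI sphere_area_sphere// sphere_areaT.
rewrite (eq_bigr (fun=> (pi * (2 * r) ^+ 2)%:E)); last first.
  by move=> i _; apply: cap_area => //; exact: pc.1.
rewrite sumEFin lee_fin sumr_const card_ord -[_ *+ n]mulr_natl.
have -> : n%:R * (pi * (2 * r) ^+ 2) = n%:R * r ^+ 2 * (4 * pi) by ring.
by rewrite ler_pMl// mulr_gt0.
Qed.

End packing.

Section hausdorff_sphere.
Context {R : realType}.
Notation V := 'rV[R]_3.
Local Open Scope ereal_scope.

Lemma sphere_area_sphereT : sphere_area (sphere : set V) = (4 * pi)%:E.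
Proof.
by rewrite -[sphere in (sphere_area sphere)]setTI sphere_area_sphere// sphere_areaT.
Qed.

Lemma hausdorff_delta0 (d : R) : (0 < d)%R -> hausdorff_delta d (set0 : set V) = 0.
Proof.
move=> d0; apply/eqP; rewrite eq_le hausdorff_delta_ge0 andbT.
by apply: le_trans (hausdorff_delta_le _ d0) _; rewrite measure0.
Qed.

(** A cap of radius $r$ costs at most the area of the disc of radius $r$ in a
    covering. *)
Lemma disc_area_capS (x : V) r : (0 < r)%R ->
  ediam (cap x r `&` sphere) <= (2 * r)%:E /\
  disc_area (cap x r `&` sphere) <= (pi * r ^+ 2)%:E.
Proof.
move=> r0.
have h : ediam (cap x r `&` sphere) <= (2 * r)%:E.
  apply: ge_ereal_sup => _ [->|[[y z] [[/= yx _] [/= zx _]] <-]].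
    by rewrite lee_fin mulr_ge0// ltW.
  rewrite lee_fin; apply: le_trans (ler_enormB y x z) _.
  by move: yx zx; rewrite /cap/= (enormB z x); lra.
split => //; have := ediam_ge0 (cap x r `&` sphere); move: h.
rewrite /disc_area; case: ediam => [e| |]//; rewrite !lee_fin => h e0.
rewrite (_ : pi * r ^+ 2 = pi / 4 * (2 * r) ^+ 2)%R; last by field.
by rewrite ler_wpM2l ?divr_ge0 ?pi_ge0// -expr2 ler_sqr// nnegrE; lra.
Qed.

(** Maximal packings give coverings by a number of caps of order $r^{-2}$. *)
Lemma hausdorff_sphere_fin : hausdorff2 (sphere : set V) < +oo.
Proof.
have pi0 := @pi_gt0 R.
apply: (@le_lt_trans _ _ (16 * pi)%:E); last by rewrite ltry.
apply: ge_ereal_sup => _ [d /= d0 <-].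
pose r := Num.min 1%R (d / 4)%R.
have r0 : (0 < r)%R by rewrite lt_min ltr01 divr_gt0.
have r1 : (r <= 1)%R by rewrite ge_min lexx.
have rd : (4 * r <= d)%R.
  have : (r <= d / 4)%R by rewrite ge_min lexx orbT.
  by lra.
have r2 : (0 < r <= 2)%R by apply/andP; split; lra.
have [n [c [pc cover]]] := maximal_packing r2.
have rr : (0 < 2 * r)%R by lra.
apply: le_trans (hausdorff_delta_anti _ rd) _.
have r4 : (0 < 4 * r)%R by lra.
apply: le_trans (@hausdorff_delta_split _ _ _ (fun i => cap (c i) (2 * r) `&` sphere) n r4 _) _.
  move=> i _; rewrite (_ : 4 * r = 2 * (2 * r))%R; last by ring.
  exact: (disc_area_capS _ rr).1.
rewrite (_ : _ `\` _ = set0); last first.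
  apply/seteqP; split => x //= -[sx]; apply.
  by have [i ni xi] := cover _ sx; exists i.
rewrite hausdorff_delta0// adde0.
apply: (@le_trans _ _ (\sum_(i < n) (pi * (2 * r) ^+ 2)%:E)).
  by apply: lee_sum => i _; exact: (disc_area_capS _ rr).2.
rewrite sumEFin lee_fin sumr_const card_ord -[(_ *+ n)%R]mulr_natl.
have := packing_size r2 pc; nra.
Qed.

Definition hausdorff_on_sphere : set V -> \bar R :=
  mrestr hausdorff2 measurable_sphere.

HB.instance Definition _ := Measure.on hausdorff_on_sphere.

Let fin_hausdorff : fin_num_fun hausdorff_on_sphere.
Proof.
move=> A mA; rewrite ge0_fin_numE ?measure_ge0//.
apply: le_lt_trans hausdorff_sphere_fin; apply: le_measure; rewrite ?inE//.
- by apply: measurableI => //; exact: measurable_sphere.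
- exact: measurable_sphere.
Qed.

HB.instance Definition _ :=
  @Measure_isFinite.Build _ _ _ hausdorff_on_sphere fin_hausdorff.

Definition area_on_sphere : set V -> \bar R := sphere_area.

HB.instance Definition _ := Measure.on area_on_sphere.

Let fin_area : fin_num_fun area_on_sphere.
Proof.
by move=> A mA; rewrite ge0_fin_numE ?measure_ge0//; exact: sphere_area_lty.
Qed.

HB.instance Definition _ :=
  @Measure_isFinite.Build _ _ _ area_on_sphere fin_area.

(** Counting the pairs of points at distance less than r in two ways: the two
   measures are both invariant, so their values on caps are in the ratio of
   their total masses. *)
Lemma cap_ratio (x : V) (r : R) : sphere x -> (0 < r <= 2)%R ->
  hausdorff2 (cap x r `&` sphere) * (4 * pi)%:E =
  (pi * r ^+ 2)%:E * hausdorff2 sphere.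
Proof.
move=> sx /andP[r0 r2].
pose E : set (V * V) := [set p : V * V | cap p.1 r p.2] `&` (sphere `*` sphere).
have mE : measurable E.
  apply: measurableI; first exact: measurable_near_pairs.
  by apply: measurableX; exact: measurable_sphere.
have e1 : (hausdorff_on_sphere \x area_on_sphere) E = (pi * r ^+ 2)%:E * hausdorff2 sphere.
  rewrite /product_measure1/=.
  rewrite (eq_integral (fun y => (pi * r ^+ 2)%:E * (\1_sphere y)%:E)); last first.
    move=> y _; rewrite /= indicE; have [sy|sy] := boolP (y \in sphere).
      rewrite mule1 (_ : xsection E y = cap y r `&` sphere).
        apply: etrans (sphere_area_sphere (measurable_cap y r0)) _.
        by apply: cap_area; rewrite ?r0//; exact: set_mem.
      apply/seteqP; split => z; rewrite /xsection/= inE /E/=; first by move=> [? []].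
      by move=> [? ?]; split => //; split => //; exact: set_mem.
    rewrite mule0 (_ : xsection E y = set0) ?measure0//.
    apply/seteqP; split => z //; rewrite /xsection/= inE /E/= => -[_ [sy' _]].
    by move: sy; rewrite (mem_set sy').
  rewrite ge0_integralZl//; last 2 first.
  - by apply/measurable_EFinP; apply: measurable_indic; exact: measurable_sphere.
  - by rewrite lee_fin mulr_ge0 ?sqr_ge0 ?pi_ge0.
  rewrite integral_indic//; last exact: measurable_sphere.
  rewrite setIT; congr (_ * _).
  by rewrite -[LHS]/(hausdorff2 (sphere `&` sphere)) setIid.
rewrite -e1.
have -> : (hausdorff_on_sphere \x area_on_sphere) E =
    (hausdorff_on_sphere \x^ area_on_sphere) E.
  by apply: product_measure_unique => // C D mC mD/=; rewrite product_measure2E.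
rewrite /product_measure2/=.
rewrite (eq_integral (fun y => hausdorff2 (cap x r `&` sphere) * (\1_sphere y)%:E)); last first.
  move=> y _; rewrite /= indicE; have [sy|sy] := boolP (y \in sphere).
    rewrite mule1 (_ : ysection E y = cap y r `&` sphere).
      rewrite -[LHS]/(hausdorff2 (cap y r `&` sphere `&` sphere)) -setIA setIid.
      by apply: cap_hausdorff => //; exact: set_mem.
    apply/seteqP; split => z; rewrite /ysection/= inE /E/= /cap/= enormB.
      by move=> [? []].
    by move=> [? ?]; split => //; split => //; exact: set_mem.
  rewrite mule0 (_ : ysection E y = set0) ?measure0//.
  apply/seteqP; split => z //; rewrite /ysection/= inE /E/= => -[_ [_ sy']].
  by move: sy; rewrite (mem_set sy').
rewrite ge0_integralZl//; last first.
  by apply/measurable_EFinP; apply: measurable_indic; exact: measurable_sphere.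
rewrite integral_indic//; last exact: measurable_sphere.
by rewrite setIT; congr (_ * _); symmetry; exact: sphere_area_sphereT.
Qed.

(** Replacing the caps of a maximal packing by discs of the same diameter in
   the definition of the Hausdorff measure would make the total mass smaller,
   by an amount that does not tend to zero, if caps had too large a measure. *)
Lemma hausdorff_sphere_le : hausdorff2 (sphere : set V) <= (4 * pi)%:E.
Proof.
have pi0 := @pi_gt0 R.
have hE : hausdorff2 (sphere : set V) = (fine (hausdorff2 (sphere : set V)))%:E.
  by rewrite fineK// ge0_fin_numE// hausdorff_sphere_fin.
set h := fine _ in hE; rewrite hE lee_fin leNgt; apply/negP => hpi.
suff : hausdorff2 (sphere : set V) <= (h - (h - 4 * pi) / 4)%:E.
  by rewrite hE lee_fin; lra.
apply: ge_ereal_sup => _ [d /= d0 <-].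
pose r := Num.min 1%R (d / 2)%R.
have r0 : (0 < r)%R by rewrite lt_min ltr01 divr_gt0.
have r1 : (r <= 1)%R by rewrite ge_min lexx.
have rd : (2 * r <= d)%R.
  have : (r <= d / 2)%R by rewrite ge_min lexx orbT.
  by lra.
have r2 : (0 < r <= 2)%R by apply/andP; split; lra.
have r01 : (0 < r <= 1)%R by apply/andP; split; lra.
have rr : (0 < 2 * r)%R by lra.
have [n [c [pc cover]]] := maximal_packing r2.
have n1 := maximal_packing_size r01 cover pc.
pose F i := cap (c i) r `&` sphere.
have mF i : measurable (F i) by exact: measurable_capS.
have mU : measurable (\big[setU/set0]_(i < n) F i) by exact: bigsetU_measurable.
apply: le_trans (hausdorff_delta_anti _ rd) _.
apply: le_trans (@hausdorff_delta_split _ _ _ F n rr _) _.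
  by move=> i _; exact: (disc_area_capS _ r0).1.
have F1 : \sum_(i < n) disc_area (F i) <= (n%:R * (pi * r ^+ 2))%:E.
  apply: (@le_trans _ _ (\sum_(i < n) (pi * r ^+ 2)%:E)).
    by apply: lee_sum => i _; exact: (disc_area_capS _ r0).2.
  by rewrite sumEFin lee_fin sumr_const card_ord -[(_ *+ n)%R]mulr_natl.
have gE i : (i < n)%N -> hausdorff2 (F i) = (r ^+ 2 * h / 4)%:E.
  move=> ni; have := cap_ratio (pc.1 _ ni) r2; rewrite hE -/(F i).
  have : hausdorff2 (F i) \is a fin_num.
    rewrite ge0_fin_numE//; apply: le_lt_trans hausdorff_sphere_fin.
    by apply: le_outer_measure => y [].
  move=> /fineK <-; rewrite -!EFinM => -[e]; congr (_%:E).
  have p4 : (4 * pi != 0 :> R)%R by rewrite gt_eqF// mulr_gt0.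
  by apply: (mulIf p4); rewrite e; field.
have F2 : hausdorff2 (\big[setU/set0]_(i < n) F i) = (n%:R * (r ^+ 2 * h / 4))%:E.
  rewrite (measure_semi_additive_ord_I hausdorff2 (F := F))//; last exact: packing_trivIset.
  rewrite (eq_bigr (fun=> (r ^+ 2 * h / 4)%:E)); last by move=> i _; exact: gE.
  by rewrite sumEFin sumr_const card_ord -[(_ *+ n)%R]mulr_natl.
have F3 : hausdorff2 (sphere `\` \bigcup_(i in `I_n) F i) =
    (h - n%:R * (r ^+ 2 * h / 4))%:E.
  pose B := \big[setU/set0]_(i < n) F i.
  have D : hausdorff2 (sphere `\` B) = hausdorff2 sphere - hausdorff2 (sphere `&` B).
    by apply: measureD => //; [exact: measurable_sphere|exact: hausdorff_sphere_fin].
  rewrite bigcup_mkord D setIidr; first by rewrite hE F2 -EFinB.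
  by rewrite /B -(bigcup_mkord n F) => x [i _ []].
apply: le_trans (leeD F1 (le_trans (hausdorff_delta_le _ rr) (lexx _))) _.
rewrite F3 -EFinD lee_fin.
set m := (n%:R * r ^+ 2)%R in n1.
have -> : (n%:R * (pi * r ^+ 2) = m * pi)%R by rewrite /m; ring.
have -> : (n%:R * (r ^+ 2 * h / 4) = m * h / 4)%R by rewrite /m; field.
by nra.
Qed.

(** The surface measure of the sphere is its two-dimensional Hausdorff measure:
   one inequality holds on every Borel set, the other one on the whole sphere. *)
Theorem hausdorff_sphereE (A : set V) : measurable A ->
  hausdorff2 (A `&` sphere) = sphere_area A.
Proof.
move=> mA; have mS := @measurable_sphere R.
have le (B : set V) : measurable B -> sphere_area B <= hausdorff2 (B `&` sphere).
  move=> mB; rewrite -sphere_area_sphere//; apply: area_le_hausdorff.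
  exact: measurableI.
have fin (B : set V) : measurable B -> hausdorff2 (B `&` sphere) \is a fin_num.
  move=> mB; rewrite ge0_fin_numE//; apply: le_lt_trans hausdorff_sphere_fin.
  by apply: le_outer_measure => y [].
apply/eqP; rewrite eq_le le// andbT leNgt; apply/negP => lt.
have mC : measurable (~` A) by exact: measurableC.
have fA (B : set V) : measurable B -> sphere_area B \is a fin_num.
  by move=> mB; rewrite ge0_fin_numE//; exact: sphere_area_lty.
have : sphere_area A + sphere_area (~` A) <
    hausdorff2 (A `&` sphere) + hausdorff2 (~` A `&` sphere).
  by apply: lte_leD; rewrite ?fA ?le.
have -> : sphere_area A + sphere_area (~` A) = (4 * pi)%:E.
  by rewrite -sphere_areaT -(setUv A) measureU// setICr.
have -> : hausdorff2 (A `&` sphere) + hausdorff2 (~` A `&` sphere) = hausdorff2 sphere.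
  rewrite -[in RHS](setTI sphere) -(setUv A) setIUl measureU//.
  - exact: measurableI.
  - exact: measurableI.
  - by rewrite setIACA setICr set0I.
by move=> /lt_le_trans /(_ hausdorff_sphere_le); rewrite ltxx.
Qed.

End hausdorff_sphere.

(** * Differential calculus on the sphere *)

Section curves.
Context {R : realType}.
Notation V := 'rV[R]_3.

Lemma is_derive_row3 (a b c : R -> R) (t da db dc : R) :
  is_derive t 1 a da -> is_derive t 1 b db -> is_derive t 1 c dc ->
  is_derive t 1 (fun s => row3 (a s) (b s) (c s)) (row3 da db dc).
Proof.
move=> [da1 da2] [db1 db2] [dc1 dc2].
have Ea : (fun s => row3 (a s) (b s) (c s) 0 0) = a by apply/funext => s; exact: row30.
have Eb : (fun s => row3 (a s) (b s) (c s) 0 1) = b by apply/funext => s; exact: row31.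
have Ec : (fun s => row3 (a s) (b s) (c s) 0 2%:R) = c by apply/funext => s; exact: row32.
have D : derivable (fun s => row3 (a s) (b s) (c s)) t 1.
  apply/derivable_mxP => i; rewrite (ord1 i) => {i}.
  by elim/ord3P; rewrite ?Ea ?Eb ?Ec.
apply: DeriveDef => //; rewrite derive_mx//; apply/rowP; elim/ord3P.
- by rewrite mxE row30 Ea.
- by rewrite mxE row31 Eb.
- by rewrite mxE row32 Ec.
Qed.

Lemma is_derive_comp_curve (g : V -> R) (c : R -> V) (t : R) (dc : V) :
  differentiable g (c t) -> is_derive t 1 c dc ->
  is_derive t 1 (g \o c) ('D_dc g (c t)).
Proof.
move=> dg [c1 c2]; have dct : differentiable c t by exact/derivable1_diffP.
have dgc : differentiable (g \o c) t by exact: differentiable_comp.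
apply: DeriveDef; first exact/derivable1_diffP.
by rewrite deriveE// diff_comp//= -c2 !deriveE.
Qed.

Lemma rowV_sum (v : V) : v = \sum_(i < 3) v 0 i *: delta_mx 0 i.
Proof. exact: row_sum_delta. Qed.

Lemma derive_sum_coord (W : normedModType R) (g : V -> W) (x v : V) : differentiable g x ->
  'D_v g x = \sum_(i < 3) v 0 i *: 'D_(delta_mx 0 i) g x.
Proof.
move=> dg; rewrite deriveE// {1}[v]rowV_sum linear_sum.
by apply: eq_bigr => i _; rewrite linearZ deriveE.
Qed.

End curves.

Section radial.
Context {R : realType}.
Notation V := 'rV[R]_3.

Lemma sphere_neq0 (x : V) : sphere x -> x != 0.
Proof.
move=> sx; apply/eqP => x0; move: sx; rewrite sphereE x0 dotpE !mxE.
by rewrite !mulr0 !addr0 => /esym/eqP; rewrite oner_eq0.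
Qed.

Lemma radial_ext_sphere (W : Type) (f : V -> W) x : sphere x -> radial_ext f x = f x.
Proof. by rewrite /radial_ext /sphere/= => ->; rewrite invr1 scale1r. Qed.

Lemma radial_extZ (W : Type) (f : V -> W) (k : R) x : 0 < k ->
  radial_ext f (k *: x) = radial_ext f x.
Proof.
move=> k0; rewrite /radial_ext; congr f.
have -> : enorm (k *: x) = k * enorm x.
  rewrite /enorm (_ : dotp _ _ = k ^+ 2 * dotp x x); last by rewrite !dotpE !mxE; ring.
  by rewrite sqrtrM ?sqr_ge0// sqrtr_sqr gtr0_norm.
by rewrite scalerA invfM mulrAC mulVf ?mul1r// gt_eqF.
Qed.

(** The extension is constant along rays. *)
Lemma derive_radial_ext (W : normedModType R) (f : V -> W) x :
  'D_x (radial_ext f) x = 0.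
Proof.
apply: cvg_lim => //; apply: cvg_near_cst; near=> h.
have h1 : 0 < h + 1.
  have : `|h| < 1 by near: h; exact: dnbhs0_lt.
  by rewrite ltr_norml => /andP[]; lra.
rewrite /= (_ : h *: x + x = (h + 1) *: x); last by rewrite scalerDl scale1r.
by rewrite radial_extZ// subrr scaler0.
Unshelve. all: by end_near. Qed.

Section C1.
Variables (W : normedModType R) (f : V -> W).
Hypothesis fC1 : sphere_C1 f.

Lemma C1_radial_sum x v : sphere x -> 'D_v (radial_ext f) x =
  \sum_(i < 3) v 0 i *: 'D_(delta_mx 0 i) (radial_ext f) x.
Proof. by move=> sx; apply: derive_sum_coord; have [] := fC1 (sphere_neq0 sx). Qed.

End C1.

Section gradient.
Variable psi : V -> R.
Hypothesis psiC1 : sphere_C1 psi.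

(** The components of [sphere_grad] in the ambient basis represent the
    derivative of the extension in every direction, by linearity of the
    differential. *)
Lemma sphere_gradE x v : sphere x ->
  dotp v (sphere_grad psi x) = 'D_v (radial_ext psi) x.
Proof.
by move=> sx; rewrite C1_radial_sum// /dotp; apply: eq_bigr => i _; rewrite mxE.
Qed.

Lemma sphere_grad_tangent x : sphere x -> dotp x (sphere_grad psi x) = 0.
Proof. by move=> sx; rewrite sphere_gradE// derive_radial_ext. Qed.

Lemma is_derive_sphere_curve (c : R -> V) (t : R) (dc : V) : (forall s, sphere (c s)) ->
  is_derive t 1 c dc ->
  is_derive t 1 (fun s => psi (c s)) (dotp dc (sphere_grad psi (c t))).
Proof.
move=> sc hc; rewrite sphere_gradE//.
rewrite (_ : (fun _ => _) = radial_ext psi \o c); last first.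
  by apply/funext => s /=; rewrite radial_ext_sphere.
by apply: is_derive_comp_curve => //; have [] := psiC1 (sphere_neq0 (sc t)).
Qed.

Lemma continuous_radial_ext x : x != 0 -> {for x, continuous (radial_ext psi)}.
Proof. by move=> x0; apply: differentiable_continuous; have [] := psiC1 x0. Qed.

Lemma continuous_sphere_grad (a : V) x : x != 0 ->
  {for x, continuous (fun y => dotp a (sphere_grad psi y))}.
Proof.
move=> x0; have [_ dc] := psiC1 x0.
rewrite (_ : (fun _ => _) = (fun y =>
  a 0 0 * 'D_(delta_mx 0 0) (radial_ext psi) y +
  a 0 1 * 'D_(delta_mx 0 1) (radial_ext psi) y +
  a 0 2%:R * 'D_(delta_mx 0 2%:R) (radial_ext psi) y)); last first.
  by apply/funext => y; rewrite dotpE !mxE.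
have h i : {for x, continuous (fun y => a 0 i * 'D_(delta_mx 0 i) (radial_ext psi) y)}.
  by apply: continuousM; [exact: cst_continuous|exact: dc].
exact: continuousD (continuousD (h 0) (h 1)) (h 2%:R).
Qed.

End gradient.

End radial.

Section spherical_coordinates.
Context {R : realType}.
Notation V := 'rV[R]_3.

Definition e_th (th ph : R) : V := row3 (- sin th) (cos th * cos ph) (cos th * sin ph).
Definition e_ph (ph : R) : V := row3 0 (- sin ph) (cos ph).

Lemma sph_point_sphere th ph : sphere (sph_point th ph : V).
Proof.
rewrite sphereE dotpE !row3_coord; have := cos2Dsin2 th; have := cos2Dsin2 ph.
move: (cos th) (sin th) (cos ph) (sin ph) => c s c' s' h1 h2.
have -> : c * c + s * c' * (s * c') + s * s' * (s * s') =
  c ^+ 2 + s ^+ 2 * (c' ^+ 2 + s' ^+ 2) by ring.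
by rewrite h1 mulr1.
Qed.

Lemma is_derive_sph_th (th ph : R) :
  is_derive th 1 (fun t => sph_point t ph : V) (e_th th ph).
Proof.
have h (k : R) : is_derive th 1 (fun t => sin t * k) (cos th * k).
  by apply: is_derive_eq; rewrite scaler0 add0r; exact: mulrC.
exact: is_derive_row3.
Qed.

Lemma is_derive_sph_ph (th ph : R) :
  is_derive ph 1 (fun t => sph_point th t : V) (sin th *: e_ph ph).
Proof.
have -> : sin th *: e_ph ph = row3 0 (sin th * - sin ph) (sin th * cos ph).
  by apply: row3P; rewrite !mxE //= mulr0.
have h (f : R -> R) (df : R) : is_derive ph 1 f df ->
    is_derive ph 1 (fun t => sin th * f t) (sin th * df).
  by move=> ?; apply: is_derive_eq.
exact: is_derive_row3.
Qed.

End spherical_coordinates.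

(** * Integrals in the coordinates of the cylinder *)

Section integration_tools.
Context {R : realType}.
Notation leb := (@lebesgue_measure R).
Notation mR := (measurableTypeR R).
Notation leb2 := (@lebesgue_measure R \x @lebesgue_measure R)%E.

Lemma bounded_integrable d (T : measurableType d) (mu : {measure set T -> \bar R})
    (A : set T) (f : T -> R) (M : R) : measurable A -> (mu A < +oo)%E ->
  measurable_fun A f -> (forall x, A x -> `|f x| <= M) ->
  mu.-integrable A (EFin \o f).
Proof.
move=> mA fA mf fM; apply: measurable_bounded_integrable => //.
exists M; split; first exact: num_real.
by move=> k Mk x Ax; apply: le_trans (fM _ Ax) (ltW Mk).
Qed.

Lemma integral_mrestr d (T : measurableType d) (mu : {measure set T -> \bar R})
    (D A : set T) (mD : measurable D) (f : T -> \bar R) : measurable A ->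
  (mrestr mu mD).-integrable A f ->
  (\int[mrestr mu mD]_(x in A) f x = \int[mu]_(x in A `&` D) f x)%E.
Proof.
move=> mA fi; have mC : measurable (~` D) by exact: measurableC.
transitivity (\int[mrestr mu mD]_(x in A `\` ~` D) f x)%E.
  by apply: negligible_integral => //; rewrite /= /mrestr setICl measure0.
rewrite setDE setCK; apply: eq_measure_integral => B mB BAD.
by rewrite /= /mrestr setIidl// => x /BAD[].
Qed.

(** Both orders of integration are needed: each of the two terms of the
    divergence is integrated first in its own angle. *)
Lemma rect_fubini (X Y : set mR) (K : mR * mR -> R) (M : R) :
  measurable X -> measurable Y -> (leb X < +oo)%E -> (leb Y < +oo)%E ->
  measurable_fun setT K -> (forall x y, X x -> Y y -> `|K (x, y)| <= M) ->
  [/\ leb2.-integrable (X `*` Y) (EFin \o K),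
      (\int[leb2]_(p in X `*` Y) (K p)%:E =
        \int[leb]_(x in X) \int[leb]_(y in Y) (K (x, y))%:E)%E &
      (\int[leb2]_(p in X `*` Y) (K p)%:E =
        \int[leb]_(y in Y) \int[leb]_(x in X) (K (x, y))%:E)%E].
Proof.
move=> mX mY fX fY mK KM.
have mXY : measurable (X `*` Y) by exact: measurableX.
have iK : leb2.-integrable (X `*` Y) (EFin \o K).
  apply: (@bounded_integrable _ _ _ _ _ M) => //.
  - by rewrite /= product_measure1E// lte_mul_pinfty// ge0_fin_numE.
  - exact: measurable_funTS.
  - by move=> [x y] [/= Xx Yy]; exact: KM.
have iK' : leb2.-integrable setT ((EFin \o K) \_ (X `*` Y)).
  by apply/(integrable_mkcond (EFin \o K) mXY).
have patchE' x y : ((EFin \o K) \_ (X `*` Y)) (x, y) =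
    if x \in X then (if y \in Y then (K (x, y))%:E else 0%E) else 0%E.
  rewrite patchE; have [Xx|Xx] := boolP (x \in X); have [Yy|Yy] := boolP (y \in Y).
  - by rewrite mem_set//; split; exact: set_mem.
  - by rewrite memNset// => -[_ /mem_set]; apply/negP.
  - by rewrite memNset// => -[/mem_set Xx' _]; move: Xx; rewrite Xx'.
  - by rewrite memNset// => -[/mem_set Xx' _]; move: Xx; rewrite Xx'.
split => //.
- rewrite integral_mkcond -integral12_prod_meas1// [RHS]integral_mkcond.
  apply: eq_integral => x _; rewrite patchE /fubini_F; case: ifPn => xX.
    rewrite [RHS]integral_mkcond; apply: eq_integral => y _.
    by rewrite [LHS](patchE' x y) xX patchE.
  by apply: integral0_eq => y _; rewrite (patchE' x y) (negbTE xX).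
- rewrite integral_mkcond -integral21_prod_meas1// [RHS]integral_mkcond.
  apply: eq_integral => y _; rewrite patchE /fubini_G; case: ifPn => yY.
    rewrite [RHS]integral_mkcond; apply: eq_integral => x _.
    by rewrite [LHS](patchE' x y) yY patchE.
  by apply: integral0_eq => x _; rewrite (patchE' x y) (negbTE yY); case: ifP.
Qed.

Lemma continuous_FTC (F f : R -> R) (a b : R) : a < b ->
  (forall x : R, is_derive x 1 F (f x)) -> continuous f ->
  (\int[leb]_(x in `[a, b]) (f x)%:E = (F b - F a)%:E)%E.
Proof.
move=> ab dF cf.
have cF x : {for x, continuous F}.
  by apply/differentiable_continuous/derivable1_diffP; have [] := dF x.
rewrite (@continuous_FTC2 _ f F a b)//.
- exact: continuous_subspaceT.
- split => [x _||].
  + by have [] := dF x.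
  + by apply: cvg_at_right_filter; exact: cF.
  + by apply: cvg_at_left_filter; exact: cF.
- by move=> x _; rewrite derive1E; apply: derive_val.
Qed.

End integration_tools.

Section sphere_integral.
Context {R : realType}.
Notation V := 'rV[R]_3.
Notation leb := (@lebesgue_measure R).
Notation mR := (measurableTypeR R).

Lemma open_nonzero : open [set x : V | x != 0].
Proof.
rewrite (_ : mkset _ = ~` [set 0]); last by apply/seteqP; split => x /= /eqP.
apply: closed_openC; apply: accessible_closed_set1.
exact/hausdorff_accessible/norm_hausdorff.
Qed.

Lemma measurable_fun_sphere (G : V -> R) :
  (forall x, x != 0 -> {for x, continuous G}) -> measurable_fun sphere G.
Proof.
move=> cG; apply: (@measurable_funS _ _ _ _ [set x : V | x != 0]).
- by apply: measurable_openV; exact: open_nonzero.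
- by move=> x /sphere_neq0.
have open_nbhs_all (Z : set V) : (forall x, Z x -> nbhs x Z) -> open Z.
  by move=> h; rewrite openE.
apply: (measurability _ (measurable_realfun.RGenOpens.measurableE R)).
move=> _ [_ [a [b ->] <-]]; apply: measurable_openV.
apply: open_nbhs_all => x [/= x0 xab].
have h1 : \forall y \near x, y != 0.
  by apply: open_nbhs_nbhs; split => //; exact: open_nonzero.
have h2 : \forall y \near x, `]a, b[%classic (G y).
  by apply: (cG _ x0); apply: open_nbhs_nbhs; split => //; exact: interval_open.
by near=> y; split; [near: y|near: y].
Unshelve. all: by end_near. Qed.

(** On the sphere the Hausdorff measure is the image of the Lebesgue measure of
    the cylinder, to which Fubini's theorem applies. *)
Lemma zone_integral (Z : set V) (g : V -> R) (c M : R) : -1 <= c <= 1 ->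
  Z = sphere `&` [set x | x 0 0 < c] ->
  measurable_fun sphere g -> (forall x, sphere x -> `|g x| <= M) ->
  [/\ measurable Z, hausdorff2.-integrable Z (EFin \o g) &
  (\int[hausdorff2]_(x in Z) (g x)%:E =
   \int[leb]_(t in `[0%R, (2 * pi)%R[) \int[leb]_(h in `[(-1)%R, c[) (g (cyl (h, t)))%:E)%E].
Proof.
move=> /andP[c1 c2] ZE mg gM.
have mZ : measurable Z.
  rewrite ZE; apply: measurableI; first exact: measurable_sphere.
  have mc : measurable ((fun x : V => x 0 0) @^-1` `]-oo, c[).
    by rewrite -[X in measurable X]setTI; exact: measurable_coordV.
  by apply: (eq_ind _ measurable mc); apply/seteqP; split => x /=; rewrite in_itv.
have ZS : Z `<=` sphere by rewrite ZE => x [].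
have mgZ : measurable_fun Z g by apply: measurable_funS mg => //; exact: measurable_sphere.
split => //.
  apply: (@bounded_integrable _ _ _ _ _ _ M) => //; last by move=> x /ZS; exact: gM.
  by apply: le_lt_trans (hausdorff_sphere_fin); exact: le_outer_measure.
pose g0 : V -> R := g \_ Z.
have mg0 : measurable_fun setT g0.
  by apply/(measurable_restrictT _ mZ).
have g0M x : `|g0 x| <= `|M|.
  rewrite /g0 patchE; case: ifPn => [/set_mem /ZS /gM h|_]; last by rewrite normr0.
  exact: le_trans h (ler_norm _).
have mg0c : measurable_fun setT (g0 \o cyl) by exact: measurableT_comp mg0 measurable_cyl.
rewrite (_ : (\int[hausdorff2]_(x in Z) (g x)%:E)%E =
    (\int[sphere_area]_(x in Z) (g0 x)%:E)%E); last first.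
  rewrite (eq_measure_integral sphere_area); last first.
    move=> A mA AZ; rewrite -hausdorff_sphereE// setIidl//.
    by move=> x /AZ /ZS.
  by apply: eq_integral => x Zx; rewrite /g0 patchE Zx.
have mcZ : measurable (cyl @^-1` Z) by exact: measurable_preimage_cyl.
have pi0 := @pi_gt0 R.
have i0 : (mrestr (leb \x leb)%E (@measurable_rect R)).-integrable (cyl @^-1` Z)
    ((EFin \o g0) \o cyl).
  apply: (@bounded_integrable _ _ _ _ _ (g0 \o cyl) `|M|) => //.
  - apply: le_lt_trans (sphere_area_lty (@measurableT _ V)).
    by apply: (@le_measure _ _ _ (mrestr (leb \x leb)%E (@measurable_rect R)));
      rewrite ?inE//; exact: measurable_preimage_cyl.
  - exact: measurable_funTS.
  - by move=> x _; exact: g0M.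
have h1 : (\int[sphere_area]_(x in Z) (g0 x)%:E)%E =
    (\int[mrestr (leb \x leb)%E (@measurable_rect R)]_(p in cyl @^-1` Z) (g0 (cyl p))%:E)%E.
  apply: (@integral_pushforward _ _ _ _ _ _ measurable_cyl _ Z (EFin \o g0)) => //.
  exact/measurable_EFinP.
apply: etrans h1 _.
have h2 : (\int[mrestr (leb \x leb)%E (@measurable_rect R)]_(p in cyl @^-1` Z) (g0 (cyl p))%:E =
    \int[leb \x leb]_(p in cyl @^-1` Z `&` rect) (g0 (cyl p))%:E)%E.
  pose m2 : {measure set (mR * mR) -> \bar R} := (leb \x leb)%E.
  exact: (@integral_mrestr R _ _ m2 rect (cyl @^-1` Z) (@measurable_rect R)
    (fun p => (g0 (cyl p))%:E) mcZ i0).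
apply: etrans h2 _.
have -> : (\int[leb \x leb]_(p in cyl @^-1` Z `&` rect) (g0 (cyl p))%:E =
    \int[leb \x leb]_(p in rect) (g0 (cyl p))%:E)%E.
  rewrite integral_mkcond [RHS]integral_mkcond; apply: eq_integral => p _.
  rewrite !patchE in_setI; case: (p \in rect); rewrite ?andbF ?andbT//.
  by case: ifPn => // /negP pZ; rewrite /g0 patchE ifF//; apply/negP => /set_mem h;
    apply: pZ; exact/mem_set.
have fin1 : (leb (`[(-1)%R, 1%R]%classic : set R) < +oo)%E.
  by rewrite lebesgue_measure_itv/=; case: ifP => _; rewrite ?ltry// -EFinB ltry.
have fin2 : (leb (`[0%R, (2 * pi)%R[%classic : set R) < +oo)%E.
  by rewrite lebesgue_measure_itv/=; case: ifP => _; rewrite ?ltry// -EFinB ltry.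
have [_ _ ->] := @rect_fubini _ _ _ (g0 \o cyl) `|M| (measurable_itv `[-1, 1])
  (measurable_itv `[0, 2 * pi[) fin1 fin2 mg0c (fun x y _ _ => g0M _).
apply: eq_integral => t _.
rewrite integral_mkcond [RHS]integral_mkcond; apply: eq_integral => h _.
rewrite !patchE /= /g0 patchE.
have [hI|hI] := boolP (h \in (`[-1, c[%classic : set R)).
  have hI' : -1 <= h < c by move: hI; rewrite inE/= in_itv.
  have hI1 : -1 <= h <= 1 by apply/andP; split; lra.
  rewrite ifT; last by rewrite inE/= in_itv.
  rewrite ifT//; apply/mem_set; rewrite ZE; split; first exact: cyl_sphere.
  by rewrite /= /cyl row30; case/andP: hI'.
case: ifPn => // hI2; case: ifPn => // /set_mem; rewrite ZE => -[_] /=.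
rewrite /cyl row30/= => hc; exfalso; move/negP: hI; apply.
by move: hI2; rewrite !inE/= !in_itv/= hc => /andP[->].
Qed.

End sphere_integral.

(** * Continuity, and the cone in coordinates *)

Section continuity_tools.
Context {R : realType}.
Notation V := 'rV[R]_3.

Lemma contM (f g : R -> R) : continuous f -> continuous g ->
  continuous (fun x => f x * g x).
Proof. by move=> cf cg x; apply: continuousM; [exact: cf|exact: cg]. Qed.

Lemma contD (f g : R -> R) : continuous f -> continuous g ->
  continuous (fun x => f x + g x).
Proof. by move=> cf cg x; apply: continuousD; [exact: cf|exact: cg]. Qed.

Lemma contB (f g : R -> R) : continuous f -> continuous g ->
  continuous (fun x => f x - g x).
Proof. by move=> cf cg x; apply: continuousB; [exact: cf|exact: cg]. Qed.

Lemma continuous_row3 (a b c : R -> R) : continuous a -> continuous b ->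
  continuous c -> continuous (fun t => row3 (a t) (b t) (c t) : V).
Proof.
move=> ca cb cc.
rewrite (_ : (fun _ => _) = (fun t => a t *: row3 1 0 0 + b t *: row3 0 1 0 +
    c t *: row3 0 0 1 : V)); last first.
  by apply/funext => t; apply: row3P; rewrite !mxE /=; ring.
have h (f : R -> R) (v : V) : continuous f -> continuous (fun t => f t *: v).
  by move=> cf t; exact: (@continuousZr_tmp R V R f v t (cf t)).
move=> t; exact: continuousD (continuousD (h _ _ ca t) (h _ _ cb t)) (h _ _ cc t).
Qed.

Lemma continuous_dotp2 (u v : R -> V) :
  (forall i, continuous (fun s => u s 0 i)) ->
  (forall i, continuous (fun s => v s 0 i)) ->
  continuous (fun s => dotp (u s) (v s)).
Proof.
move=> cu cv; rewrite (_ : (fun _ => _) = (fun s => u s 0 0 * v s 0 0 +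
    u s 0 1 * v s 0 1 + u s 0 2%:R * v s 0 2%:R)); last first.
  by apply/funext => s; rewrite dotpE.
by apply: contD; [apply: contD|]; apply: contM.
Qed.

Lemma continuous_curve_coord (u : R -> V) i : continuous u -> continuous (fun s => u s 0 i).
Proof.
move=> cu s; apply: (@continuous_comp R V R u (fun x : V => x 0 i)); first exact: cu.
exact: coord_continuous.
Qed.

Lemma measurable_dotp d (T : measurableType d) (u v : T -> V) :
  measurable_fun setT u -> measurable_fun setT v ->
  measurable_fun setT (fun p => dotp (u p) (v p)).
Proof.
move=> mu mv; rewrite (_ : (fun _ => _) = (fun s => u s 0 0 * v s 0 0 +
    u s 0 1 * v s 0 1 + u s 0 2%:R * v s 0 2%:R)); last first.
  by apply/funext => s; rewrite dotpE.
have h i : measurable_fun setT (fun s => u s 0 i * v s 0 i).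
  by apply: measurable_funM; [exact: (measurableT_comp (measurable_coordV i) mu)|
    exact: (measurableT_comp (measurable_coordV i) mv)].
by apply: measurable_funD => //; apply: measurable_funD.
Qed.

Lemma dotp_bound (u v : V) (a b : R) : (forall i, `|u 0 i| <= a) ->
  (forall i, `|v 0 i| <= b) -> `|dotp u v| <= 3 * a * b.
Proof.
move=> ua vb; rewrite /dotp; apply: le_trans (ler_norm_sum _ _ _) _.
apply: (@le_trans _ _ (\sum_(i < 3) a * b)).
  by apply: ler_sum => i _; rewrite normrM ler_pM.
by rewrite sumr_const card_ord le_eqVlt; apply/orP; left; apply/eqP; ring.
Qed.

Lemma sphere_bounded (G : V -> R) : (forall x, x != 0 -> {for x, continuous G}) ->
  exists M, forall x, sphere x -> `|G x| <= M.
Proof.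
move=> cG; have S0 : (sphere : set V) !=set0.
  by exists (sph_point 0 0); exact: sph_point_sphere.
have cS : compact (sphere : set V).
  by rewrite -[sphere]setTI; apply: compact_sphereI; exact: closedT.
have cN : {within sphere, continuous (fun x => `|G x|)}.
  apply: continuous_in_subspaceT => x; rewrite inE => sx.
  apply: (@continuous_comp V R R G (fun r => `|r|)); first exact/cG/sphere_neq0.
  exact: norm_continuous.
have [m _ hm] := compact_EVT_max S0 cS cN.
by exists `|G m| => x sx; apply: hm; rewrite inE.
Qed.

End continuity_tools.

Section cone_region.
Context {R : realType}.
Notation V := 'rV[R]_3.
Variable th0 : R.
Hypothesis th0I : 0 < th0 < pi / 2.

Let pi0 := @pi_gt0 R.

Lemma sin_th0_gt0 : 0 < sin th0.
Proof. by apply: sin_gt0_pi; move: th0I => /andP[? ?]; apply/andP; split; lra. Qed.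

Lemma circle_angle_sym (x y : R) : x ^+ 2 + y ^+ 2 = 1 ->
  exists2 t, - pi <= t <= pi & x = cos t /\ y = sin t.
Proof.
move=> /unit_circle_angle[t t2 [-> ->]].
have [tpi|tpi] := leP t pi.
  by exists t => //; apply/andP; split; lra.
exists (t - 2 * pi); first by apply/andP; split; lra.
by rewrite -[t in LHS](subrK (2 * pi)) mulr_natl cosD2pi -[t in X in _ /\ X = _](subrK (pi *+ 2)) sinD2pi.
Qed.

(** The polar angle is recovered as the arc cosine of the first coordinate,
    which is decreasing. *)
Lemma OmegaE : Omega th0 = sphere `&` [set x : V | x 0 0 < cos th0].
Proof.
have /andP[t0 t2] := th0I.
have tI : th0 \in `[0, pi] by rewrite in_itv/=; apply/andP; split; lra.
apply/seteqP; split => x [sx hx]; split => //=.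
  rewrite ltNge; apply/negP => h; apply: hx.
  have x1 : -1 <= x 0 0 <= 1.
    move: sx; rewrite sphereE dotpE => sx; apply/andP; split; nra.
  have aI : acos (x 0 0) \in `[0, pi] by rewrite in_itv/= acos_ge0 ?acos_lepi.
  have aK : cos (acos (x 0 0)) = x 0 0 by apply: acosK; rewrite in_itv.
  have ale : 0 <= acos (x 0 0) <= th0.
    rewrite acos_ge0//= leNgt; apply/negP => h2.
    have : cos (acos (x 0 0)) < cos th0 by rewrite ltr_cos.
    by rewrite aK; lra.
  have s2 : sin (acos (x 0 0)) ^+ 2 = x 0 1 ^+ 2 + x 0 2%:R ^+ 2.
    by rewrite sin2cos2 aK; move: sx; rewrite sphereE dotpE => <-; ring.
  set s := sin (acos (x 0 0)) in s2.
  have [s0|s0] := eqVneq s 0.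
    exists (acos (x 0 0)), 0; split => //; first by apply/andP; split; lra.
    have := sqr_ge0 (x 0 1); have := sqr_ge0 (x 0 2%:R) => h1 h2.
    apply: row3P; rewrite /sph_point !row3_coord ?aK// -/s s0 mul0r;
      apply/eqP; rewrite -(@sqrf_eq0 R) eq_le; apply/andP; split => //;
      by rewrite s0 expr0n/= in s2; lra.
  have [ph phI [pc ps]] : exists2 t, - pi <= t <= pi & x 0 1 / s = cos t /\ x 0 2%:R / s = sin t.
    apply: circle_angle_sym; rewrite !exprMn -mulrDl -s2 -exprMn divff// expr1n.
    by [].
  exists (acos (x 0 0)), ph; split => //.
  by apply: row3P; rewrite /sph_point !row3_coord ?aK// -/s -?pc -?ps mulrC mulfVK.
move=> [th [ph [thI _ xE]]]; move: hx; rewrite /= xE row30 ltNge => /negP; apply.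
rewrite leNgt ltr_cos//; last by rewrite in_itv/=; move: thI => /andP[? ?]; apply/andP; split; lra.
by rewrite -leNgt; case/andP: thI.
Qed.

Lemma Omega_sphere : Omega th0 `<=` (sphere : set V).
Proof. by move=> x []. Qed.

Lemma is_derive_C_point_e_ph (s : R) :
  is_derive s 1 (C_point th0 : R -> V) (e_ph (s / sin th0)).
Proof.
have sn : sin th0 != 0 by rewrite gt_eqF ?sin_th0_gt0.
have h (f df : R -> R) : (forall t : R, is_derive t 1 f (df t)) ->
    is_derive s 1 (fun r => sin th0 * f (r / sin th0)) (df (s / sin th0)).
  move=> hf; have h1 : is_derive s 1 (fun r => r / sin th0) (sin th0)^-1.
    apply: (@is_derive_eq _ _ _ (fun r : R => r * (sin th0)^-1)) => //.
    by rewrite !scaler0 add0r /GRing.scale /= mulr1.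
  have h2 := @is_derive1_comp R f (fun r => r / sin th0) s _ _ (hf _) h1.
  have h3 := @is_deriveZ _ _ _ _ (sin th0) s 1 _ h2.
  apply: (is_derive_eq h3); rewrite /GRing.scale/=.
  by rewrite mulrCA mulfV ?mulr1.
exact: (@is_derive_row3 R (fun=> cos th0) _ _ s 0 _ _ (@is_derive_cst R R R (cos th0) s 1)
  (h cos (fun t => - sin t) (fun t => is_derive_cos t))
  (h sin cos (fun t => is_derive_sin t))).
Qed.

Lemma C_tangentE (s : R) : C_tangent th0 s = e_ph (s / sin th0) :> V.
Proof.
by rewrite /C_tangent derive1E; apply: derive_val; exact: is_derive_C_point_e_ph.
Qed.

Lemma is_derive_C_point (s : R) :
  is_derive s 1 (C_point th0 : R -> V) (C_tangent th0 s).
Proof. by rewrite C_tangentE; exact: is_derive_C_point_e_ph. Qed.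

Lemma C_normalE (s : R) : C_normal th0 s = - e_th th0 (s / sin th0) :> V.
Proof.
rewrite /C_normal derive1E; congr (- _); apply: derive_val.
exact: is_derive_sph_th.
Qed.

End cone_region.

(** * Substitutions, and functions of the angles *)

Section substitution.
Context {R : realType}.
Notation leb := (@lebesgue_measure R).

Lemma derivable_oo_everywhere (F f : R -> R) (a b : R) :
  (forall x : R, is_derive x 1 F (f x)) -> derivable_oo_LRcontinuous F a b.
Proof.
move=> dF; have cF x : {for x, continuous F}.
  by apply/differentiable_continuous/derivable1_diffP; have [] := dF x.
split => [x _||]; first by have [] := dF x.
- by apply: cvg_at_right_filter; exact: cF.
- by apply: cvg_at_left_filter; exact: cF.
Qed.

Lemma derive1_everywhere (F f : R -> R) :
  (forall x : R, is_derive x 1 F (f x)) -> derive1 F = f.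
Proof. by move=> dF; apply/funext => x; rewrite derive1E; apply: derive_val. Qed.

Lemma substitution_cos (G : R -> R) (a : R) : 0 <= a <= pi -> continuous G ->
  (\int[leb]_(h in `[(-1)%R, cos a]) (G h)%:E =
   \int[leb]_(t in `[a, pi]) (G (cos t) * sin t)%:E)%E.
Proof.
move=> /andP[a0 api] cG.
have dcos x : is_derive (x : R) 1 cos (- sin x) by exact: is_derive_cos.
have cs : continuous (fun t : R => - sin t).
  by move=> t; apply: continuousN; exact: continuous_sin.
rewrite -[in LHS]cospi integration_by_substitution_decreasing//.
- apply: eq_integral => t _; rewrite (derive1_everywhere dcos).
  by congr EFin; rewrite /= /GRing.mul /= fctE opprK.
- move=> x y xI yI xy; rewrite ltr_cos// in_itv/=.
    by move: (yI); rewrite in_itv/= => /andP[? ?]; apply/andP; split; lra.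
  by move: (xI); rewrite in_itv/= => /andP[? ?]; apply/andP; split; lra.
- by rewrite (derive1_everywhere dcos) => x _; exact: cs.
- rewrite (derive1_everywhere dcos); apply/cvg_ex; exists (- sin a).
  by apply: cvg_at_right_filter; exact: cs.
- rewrite (derive1_everywhere dcos); apply/cvg_ex; exists (- sin pi).
  by apply: cvg_at_left_filter; exact: cs.
- exact: derivable_oo_everywhere dcos.
- exact: continuous_subspaceT.
Qed.

Lemma substitution_scale (G : R -> R) (k b : R) : 0 < k -> 0 <= b -> continuous G ->
  (\int[leb]_(s in `[0%R, (k * b)%R]) (G s)%:E =
   \int[leb]_(t in `[0%R, b]) (G (k * t) * k)%:E)%E.
Proof.
move=> k0 b0 cG.
have dk (x : R) : is_derive x 1 (fun t => k * t) k.
  by apply: is_derive_eq (@is_deriveZ R R R id k x 1 1 _) _; rewrite /GRing.scale/= mulr1.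
have ck : continuous (fun _ : R => k) by move=> t; exact: cst_continuous.
rewrite -[X in `[X, _]](mulr0 k) (@integration_by_substitution_increasing _ (fun t => k * t))//.
- by apply: eq_integral => t _; rewrite (derive1_everywhere dk).
- by move=> x y _ _; rewrite ltr_pM2l.
- by rewrite (derive1_everywhere dk) => x _; exact: ck.
- by rewrite (derive1_everywhere dk); exact: is_cvg_cst.
- by rewrite (derive1_everywhere dk); exact: is_cvg_cst.
- exact: (derivable_oo_everywhere (f := fun=> k)).
- exact: continuous_subspaceT.
Qed.

End substitution.

Section curve_derivatives.
Context {R : realType}.
Notation V := 'rV[R]_3.

Lemma is_derive_coord (u : R -> V) (t : R) (du : V) i : is_derive t 1 u du ->
  is_derive t 1 (fun s => u s 0 i) (du 0 i).
Proof.
move=> [u1 u2]; apply: DeriveDef; first by have /derivable_mxP := u1; exact.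
by rewrite -u2 derive_mx// mxE.
Qed.

Lemma is_derive_dotp (u v : R -> V) (t : R) (du dv : V) :
  is_derive t 1 u du -> is_derive t 1 v dv ->
  is_derive t 1 (fun s => dotp (u s) (v s)) (dotp du (v t) + dotp (u t) dv).
Proof.
move=> hu hv; have h i := is_deriveM (is_derive_coord i hu) (is_derive_coord i hv).
rewrite (_ : (fun _ => _) = (fun s => u s 0 0 * v s 0 0 +
    u s 0 1 * v s 0 1 + u s 0 2%:R * v s 0 2%:R)); last first.
  by apply/funext => s; rewrite dotpE.
apply: is_derive_eq (is_deriveD (is_deriveD (h 0) (h 1)) (h 2%:R)) _.
by rewrite !dotpE /GRing.scale/=; ring.
Qed.

Lemma is_derive_const_dotp (a : V) (u : R -> V) (t : R) (du : V) :
  is_derive t 1 u du -> is_derive t 1 (fun s => dotp a (u s)) (dotp a du).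
Proof.
move=> hu; apply: is_derive_eq (is_derive_dotp (@is_derive_cst R R V a t 1) hu) _.
by rewrite /dotp big1 ?add0r// => i _; rewrite mxE mul0r.
Qed.

Lemma is_derive_e_th (th ph : R) :
  is_derive th 1 (fun t => e_th t ph : V) (- sph_point th ph).
Proof.
have h (k : R) : is_derive th 1 (fun t => cos t * k) (- (sin th * k)).
  by apply: is_derive_eq; rewrite scaler0 add0r /GRing.scale/=; ring.
have h0 : is_derive th 1 (fun t : R => - sin t) (- cos th) by exact: is_derive_eq.
have -> : - sph_point th ph = row3 (- cos th) (- (sin th * cos ph)) (- (sin th * sin ph)) :> V.
  by apply: row3P; rewrite !mxE.
exact: is_derive_row3.
Qed.

Lemma is_derive_e_ph (ph : R) :
  is_derive ph 1 (e_ph : R -> V) (row3 0 (- cos ph) (- sin ph)).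
Proof.
exact: is_derive_row3.
Qed.

End curve_derivatives.

Section angular_functions.
Context {R : realType}.
Notation V := 'rV[R]_3.
Notation mR := (measurableTypeR R).
Implicit Types K H : mR * mR -> R.
Implicit Types U W : mR * mR -> V.

(** The regularity of the integrands in the angles $(\theta,\phi)$ that is
    enough both for Fubini and for the fundamental theorem of calculus in each
    variable; it is stable under the algebraic operations. *)
Definition tame K := [/\ measurable_fun setT K,
  exists M, forall p, `|K p| <= M,
  forall t : R, continuous (fun th : R => K (th, t)) &
  forall th : R, continuous (fun t : R => K (th, t))].

Definition tame_vector U := forall i, tame (fun p => U p 0 i).

Lemma tameM K H : tame K -> tame H -> tame (fun p => K p * H p).
Proof.
move=> [mK [M KM] K1 K2] [mH [N HN] H1 H2]; split.
- exact: measurable_funM.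
- by exists (M * N) => p; rewrite normrM ler_pM.
- by move=> t; apply: contM; [exact: K1|exact: H1].
- by move=> t; apply: contM; [exact: K2|exact: H2].
Qed.

Lemma tameD K H : tame K -> tame H -> tame (fun p => K p + H p).
Proof.
move=> [mK [M KM] K1 K2] [mH [N HN] H1 H2]; split.
- exact: measurable_funD.
- by exists (M + N) => p; rewrite (le_trans (ler_normD _ _))// lerD.
- by move=> t; apply: contD; [exact: K1|exact: H1].
- by move=> t; apply: contD; [exact: K2|exact: H2].
Qed.

Lemma tame_cst (c : R) : tame (fun=> c).
Proof.
split; [exact: measurable_cst|by exists (`|c|) | | ];
  by move=> t s; exact: cst_continuous.
Qed.

Lemma tameN K : tame K -> tame (fun p => - K p).
Proof.
move=> nK; rewrite (_ : (fun _ => _) = (fun p => -1 * K p)); last first.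
  by apply/funext => p; rewrite mulN1r.
exact: tameM (tame_cst (-1)) nK.
Qed.

Lemma tameB K H : tame K -> tame H -> tame (fun p => K p - H p).
Proof. by move=> nK nH; apply: tameD => //; exact: tameN. Qed.

Lemma tame_fst (f : R -> R) (M : R) : continuous f -> (forall x, `|f x| <= M) ->
  tame (fun p => f p.1).
Proof.
move=> cf fM; split; [|by exists M| |].
- exact: measurableT_comp (continuous_measurable_fun cf) measurable_fst.
- by [].
- by move=> t s; exact: cst_continuous.
Qed.

Lemma tame_snd (f : R -> R) (M : R) : continuous f -> (forall x, `|f x| <= M) ->
  tame (fun p => f p.2).
Proof.
move=> cf fM; split; [|by exists M| |].
- exact: measurableT_comp (continuous_measurable_fun cf) measurable_snd.
- by move=> t s; exact: cst_continuous.
- by [].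
Qed.

Lemma norm_cos_le1 (x : R) : `|cos x| <= 1.
Proof. by rewrite ler_norml cos_geN1 cos_le1. Qed.

Lemma norm_sin_le1 (x : R) : `|sin x| <= 1.
Proof. by rewrite ler_norml sin_geN1 sin_le1. Qed.

Lemma tame_cos1 : tame (fun p => cos p.1).
Proof. exact: tame_fst (@continuous_cos R) norm_cos_le1. Qed.
Lemma tame_sin1 : tame (fun p => sin p.1).
Proof. exact: tame_fst (@continuous_sin R) norm_sin_le1. Qed.
Lemma tame_cos2 : tame (fun p => cos p.2).
Proof. exact: tame_snd (@continuous_cos R) norm_cos_le1. Qed.
Lemma tame_sin2 : tame (fun p => sin p.2).
Proof. exact: tame_snd (@continuous_sin R) norm_sin_le1. Qed.

Lemma tame_row3 K0 K1 K2 : tame K0 -> tame K1 -> tame K2 ->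
  tame_vector (fun p => row3 (K0 p) (K1 p) (K2 p)).
Proof.
move=> n0 n1 n2; elim/ord3P.
- by rewrite (_ : (fun _ => _) = K0)//; apply/funext => p; rewrite row30.
- by rewrite (_ : (fun _ => _) = K1)//; apply/funext => p; rewrite row31.
- by rewrite (_ : (fun _ => _) = K2)//; apply/funext => p; rewrite row32.
Qed.

Lemma tame_dotp U W : tame_vector U -> tame_vector W ->
  tame (fun p => dotp (U p) (W p)).
Proof.
move=> nU nW; rewrite (_ : (fun _ => _) = (fun s => U s 0 0 * W s 0 0 +
    U s 0 1 * W s 0 1 + U s 0 2%:R * W s 0 2%:R)); last first.
  by apply/funext => s; rewrite dotpE.
by apply: tameD; [apply: tameD|]; apply: tameM.
Qed.

Lemma tame_vector_cst (a : V) : tame_vector (fun=> a).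
Proof. by move=> i; exact: tame_cst. Qed.

Lemma tame_sph_point : tame_vector (fun p => sph_point p.1 p.2).
Proof.
apply: tame_row3; first exact: tame_cos1.
- exact: tameM tame_sin1 tame_cos2.
- exact: tameM tame_sin1 tame_sin2.
Qed.

Lemma tame_e_th : tame_vector (fun p => e_th p.1 p.2).
Proof.
apply: tame_row3; first exact: tameN tame_sin1.
- exact: tameM tame_cos1 tame_cos2.
- exact: tameM tame_cos1 tame_sin2.
Qed.

Lemma tame_e_ph : tame_vector (fun p => e_ph p.2).
Proof.
apply: tame_row3; first exact: tame_cst.
- exact: tameN tame_sin2.
- exact: tame_cos2.
Qed.

Lemma continuous_sph_th (ph : R) : continuous (fun th => sph_point th ph : V).
Proof.
have cc (c : R) : continuous (fun _ : R => c) by move=> t; exact: cst_continuous.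
by apply: continuous_row3; [exact: continuous_cos|..];
  apply: contM => //; exact: continuous_sin.
Qed.

Lemma continuous_sph_ph (th : R) : continuous (sph_point th : R -> V).
Proof.
have cc (c : R) : continuous (fun _ : R => c) by move=> t; exact: cst_continuous.
by apply: continuous_row3 => //; apply: contM => //;
  [exact: continuous_cos|exact: continuous_sin].
Qed.

Lemma tame_sphere (G : V -> R) : (forall x, x != 0 -> {for x, continuous G}) ->
  tame (fun p => G (sph_point p.1 p.2)).
Proof.
move=> cG; have [M GM] := sphere_bounded cG; split.
- apply: (@measurable_comp _ _ _ _ _ _ sphere G setT).
  + exact: measurable_sphere.
  + by move=> _ [p _ <-]; exact: sph_point_sphere.
  + exact: measurable_fun_sphere.
  + by apply: measurable_fun_coordV => i; have [] := tame_sph_point i.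
- by exists M => p; apply: GM; exact: sph_point_sphere.
- move=> t th; apply: (@continuous_comp R V R (fun s => sph_point s t) G).
    exact: continuous_sph_th.
  by apply: cG; apply: sphere_neq0; exact: sph_point_sphere.
- move=> th t; apply: (@continuous_comp R V R (sph_point th) G).
    exact: continuous_sph_ph.
  by apply: cG; apply: sphere_neq0; exact: sph_point_sphere.
Qed.

End angular_functions.

(** * The divergence theorem outside the cone *)

Section divergence_formula.
Context {R : realType}.

Lemma contN (f : R -> R) : continuous f -> continuous (fun x => - f x).
Proof. by move=> cf x; apply: continuousN; exact: cf. Qed.

Notation V := 'rV[R]_3.
Notation leb := (@lebesgue_measure R).
Notation mR := (measurableTypeR R).
Variable th0 : R.
Hypothesis th0I : 0 < th0 < pi / 2.

Let pi0 := @pi_gt0 R.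

Lemma sin_ge0_cosK (t : R) : 0 <= t <= pi -> lat (cos t) = sin t.
Proof.
move=> tI; rewrite /lat -sin2cos2 sqrtr_sqr ger0_norm//.
by apply: sin_ge0_pi.
Qed.

Lemma cyl_cos (t ph : R) : 0 <= t <= pi -> cyl (cos t, ph) = sph_point t ph.
Proof. by move=> tI; rewrite /cyl /sph_point /= sin_ge0_cosK. Qed.

Lemma cyl_neq0 (h ph : R) : cyl (h, ph) != 0 :> V.
Proof.
have [h1|h1] := boolP (-1 <= h <= 1); first exact/sphere_neq0/cyl_sphere.
apply/eqP => /(congr1 (fun x : V => x 0 0)); rewrite row30 mxE /= => h0.
by move: h1; rewrite h0 oppr_le0 ler01.
Qed.

(** The projection is continuous across the poles, since the square root is
    continuous at zero. *)
Lemma continuous_cyl (ph : R) : continuous (fun h : R => cyl (h, ph) : V).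
Proof.
have cl : continuous (lat : R -> R).
  move=> h; apply: (@continuous_comp R R R (fun h => 1 - h ^+ 2) Num.sqrt).
    by apply: contB => [|]; [move=> t; exact: cst_continuous|exact: exprn_continuous].
  exact: sqrt_continuous.
have cc (c : R) : continuous (fun _ : R => c) by move=> t; exact: cst_continuous.
by apply: continuous_row3 => /=; [by move=> t; exact: cvg_id|..]; apply: contM.
Qed.

Lemma cap_integral_angles (g : V -> R) : (forall x, x != 0 -> {for x, continuous g}) ->
  [/\ measurable (Omega th0), hausdorff2.-integrable (Omega th0) (EFin \o g) &
  (\int[hausdorff2]_(x in Omega th0) (g x)%:E =
   \int[leb]_(t in `[0%R, (2 * pi)%R[) \int[leb]_(th in `[th0, pi])
     (g (sph_point th t) * sin th)%:E)%E].
Proof.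
move=> cg; have [M gM] := sphere_bounded cg.
have /andP[t0 t2] := th0I.
have c1 : -1 <= cos th0 <= 1 by rewrite cos_geN1 cos_le1.
have [mO iO ->] := zone_integral c1 (OmegaE th0I) (measurable_fun_sphere cg) gM.
split => //; apply: eq_integral => t _.
have cgt : continuous (fun h : R => g (cyl (h, t))).
  move=> h; apply: (@continuous_comp R V R (fun h => cyl (h, t)) g).
    exact: continuous_cyl.
  by apply: cg; exact: cyl_neq0.
rewrite integral_itv_bndo_bndc; last first.
  apply: measurable_funTS; apply/measurable_EFinP.
  exact: continuous_measurable_fun.
rewrite (substitution_cos _ cgt); last by apply/andP; split; lra.
apply: eq_integral => th; rewrite inE/= in_itv/= => /andP[h1 h2].
by rewrite cyl_cos//; apply/andP; split; lra.
Qed.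

(** The vectors $e_\theta$, $e_\phi$ and the position form an orthonormal
    frame, so that the scalar product is the sum of the products of the
    components. *)
Lemma sph_frame (a b : V) (th ph : R) : dotp a b =
  dotp a (e_th th ph) * dotp b (e_th th ph) + dotp a (e_ph ph) * dotp b (e_ph ph) +
  dotp a (sph_point th ph) * dotp b (sph_point th ph).
Proof.
rewrite !dotpE !row3_coord; have := cos2Dsin2 th; have := cos2Dsin2 ph.
move: (cos th) (sin th) (cos ph) (sin ph) => c s c' s' h1 h2.
transitivity (a 0 0 * b 0 0 * (c ^+ 2 + s ^+ 2) +
  (a 0 1 * c' + a 0 2%:R * s') * (b 0 1 * c' + b 0 2%:R * s') * (c ^+ 2 + s ^+ 2) +
  (a 0 2%:R * c' - a 0 1 * s') * (b 0 2%:R * c' - b 0 1 * s')); last by ring.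
rewrite h2; transitivity (a 0 0 * b 0 0 +
  (a 0 1 * b 0 1 + a 0 2%:R * b 0 2%:R) * (c' ^+ 2 + s' ^+ 2)); last by ring.
by rewrite h1; ring.
Qed.

Section test_function.
Variable psi : V -> R.
Hypothesis psiC1 : sphere_C1 psi.
Variable a : V.

Let f p := psi (sph_point p.1 p.2).
Let g p := sphere_grad psi (sph_point p.1 p.2).

Let tame_f : tame f.
Proof.
rewrite (_ : f = (fun p => radial_ext psi (sph_point p.1 p.2))).
  by apply: tame_sphere => x; exact: continuous_radial_ext.
by apply/funext => p; rewrite radial_ext_sphere//; exact: sph_point_sphere.
Qed.

Let tame_g : tame_vector g.
Proof.
move=> i; apply: (@tame_sphere _ (fun x => sphere_grad psi x 0 i)) => x x0.
rewrite (_ : (fun _ => _) = (fun x => 'D_(delta_mx 0 i) (radial_ext psi) x)).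
  by have [_] := psiC1 x0; exact.
by apply/funext => y; rewrite mxE.
Qed.

Let k1 (p : mR * mR) : R :=
  (cos p.1 * dotp a (e_th p.1 p.2) - sin p.1 * dotp a (sph_point p.1 p.2)) * f p +
  sin p.1 * dotp a (e_th p.1 p.2) * dotp (e_th p.1 p.2) (g p).

Let k2 (p : mR * mR) : R :=
  dotp a (row3 0 (- cos p.2) (- sin p.2)) * f p +
  dotp a (e_ph p.2) * (sin p.1 * dotp (e_ph p.2) (g p)).

Let tame_k1 : tame k1.
Proof.
have ta := tame_vector_cst a.
apply: tameD; apply: tameM => //.
- apply: tameB; apply: tameM; [exact: tame_cos1| |exact: tame_sin1|].
    exact: tame_dotp ta (@tame_e_th R).
  exact: tame_dotp ta (@tame_sph_point R).
- by apply: tameM; [exact: tame_sin1|exact: tame_dotp ta (@tame_e_th R)].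
- exact: tame_dotp (@tame_e_th R) tame_g.
Qed.

Let tame_k2 : tame k2.
Proof.
have ta := tame_vector_cst a.
apply: tameD; apply: tameM => //.
- apply: tame_dotp ta _; apply: tame_row3; first exact: tame_cst.
    exact: tameN (@tame_cos2 R).
  exact: tameN (@tame_sin2 R).
- exact: tame_dotp ta (@tame_e_ph R).
- by apply: tameM; [exact: tame_sin1|exact: tame_dotp (@tame_e_ph R) tame_g].
Qed.

Let P (ph th : R) := sin th * dotp a (e_th th ph) * psi (sph_point th ph).
Let Q (th ph : R) := dotp a (e_ph ph) * psi (sph_point th ph).

Let is_derive_P (ph th : R) : is_derive th 1 (P ph) (k1 (th, ph)).
Proof.
have h1 := is_derive_sin th.
have h2 := is_derive_const_dotp a (is_derive_e_th th ph).
have h3 := is_derive_sphere_curve psiC1 (fun s => sph_point_sphere s ph)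
  (is_derive_sph_th th ph).
have h := is_deriveM (is_deriveM h1 h2) h3.
apply: is_derive_eq h _; rewrite /k1 /f /g /GRing.scale/=.
rewrite (_ : dotp a (- sph_point th ph) = - dotp a (sph_point th ph)); last first.
  by rewrite !dotpE !mxE; ring.
transitivity (sin th * dotp a (e_th th ph) * dotp (e_th th ph) (sphere_grad psi (sph_point th ph)) +
  psi (sph_point th ph) * (sin th * - dotp a (sph_point th ph) + dotp a (e_th th ph) * cos th)) => //.
by ring.
Qed.

Let is_derive_Q (th ph : R) : is_derive ph 1 (Q th) (k2 (th, ph)).
Proof.
have h2 := is_derive_const_dotp a (is_derive_e_ph ph).
have h3 := is_derive_sphere_curve psiC1 (fun s => sph_point_sphere th s)
  (is_derive_sph_ph th ph).
have h := is_deriveM h2 h3.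
apply: is_derive_eq h _; rewrite /k2 /f /g /GRing.scale/=.
rewrite (_ : dotp (sin th *: e_ph ph) _ = sin th * dotp (e_ph ph) (sphere_grad psi (sph_point th ph))).
  by ring.
by rewrite !dotpE !mxE; ring.
Qed.

Let k12E (th ph : R) : k1 (th, ph) + k2 (th, ph) =
  (dotp a (sphere_grad psi (sph_point th ph)) -
   2 * dotp a (sph_point th ph) * psi (sph_point th ph)) * sin th.
Proof.
have sp := @sph_point_sphere R th ph.
rewrite (sph_frame a (sphere_grad psi _) th ph).
rewrite [dotp (sphere_grad _ _) (sph_point _ _)]dotpC sphere_grad_tangent// mulr0 addr0.
rewrite /k1 /k2 /= (_ : dotp a (row3 0 _ _) = - (sin th * dotp a (sph_point th ph)) -
  cos th * dotp a (e_th th ph)); last first.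
  rewrite !dotpE !row3_coord; have := cos2Dsin2 th.
  move: (cos th) (sin th) (cos ph) (sin ph) => c s c' s' h.
  transitivity (- (a 0 1 * c' + a 0 2%:R * s') * (c ^+ 2 + s ^+ 2)); last by ring.
  by rewrite h; ring.
rewrite ![dotp (sphere_grad _ _) _]dotpC /f /g /=.
by ring.
Qed.

(** Written in the angles, the integrand is $\partial_\theta P+\partial_\phi Q$;
    the second term integrates to zero over a period, and the first leaves the
    boundary value of $P$ on the circle since $P$ vanishes at the pole. *)
Lemma divergence_angles :
  (\int[leb]_(t in `[0%R, (2 * pi)%R[) \int[leb]_(th in `[th0, pi])
     ((dotp a (sphere_grad psi (sph_point th t)) -
   2 * dotp a (sph_point th t) * psi (sph_point th t)) * sin th)%:E =
  \int[leb]_(t in `[0%R, (2 * pi)%R[) (- P t th0)%:E)%E.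
Proof.
have /andP[t0 t2] := th0I.
set X := `[th0, pi]%classic : set mR; set Y := `[0, 2 * pi[%classic : set mR.
have mX : measurable X by exact: measurable_itv.
have mY : measurable Y by exact: measurable_itv.
have fX : (leb X < +oo)%E.
  by rewrite (@lebesgue_measure_itv R `[th0, pi]); case: ifP => _; exact: ltry.
have fY : (leb Y < +oo)%E.
  by rewrite (@lebesgue_measure_itv R `[0, 2 * pi[); case: ifP => _; exact: ltry.
have [mk [M kM] _ _] := tameD tame_k1 tame_k2.
have [mk1 [M1 k1M] ck1 _] := tame_k1; have [mk2 [M2 k2M] _ ck2] := tame_k2.
have [_ _ I] := rect_fubini mX mY fX fY mk (fun x y _ _ => kM (x, y)).
have [i1 _ I1] := rect_fubini mX mY fX fY mk1 (fun x y _ _ => k1M (x, y)).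
have [i2 I2 _] := rect_fubini mX mY fX fY mk2 (fun x y _ _ => k2M (x, y)).
transitivity (\int[leb]_(t in Y) \int[leb]_(th in X) (k1 (th, t) + k2 (th, t))%:E)%E.
  by apply: eq_integral => t _; apply: eq_integral => th _; rewrite k12E.
rewrite -I; transitivity (\int[leb \x leb]_(p in X `*` Y) (k1 p)%:E +
   \int[leb \x leb]_(p in X `*` Y) (k2 p)%:E)%E.
  by rewrite -integralD_EFin//; exact: measurableX.
rewrite I1 I2 [X in (_ + X)%E]integral0_eq ?adde0 => [|th _]; last first.
  rewrite integral_itv_bndo_bndc; last first.
    apply: measurable_funTS; apply/measurable_EFinP.
    exact: continuous_measurable_fun (ck2 th).
  rewrite (continuous_FTC _ (is_derive_Q th) (ck2 th)); last by lra.
  rewrite /Q /e_ph /sph_point -[2 * pi]add0r mulr_natl !cosD2pi !sinD2pi.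
  by rewrite subrr.
apply: eq_integral => t _; rewrite (continuous_FTC _ (is_derive_P t) (ck1 t)); last by lra.
by congr EFin; rewrite [P t pi]/P sinpi !mul0r sub0r.
Qed.

End test_function.

(** The divergence theorem on the complement of the cap for the tangential part
    $a^\top$ of a constant vector: $\operatorname{div} a^\top=-2(a,x)$ on the
    sphere, so that $\operatorname{div}(\psi a^\top)=(a,\nabla\psi)-2(a,x)\psi$. *)
Theorem divergence_cap (psi : V -> R) (a : V) : sphere_C1 psi ->
  [/\ measurable (Omega th0),
  hausdorff2.-integrable (Omega th0) (fun x =>
    (dotp a (sphere_grad psi x) - 2 * dotp a x * psi x)%:E) &
  (\int[hausdorff2]_(x in Omega th0)
     (dotp a (sphere_grad psi x) - 2 * dotp a x * psi x)%:E =
   \int[leb]_(s in `[0%R, C_length th0])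
     (psi (C_point th0 s) * dotp a (C_normal th0 s))%:E)%E].
Proof.
move=> psiC1; have /andP[t0 t2] := th0I.
pose G x := dotp a (sphere_grad psi x) - 2 * dotp x a * radial_ext psi x.
have cG x : x != 0 -> {for x, continuous G}.
  move=> x0; apply: continuousB; first exact: continuous_sphere_grad.
  apply: continuousM; last exact: continuous_radial_ext.
  apply: (@continuousM R V (fun=> 2) (fun y : V => dotp y a)).
    exact: cst_continuous.
  exact: continuous_dotp.
have GE x : sphere x -> dotp a (sphere_grad psi x) - 2 * dotp a x * psi x = G x.
  by move=> sx; rewrite /G radial_ext_sphere// [dotp x a]dotpC.
have [mO iO IO] := cap_integral_angles cG; split => //.
  apply: eq_integrable iO => // x; rewrite inE => -[sx _].
  by rewrite /= GE.
transitivity (\int[hausdorff2]_(x in Omega th0) (G x)%:E)%E.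
  by apply: eq_integral => x; rewrite inE => -[sx _]; rewrite GE.
rewrite IO; transitivity (\int[leb]_(t in `[0%R, (2 * pi)%R[) \int[leb]_(th in `[th0, pi])
     ((dotp a (sphere_grad psi (sph_point th t)) -
   2 * dotp a (sph_point th t) * psi (sph_point th t)) * sin th)%:E)%E.
  apply: eq_integral => t _; apply: eq_integral => th _.
  by rewrite GE//; exact: sph_point_sphere.
rewrite divergence_angles//.
have cn : continuous (fun t : R => dotp a (e_th th0 t)).
  by move=> t; have [_ _ _] := tame_dotp (tame_vector_cst a) (@tame_e_th R); exact.
have cp : continuous (fun t : R => psi (sph_point th0 t)).
  rewrite (_ : (fun _ => _) = (fun t => radial_ext psi (sph_point th0 t))).
    have [_ _ _] := @tame_sphere R (radial_ext psi) (fun x => @continuous_radial_ext R psi psiC1 x); exact.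
  by apply/funext => p; rewrite radial_ext_sphere//; exact: sph_point_sphere.
have cc (c : R) : continuous (fun _ : R => c) by move=> t; exact: cst_continuous.
have sn : sin th0 != 0 by rewrite gt_eqF// sin_th0_gt0.
have cd : continuous (fun s : R => s / sin th0) by apply: contM => // s; exact: cvg_id.
rewrite integral_itv_bndo_bndc; last first.
  apply: measurable_funTS; apply/measurable_EFinP.
  have cF : continuous (fun t : R => - (sin th0 * dotp a (e_th th0 t) * psi (sph_point th0 t))).
    by apply: contN; apply: contM => //; apply: contM.
  exact: continuous_measurable_fun cF.
rewrite /C_length [2 * pi * sin th0]mulrC
  (@substitution_scale R (fun s => psi (C_point th0 s) * dotp a (C_normal th0 s)) (sin th0)) ?sin_th0_gt0//.
- apply: eq_integral => t _; rewrite C_normalE// /C_point [sin th0 * t]mulrC mulfK//.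
  by congr EFin; rewrite !dotpE !mxE; ring.
- by lra.
- apply: contM.
    move=> s; by apply: (@continuous_comp R R R (fun s => s / sin th0) (fun t => psi (sph_point th0 t)));
      [exact: cd|exact: cp].
  rewrite (_ : (fun _ => _) = (fun s => - dotp a (e_th th0 (s / sin th0)))); last first.
    by apply/funext => r; rewrite C_normalE// !dotpE !mxE; ring.
  apply: contN.
  move=> s; by apply: (@continuous_comp R R R (fun s => s / sin th0) (fun t => dotp a (e_th th0 t)));
      [exact: cd|exact: cn].
Qed.

End divergence_formula.

(** * Charges given by a density *)

Section charge_of_density.
Context {R : realType}.
Notation V := 'rV[R]_3.
Variable mu : {finite_measure set V -> \bar R}.

Lemma finite_integrable (A : set V) (f : V -> R) (M : R) : measurable A ->
  measurable_fun A f -> (forall x, A x -> `|f x| <= M) ->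
  mu.-integrable A (EFin \o f).
Proof.
move=> mA; apply: bounded_integrable => //.
by rewrite ltey_eq fin_num_measure.
Qed.

Section density.
Variables (f : V -> R) (M : R).
Hypothesis mf : measurable_fun setT f.
Hypothesis fM : forall x, `|f x| <= M.

Let fi : mu.-integrable setT (EFin \o f).
Proof. by apply: (finite_integrable (M := M)). Qed.

Definition density_charge : charge V R := induced_charge fi.

Lemma density_chargeE A : density_charge A = (\int[mu]_(x in A) (f x)%:E)%E.
Proof. by []. Qed.

Lemma density_charge_dominates : density_charge `<< mu.
Proof.
apply/null_content_dominatesP => A mA muA; rewrite density_chargeE.
by apply: null_set_integral => //; exact: (measurable_int _ (integrableS measurableT mA _ fi)).
Qed.

(** Two densities with the same integrals over all measurable sets agree
    almost everywhere. *)
Lemma RNd_density_charge : {ae mu, forall x, RNd density_charge mu x = f x}.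
Proof.
have dom := density_charge_dominates.
have ri := Radon_Nikodym_integrable dom.
have : ae_eq mu setT (Radon_Nikodym density_charge mu) (EFin \o f).
  apply: integral_ae_eq => //; first exact: measurable_int fi.
  by move=> A _ mA; rewrite -Radon_Nikodym_integral.
by apply: filterS => x; rewrite /RNd => ->.
Qed.

(** The Radon-Nikodym derivatives of the two Jordan components differ by $f$
    almost everywhere, whatever Hahn decomposition was chosen. *)
Lemma cintegral_density_charge (D : set V) (g : V -> R) (N : R) : measurable D ->
  measurable_fun D g -> (forall x, D x -> `|g x| <= N) ->
  cintegral density_charge D g = \int[mu]_(x in D) (f x * g x).
Proof.
move=> mD mg gN; rewrite /cintegral; set PN := svalP (hahn_sets _).
have dom := density_charge_dominates.
have dp := jordan_pos_dominates PN dom; have dn := jordan_neg_dominates PN dom.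
set pos := jordan_pos PN; set neg := jordan_neg PN.
have bi (nu : {finite_measure set V -> \bar R}) : nu.-integrable D (EFin \o g).
  apply: (bounded_integrable (M := N)) => //.
  by rewrite ltey_eq fin_num_measure.
have cp := Radon_Nikodym_change_of_variables dp mD (bi _).
have cn := Radon_Nikodym_change_of_variables dn mD (bi _).
set rp := Radon_Nikodym _ _ in cp; set rn := Radon_Nikodym _ _ in cn.
have ip : mu.-integrable setT rp by exact: Radon_Nikodym_integrable.
have inn : mu.-integrable setT rn by exact: Radon_Nikodym_integrable.
have fp x : rp x \is a fin_num by exact: Radon_Nikodym_fin_num.
have fn x : rn x \is a fin_num by exact: Radon_Nikodym_fin_num.
have gb : [bounded g x | x in D].
  exists N; split; first exact: num_real.
  by move=> k Nk x Dx; apply: le_trans (gN _ Dx) (ltW Nk).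
have iD h : mu.-integrable setT h -> mu.-integrable D h.
  by apply: integrableS.
have igp := integrableMr mD mg gb (iD _ ip).
have ign := integrableMr mD mg gb (iD _ inn).
have rpn : ae_eq mu D (rp \- rn)%E (EFin \o f).
  apply: integral_ae_eq => //.
  - by apply: integrableB => //; exact: iD.
  - exact: measurable_funTS (measurable_int _ fi).
  - move=> A AD mA; rewrite integralB//; last 2 first.
      exact: integrableS measurableT mA _ ip.
      exact: integrableS measurableT mA _ inn.
    have -> : (\int[mu]_(x in A) rp x = pos A)%E by exact: esym (Radon_Nikodym_integral (nu := charge_of_finite_measure pos) dp mA).
    have -> : (\int[mu]_(x in A) rn x = neg A)%E by exact: esym (Radon_Nikodym_integral (nu := charge_of_finite_measure neg) dn mA).
    rewrite -[RHS]/(density_charge A) [RHS](jordan_decomp PN mA).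
    by rewrite /cadd /= cscaleN1.
rewrite /Rintegral -cp -cn -fineB; [|exact: integrable_fin_num..].
rewrite -integralB//; congr fine.
apply: ae_eq_integral => //.
- exact: measurable_int (integrableB mD igp ign).
- apply/measurable_EFinP; apply: measurable_funM => //; exact: measurable_funTS.
apply: filterS rpn => x /[apply] /= E; rewrite EFinM -E muleC muleBl//.
  by rewrite muleC [(rn x * _)%E]muleC.
by rewrite fin_num_adde_defl// fin_numN.
Qed.

End density.
End charge_of_density.

(** * The closure of the domain *)

Section cone_closure.
Context {R : realType}.
Notation V := 'rV[R]_3.
Notation leb := (@lebesgue_measure R).
Variable th0 : R.
Hypothesis th0I : 0 < th0 < pi / 2.

Let pi0 := @pi_gt0 R.

Lemma C_length_gt0 : 0 < C_length th0.
Proof. by rewrite /C_length !mulr_gt0// sin_th0_gt0. Qed.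

Lemma C_curveE : C_curve th0 = sphere `&` [set x : V | x 0 0 = cos th0].
Proof.
have sn := sin_th0_gt0 th0I.
apply/seteqP; split => [_ [s _ <-]|x [sx /= hx]].
  by split; [exact: sph_point_sphere|rewrite /= row30].
have h : (x 0 1 / sin th0) ^+ 2 + (x 0 2%:R / sin th0) ^+ 2 = 1.
  rewrite !exprMn -mulrDl (_ : x 0 1 ^+ 2 + x 0 2%:R ^+ 2 = sin th0 ^+ 2).
    by rewrite -exprMn divff ?expr1n// gt_eqF.
  by rewrite sin2cos2 -hx; move: sx; rewrite sphereE dotpE => <-; ring.
have [t /andP[t0 t2] [ct st]] := unit_circle_angle h.
exists (sin th0 * t).
  rewrite /= in_itv/= mulr_ge0 ?(ltW sn)//= /C_length mulrC ler_wpM2r//.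
  exact: ltW.
rewrite /C_point [sin th0 * t]mulrC mulfK ?gt_eqF//.
by apply: row3P; rewrite /sph_point !row3_coord -?ct -?st ?hx// mulrC mulfVK// gt_eqF.
Qed.

Lemma C_point_curve s : C_curve th0 (C_point th0 s).
Proof.
by rewrite C_curveE; split; [exact: sph_point_sphere|rewrite /= row30].
Qed.

Lemma closed_coord_le (c : R) : closed [set x : V | x 0 0 <= c].
Proof.
apply: (@closed_comp V R (fun x : V => x 0 0) [set r | r <= c]); last exact: closed_le.
by move=> x _; exact: coord_continuous.
Qed.

Lemma closed_coord_eq (c : R) : closed [set x : V | x 0 0 = c].
Proof.
apply: (@closed_comp V R (fun x : V => x 0 0) [set c]); last exact: closed_eq.
by move=> x _; exact: coord_continuous.
Qed.

(** A point of the circle is a limit of points of its meridian with a larger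
    polar angle. *)
Lemma C_curve_closure : C_curve th0 `<=` (clOmega th0 : set V).
Proof.
move=> _ [s _ <-] B nB; rewrite (OmegaE th0I).
have c : (fun th => sph_point th (s / sin th0) : V) @ th0 --> C_point th0 s.
  exact: continuous_sph_th.
have /nbhs_ballP[e /= e0 eB] := c _ nB.
have /andP[t0 t2] := th0I.
pose d := Num.min (e / 2) (pi / 2).
have d0 : 0 < d by rewrite lt_min !divr_gt0.
exists (sph_point (th0 + d) (s / sin th0)); split; last first.
  apply: eB; rewrite -ball_normE /= opprD addrA subrr sub0r normrN gtr0_norm//.
  by rewrite gt_min; apply/orP; left; lra.
split; first exact: sph_point_sphere.
have dpi : d <= pi / 2 by rewrite ge_min lexx orbT.
by rewrite /= row30 ltr_cos ?in_itv/=; [|apply/andP; split..]; lra.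
Qed.

Lemma clOmega_split : clOmega th0 = Omega th0 `|` C_curve th0 :> set V.
Proof.
apply/seteqP; split => [x|x []]; last exact: C_curve_closure.
  have cl : closed (sphere `&` [set x : V | x 0 0 <= cos th0]).
    by apply: closedI; [exact: closed_sphere|exact: closed_coord_le].
  move=> /(closureS (_ : Omega th0 `<=` sphere `&` [set x : V | x 0 0 <= cos th0])).
  rewrite -(proj1 (closure_id _) cl) => h; have [] := h.
    by rewrite (OmegaE th0I) => y [sy /= hy]; split => //=; exact: ltW.
  rewrite (OmegaE th0I) C_curveE => sx /=; rewrite le_eqVlt => /orP[/eqP|] hx.
    by right.
  by left.
exact: subset_closure.
Qed.

Lemma Omega_C_disj : Omega th0 `&` C_curve th0 = set0 :> set V.
Proof.
rewrite (OmegaE th0I) C_curveE; apply/seteqP; split => // x [[_ /= h] [_ /= h2]].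
by rewrite h2 ltxx in h.
Qed.

Lemma clOmega_sphere : clOmega th0 `<=` (sphere : set V).
Proof.
rewrite clOmega_split => x [[]//|]; rewrite C_curveE => -[]//.
Qed.

Lemma measurable_C_curve : measurable (C_curve th0 : set V).
Proof.
rewrite C_curveE; apply: measurableI; first exact: measurable_sphere.
by apply: measurable_closedV; exact: closed_coord_eq.
Qed.

Lemma measurable_clOmega : measurable (clOmega th0 : set V).
Proof. by apply: measurable_closedV; exact: closed_closure. Qed.

Lemma measurable_Omega : measurable (Omega th0 : set V).
Proof.
rewrite (_ : Omega th0 = clOmega th0 `\` C_curve th0).
  exact: measurableD measurable_clOmega measurable_C_curve.
rewrite clOmega_split setDUl setDv setU0; apply/esym/setDidl.
exact: Omega_C_disj.
Qed.

(** On the cylinder the circle is a horizontal line. *)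
Lemma hausdorff_C_curve : hausdorff2 (C_curve th0 : set V) = 0%E.
Proof.
have mA : measurable [set x : V | x 0 0 = cos th0].
  by apply: measurable_closedV; exact: closed_coord_eq.
rewrite C_curveE setIC; apply: etrans (hausdorff_sphereE mA) _.
rewrite sphere_areaE2//; apply: integral0_eq => t _.
apply/eqP; rewrite eq_le measure_ge0 andbT.
apply: (@le_trans _ _ (leb [set cos th0])); last by rewrite lebesgue_measure_set1.
apply: le_measure; rewrite ?inE//.
  apply: measurableI => //.
  rewrite (_ : mkset _ = [set cos th0])//.
  by apply/seteqP; split => h /=; rewrite row30.
by move=> h [_ /=]; rewrite row30.
Qed.

Lemma hausdorff_clOmegaE (A : set V) : measurable A ->
  hausdorff2 (A `&` clOmega th0) = hausdorff2 (A `&` Omega th0).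
Proof.
move=> mA; rewrite clOmega_split setIUr.
apply/eqP; rewrite eq_le; apply/andP; split.
  apply: (@le_trans _ _ (hausdorff2 (A `&` Omega th0) + hausdorff2 (C_curve th0))%E).
    apply: le_trans (measureU2 _ _ _) _; first by apply: measurableI => //; exact: measurable_Omega.
      by apply: measurableI => //; exact: measurable_C_curve.
    apply: leeD => //; apply: le_measure; rewrite ?inE; [|exact: measurable_C_curve|exact: subIsetr].
    by apply: measurableI => //; exact: measurable_C_curve.
  by have -> := hausdorff_C_curve; rewrite adde0.
apply: le_measure; rewrite ?inE.
- by apply: measurableI => //; exact: measurable_Omega.
- apply: measurableU; apply: measurableI => //; first exact: measurable_Omega.
  exact: measurable_C_curve.
- exact: subsetUl.
Qed.

Lemma hausdorff_clOmega_fin : (hausdorff2 (clOmega th0 : set V) < +oo)%E.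
Proof.
apply: le_lt_trans (@hausdorff_sphere_fin R).
apply: le_measure; rewrite ?inE; [exact: measurable_clOmega|exact: measurable_sphere|].
exact: clOmega_sphere.
Qed.

Lemma hausdorff_Omega_fin : (hausdorff2 (Omega th0 : set V) < +oo)%E.
Proof.
apply: le_lt_trans (@hausdorff_sphere_fin R).
apply: le_measure; rewrite ?inE; [exact: measurable_Omega|exact: measurable_sphere|].
exact: Omega_sphere.
Qed.

End cone_closure.

(** * The measure with a mass on the circle *)

Section integral_wrt_density.
Context d (T : measurableType d) {R : realType}.
Variables (nu : {finite_measure set T -> \bar R}).
Variable mu : {sigma_finite_measure set T -> \bar R}.

(** The density is a Radon-Nikodym derivative, to which the change of
    variables for these applies. *)
Lemma integral_density (D E : set T) (f g : T -> R) : measurable D ->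
  measurable E -> E `<=` D -> mu.-integrable D (EFin \o f) ->
  (forall A, measurable A -> nu A = \int[mu]_(x in A `&` D) (f x)%:E)%E ->
  nu.-integrable E (EFin \o g) ->
  (\int[nu]_(x in E) (g x)%:E = \int[mu]_(x in E) (g x * f x)%:E)%E.
Proof.
move=> mD mE ED fi nuE gi.
have dom : nu `<< mu.
  apply/null_content_dominatesP => A mA muA; rewrite nuE//.
  apply: null_set_integral; first exact: measurableI.
    by apply: measurable_int (integrableS mD _ _ fi) => //; exact: measurableI.
  apply/eqP; rewrite eq_le measure_ge0 andbT -muA le_measure ?inE//.
  exact: measurableI.
rewrite -(Radon_Nikodym_change_of_variables dom mE gi).
set rn := Radon_Nikodym _ _.
have ri : mu.-integrable setT rn by exact: Radon_Nikodym_integrable.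
have mg : measurable_fun E (EFin \o g) by exact: measurable_int gi.
have mf : measurable_fun E (EFin \o f).
  by apply: measurable_funS (measurable_int _ fi).
have fr : ae_eq mu D rn (EFin \o f).
  apply: integral_ae_eq => //.
  - exact: integrableS ri.
  - exact: measurable_int fi.
  - move=> A AD mA.
    have -> : (\int[mu]_(x in A) rn x = nu A)%E.
      exact: esym (Radon_Nikodym_integral (nu := charge_of_finite_measure nu) dom mA).
    by rewrite nuE// setIidl.
apply: ae_eq_integral => //.
- apply: emeasurable_funM => //; apply: measurable_funTS; exact: measurable_int ri.
- apply/measurable_EFinP; apply: measurable_funM; exact/measurable_EFinP.
by apply: filterS fr => x h Ex; rewrite /= h//; exact: ED.
Qed.

End integral_wrt_density.

Section cone_measure.
Context {R : realType}.
Notation V := 'rV[R]_3.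
Notation leb := (@lebesgue_measure R).
Notation mR := (measurableTypeR R).
Variables (th0 : R) (W : R -> R).
Hypothesis th0I : 0 < th0 < pi / 2.
Hypothesis cW : continuous W.
Hypothesis W0 : forall s, 0 <= W s.

Let L := C_length th0.

Let mW : measurable_fun (setT : set mR) (W : mR -> R).
Proof. exact: continuous_measurable_fun. Qed.

Let mL : measurable (`[0, L]%classic : set mR).
Proof. exact: measurable_itv. Qed.

Lemma continuous_itv_bound (f : R -> R) (b : R) : 0 <= b -> continuous f ->
  exists M, forall s, 0 <= s <= b -> `|f s| <= M.
Proof.
move=> b0 cf; have cn : {within `[0, b], continuous (fun s => `|f s|)}.
  apply: continuous_subspaceT => s.
  apply: (@continuous_comp R R R f (fun r => `|r|)); first exact: cf.
  exact: norm_continuous.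
have [c _ h] := EVT_max b0 cn.
by exists `|f c| => s sI; apply: h; rewrite in_itv.
Qed.

Lemma lebesgue_itv_fin (b : R) : (leb `[0%R, b]%classic < +oo)%E.
Proof.
by rewrite (@lebesgue_measure_itv R `[0, b]); case: ifP => _; exact: ltry.
Qed.

Lemma continuous_integrable (f : R -> R) (b : R) : 0 <= b -> continuous f ->
  leb.-integrable `[0, b] (EFin \o f).
Proof.
move=> b0 cf; have [M fM] := continuous_itv_bound b0 cf.
apply: (bounded_integrable (M := M)).
- exact: measurable_itv.
- exact: lebesgue_itv_fin.
- exact: measurable_funTS (continuous_measurable_fun cf).
- by move=> s /=; rewrite in_itv/=; exact: fM.
Qed.

Let L0 : 0 <= L. Proof. exact: ltW (C_length_gt0 th0I). Qed.

Let arc_fin : (density_measure leb mW W0 `[0%R, L]%classic < +oo)%E.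
Proof.
rewrite density_measureE.
by have /integrable_lty := continuous_integrable L0 cW; apply; exact: measurable_itv.
Qed.

Let arc_measure : {finite_measure set mR -> \bar R} := mfrestr mL arc_fin.

Let mC : measurable_fun (setT : set mR) (C_point th0 : mR -> V).
Proof.
have cd : continuous (fun s : R => s / sin th0).
  by apply: contM => s; [exact: cvg_id|exact: cst_continuous].
apply: measurable_fun_coordV => i; apply: continuous_measurable_fun.
apply: continuous_curve_coord => s.
apply: (@continuous_comp R R V (fun s => s / sin th0) (sph_point th0)); first exact: cd.
exact: continuous_sph_ph.
Qed.

Let mO : measurable (Omega th0 : set V) := measurable_Omega th0I.

Let total : {measure set V -> \bar R} :=
  measure_add (mrestr hausdorff2 mO) (image_measure arc_measure mC).

Let totalE (A : set V) : total A =
  (hausdorff2 (A `&` Omega th0) + dirac_C th0 W A)%E.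
Proof.
apply: etrans (measure_addE _ _ A) _; congr (_ + _)%E.
by rewrite /dirac_C setIC.
Qed.

Let totalT_fin : (total setT < +oo)%E.
Proof.
have -> : total setT = (mrestr hausdorff2 mO setT + arc_measure setT)%E.
  exact: etrans (measure_addE _ _ setT) _.
apply: lte_add_pinfty.
  by rewrite /mrestr setTI; exact: hausdorff_Omega_fin.
by rewrite ltey_eq fin_num_measure.
Qed.

(** The measure $\mathbb I_\Omega\,d\mathcal H^2+W\delta_C$. *)
Definition cone_measure : {finite_measure set V -> \bar R} :=
  mfrestr measurableT totalT_fin.

Lemma cone_measureE (A : set V) : cone_measure A =
  (hausdorff2 (A `&` Omega th0) + dirac_C th0 W A)%E.
Proof. by rewrite -[LHS]/(total (A `&` setT)) setIT totalE. Qed.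

Lemma cone_measure_closure : cone_measure (~` clOmega th0) = 0%E.
Proof.
rewrite cone_measureE (_ : _ `&` _ = set0); last first.
  by apply/seteqP; split => // x [nx Ox]; apply: nx; exact: subset_closure.
rewrite measure0 add0e /dirac_C (_ : _ `&` _ = set0) ?integral_set0//.
apply/seteqP; split => // s [_ ns]; apply: ns; apply: (C_curve_closure th0I).
exact: C_point_curve.
Qed.

(** The two parts of the measure are integrated separately; the part on the
    circle is an image under the arc-length parametrization. *)
Lemma integral_cone_measure (F : V -> R) (M : R) :
  measurable_fun (clOmega th0) F -> (forall x, clOmega th0 x -> `|F x| <= M) ->
  \int[cone_measure]_(x in clOmega th0) F x =
  \int[hausdorff2]_(x in Omega th0) F x +
  \int[leb]_(s in `[0, L]) (F (C_point th0 s) * W s).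
Proof.
move=> mF FM; set D : set V := clOmega th0.
have mD : measurable D by exact: measurable_clOmega.
have OD : Omega th0 `<=` D by exact: subset_closure.
have iO : hausdorff2.-integrable (Omega th0) (EFin \o F).
  apply: (bounded_integrable (M := M)) => //; [exact: hausdorff_Omega_fin| |].
    by apply: measurable_funS mF.
  by move=> x Ox; apply: FM; exact: OD.
have i1 : (mrestr hausdorff2 mO).-integrable D (EFin \o F).
  apply: (bounded_integrable (M := M)) => //.
  rewrite -[X in (X < _)%E]/(hausdorff2 (D `&` Omega th0)) setIidr//.
  exact: hausdorff_Omega_fin.
pose G := F \_ D.
have mG : measurable_fun setT G by apply/(measurable_restrictT _ mD).
have GM x : `|G x| <= Num.max M 0.
  rewrite /G patchE; case: ifPn => [|_]; last by rewrite normr0 le_max lexx orbT.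
  by rewrite inE => Dx; rewrite le_max FM.
have Cpre : C_point th0 @^-1` D = setT :> set mR.
  apply/seteqP; split => // s _; apply: (C_curve_closure th0I); exact: C_point_curve.
have mGC : measurable_fun (setT : set mR) (G \o C_point th0 : mR -> R).
  exact: measurableT_comp.
have iG : arc_measure.-integrable setT (EFin \o (G \o C_point th0 : mR -> R)).
  apply: (bounded_integrable (M := Num.max M 0)) => //.
    by rewrite ltey_eq fin_num_measure.
  by move=> s _; exact: GM.
have iGL : leb.-integrable `[0, L] (EFin \o (fun s : R => G (C_point th0 s) * W s)).
  have [N WN] := continuous_itv_bound L0 cW.
  apply: (bounded_integrable (M := Num.max M 0 * N)) => //.
  - exact: lebesgue_itv_fin.
  - by apply: measurable_funTS; apply: measurable_funM.
  - by move=> s; rewrite /= in_itv/= => sI; rewrite normrM ler_pM// WN.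
have FG (m : {measure set V -> \bar R}) : (\int[m]_(x in D) (F x)%:E = \int[m]_(x in D) (G x)%:E)%E.
  by apply: eq_integral => x xD; rewrite /G patchE xD.
have i2 : (image_measure arc_measure mC).-integrable D (EFin \o F).
  apply: (@eq_integrable _ _ _ _ _ mD (EFin \o G)).
    by move=> x xD; rewrite /= /G patchE xD.
  have iGp : arc_measure.-integrable (C_point th0 @^-1` D)
    ((EFin \o G) \o (C_point th0 : mR -> V)) by rewrite Cpre.
  apply: (integrable_pushforward mC _ iGp mD).
  exact/measurable_EFinP.
have E1 : (\int[cone_measure]_(x in D) (F x)%:E = \int[total]_(x in D) (F x)%:E)%E.
  by apply: eq_measure_integral => A _ _; rewrite -[LHS]/(total (A `&` setT)) setIT.
have E2 : (\int[total]_(x in D) (F x)%:E = \int[mrestr hausdorff2 mO]_(x in D) (F x)%:E +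
    \int[image_measure arc_measure mC]_(x in D) (F x)%:E)%E.
  apply: integral_measure_add => //; exact/measurable_EFinP.
have E3 : (\int[mrestr hausdorff2 mO]_(x in D) (F x)%:E =
    \int[hausdorff2]_(x in Omega th0) (F x)%:E)%E.
  by have := integral_mrestr mD i1; rewrite setIidr.
have E4 : (\int[image_measure arc_measure mC]_(x in D) (F x)%:E =
    \int[leb]_(s in `[0%R, L]) (G (C_point th0 s) * W s)%:E)%E.
  rewrite FG; apply: etrans (@integral_pushforward _ _ _ _ _ _ mC arc_measure D (EFin \o G) _ _ mD) _.
  - exact/measurable_EFinP.
  - by rewrite Cpre.
  rewrite Cpre.
  transitivity (\int[arc_measure]_(s in `[0%R, L]) (G (C_point th0 s))%:E)%E.
    have mN : measurable (~` `[0, L]%classic : set mR) by exact: measurableC.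
    have aN : arc_measure (~` `[0, L]%classic) = 0%E.
      have -> : arc_measure (~` `[0, L]%classic) =
        density_measure leb mW W0 (~` `[0, L]%classic `&` `[0, L]%classic) by [].
      by rewrite setICl measure0.
    have := negligible_integral mN measurableT iG aN.
    by rewrite setTD setCK.
  have arcE (A : set mR) : measurable A ->
    arc_measure A = (\int[leb]_(s in A `&` `[0%R, L]) (W s)%:E)%E by [].
  have iGS := integrableS measurableT mL (@subsetT _ _) iG.
  exact: (@integral_density _ mR R arc_measure leb `[0, L]%classic `[0, L]%classic W
    (G \o C_point th0) mL mL (@subset_refl _ _) (continuous_integrable L0 cW) arcE iGS).
rewrite /Rintegral E1 E2 E3 E4 fineD; last 2 first.
- exact: integrable_fin_num iO.
- exact: integrable_fin_num iGL.
congr (_ + fine _); apply: eq_integral => s _.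
by congr (_ * _)%:E; rewrite /G patchE ifT// inE; apply: (C_curve_closure th0I); exact: C_point_curve.
Qed.

End cone_measure.

(** * The pressure measure *)

Section constant_pressure.
Context {R : realType}.
Notation V := 'rV[R]_3.
Variables (th0 p0 : R).
Hypothesis th0I : 0 < th0 < pi / 2.
Hypothesis p0_ge0 : 0 <= p0.

Let mO : measurable (Omega th0 : set V) := measurable_Omega th0I.
Let mD : measurable (clOmega th0 : set V) := measurable_clOmega th0.

Let scaled : {measure set V -> \bar R} := mscale (NngNum p0_ge0) hausdorff2.

Let scaled_fin : (scaled (clOmega th0) < +oo)%E.
Proof.
have -> : scaled (clOmega th0) = (p0%:E * hausdorff2 (clOmega th0 : set V))%E by [].
apply: lte_mul_pinfty => //; exact: hausdorff_clOmega_fin.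
Qed.

Definition pressure_measure : {finite_measure set V -> \bar R} :=
  mfrestr mD scaled_fin.

Lemma pressure_measureE (A : set V) :
  pressure_measure A = (p0%:E * hausdorff2 (A `&` clOmega th0))%E.
Proof. by []. Qed.

Lemma integral_pressure_measure (F : V -> R) (M : R) :
  measurable_fun (clOmega th0) F -> (forall x, clOmega th0 x -> `|F x| <= M) ->
  \int[pressure_measure]_(x in clOmega th0) F x =
  p0 * \int[hausdorff2]_(x in Omega th0) F x.
Proof.
move=> mF FM; set D : set V := clOmega th0.
have OD : Omega th0 `<=` D by exact: subset_closure.
pose mu : {finite_measure set V -> \bar R} := mfrestr mO (hausdorff_Omega_fin th0I).
have muE A : mu A = hausdorff2 (A `&` Omega th0) by [].
have ip : mu.-integrable D (EFin \o (fun=> p0)).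
  by apply: (@finite_integrable R mu D (fun=> p0) `|p0|) => //; exact: measurable_cst.
have iF : pressure_measure.-integrable D (EFin \o F) by exact: (@finite_integrable R pressure_measure D F M).
have pE A : measurable A ->
    pressure_measure A = (\int[mu]_(x in A `&` D) (p0)%:E)%E.
  move=> mA; rewrite pressure_measureE integral_cst; last exact: measurableI.
  congr (_ * _)%E; rewrite -[RHS]/(hausdorff2 ((A `&` D) `&` Omega th0)).
  by rewrite -setIA [D `&` _]setIidr// hausdorff_clOmegaE.
have E1 := @integral_density _ V R pressure_measure mu D D (fun=> p0) F mD mD
  (@subset_refl _ _) ip pE iF.
have iFp : mu.-integrable D (EFin \o (fun x => F x * p0)).
  apply: (@finite_integrable R mu D _ (M * `|p0|)) => //.
    by apply: measurable_funM => //; exact: measurable_cst.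
  by move=> x Dx; rewrite normrM ler_wpM2r// FM.
have E2 : (\int[mu]_(x in D) (F x * p0)%:E = \int[hausdorff2]_(x in Omega th0) (F x * p0)%:E)%E.
  by have := integral_mrestr mD iFp; rewrite setIidr.
have iO : hausdorff2.-integrable (Omega th0) (EFin \o F).
  apply: (bounded_integrable (M := M)) => //; [exact: hausdorff_Omega_fin| |].
    by apply: measurable_funS mF.
  by move=> x Ox; apply: FM; exact: OD.
rewrite {1}/Rintegral E1 E2 -/(Rintegral _ _ _) -RintegralZl//.
by apply: eq_Rintegral => x _; rewrite mulrC.
Qed.

End constant_pressure.

(** * The arc length on the circle *)

Section circle_arc.
Context {R : realType}.
Notation V := 'rV[R]_3.
Notation mR := (measurableTypeR R).
Variable th0 : R.
Hypothesis th0I : 0 < th0 < pi / 2.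

Let pi0 := @pi_gt0 R.
Let L := C_length th0.
Let sn0 : 0 < sin th0 := sin_th0_gt0 th0I.

Lemma cos_lt1 (d : R) : 0 < d < 2 * pi -> cos d < 1.
Proof.
move=> /andP[d0 d2]; have h : 0 < sin (d / 2).
  by apply: sin_gt0_pi; apply/andP; split; lra.
have -> : d = (d / 2) *+ 2 by rewrite mulr2n; lra.
rewrite cos_mulr2n; have := cos2Dsin2 (d / 2); move: h.
by move: (sin _) (cos _) => s c h1 h2; nra.
Qed.

Lemma angle_inj (t t' : R) : 0 <= t < 2 * pi -> 0 <= t' < 2 * pi ->
  cos t = cos t' -> sin t = sin t' -> t = t'.
Proof.
wlog tt : t t' / t <= t'.
  move=> h tI tI' c s; have [le|/ltW le] := leP t t'; first exact: h.
  by apply/esym; exact: h.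
move=> /andP[t0 t2] /andP[t0' t2'] c s.
move: tt; rewrite le_eqVlt => /orP[/eqP//|lt].
have : cos (t' - t) < 1 by apply: cos_lt1; apply/andP; split; lra.
by rewrite cosB c s -!expr2 cos2Dsin2 ltxx.
Qed.

(** An angle in a half-open turn is determined by its cosine and sine. *)
Lemma C_arcK (s : R) : 0 <= s < L -> C_arc th0 (C_point th0 s) = s.
Proof.
move=> sI; apply: xget_unique => // s' [sI' e].
have ang (r : R) : 0 <= r < L -> 0 <= r / sin th0 < 2 * pi.
  move=> /andP[r0 rL]; rewrite divr_ge0 ?(ltW sn0)//= ltr_pdivrMr//.
have [ec es] : cos (s' / sin th0) = cos (s / sin th0) /\ sin (s' / sin th0) = sin (s / sin th0).
  split; [move: (congr1 (fun x : V => x 0 1) e)|move: (congr1 (fun x : V => x 0 2%:R) e)];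
    rewrite !row3_coord => /mulfI; apply; exact: lt0r_neq0.
have := angle_inj (ang _ sI') (ang _ sI) ec es.
by move=> /(congr1 (fun r => r * sin th0)); rewrite !mulfVK ?gt_eqF.
Qed.

Lemma C_point_length : C_point th0 L = C_point th0 0 :> V.
Proof.
rewrite /C_point mulfK ?gt_eqF// mul0r -[2 * pi]add0r mulr_natl /sph_point.
by rewrite cosD2pi sinD2pi.
Qed.

(** The arc length is only recovered modulo the length of the circle, which
    does not matter for periodic functions. *)
Lemma periodic_C_arc (T : Type) (f : R -> T) : (forall s, f (s + L) = f s) ->
  forall s, 0 <= s <= L -> f (C_arc th0 (C_point th0 s)) = f s.
Proof.
move=> fp s /andP[s0]; rewrite le_eqVlt => /orP[/eqP->|sL].
  rewrite C_point_length C_arcK; first by rewrite -[L]add0r fp.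
  by rewrite lexx /=; exact: C_length_gt0.
by rewrite C_arcK// s0.
Qed.

Lemma C_arc_itv (x : V) : 0 <= C_arc th0 x <= L.
Proof.
rewrite /C_arc; set S := mkset _.
have [[s Ss]|nS] := pselect (exists s, S s).
  by have [/andP[h1 /ltW h2] _] := @xgetPex _ 0 S (ex_intro _ s Ss); rewrite h1.
rewrite xgetPN; last by move=> s Ss; apply: nS; exists s.
by rewrite lexx /=; exact/ltW/C_length_gt0.
Qed.

Lemma C_curve_half_open (x : V) : C_curve th0 x ->
  exists2 s, 0 <= s < L & x = C_point th0 s.
Proof.
move=> [s]; rewrite /= in_itv/= => /andP[s0 sL] <-.
move: sL; rewrite le_eqVlt => /orP[/eqP->|sL]; last by exists s; rewrite ?s0.
exists 0; last exact: C_point_length.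
by rewrite lexx /=; exact: C_length_gt0.
Qed.

Lemma continuous_C_point : continuous (C_point th0 : R -> V).
Proof.
have cd : continuous (fun s : R => s / sin th0).
  by apply: contM => s; [exact: cvg_id|exact: cst_continuous].
move=> s; apply: (@continuous_comp R R V (fun s => s / sin th0) (sph_point th0)); first exact: cd.
exact: continuous_sph_ph.
Qed.

(** The points of the circle with arc length at most $a$ form the compact
    image of an interval. *)
Lemma measurable_C_arc : measurable_fun setT (C_arc th0 : V -> R).
Proof.
apply: (measurability _ (measurable_realfun.RGenOInfty.measurableE R)).
move=> _ [_ [a ->] <-]; rewrite setTI.
have [aL|aL] := leP L a.
  rewrite (_ : _ @^-1` _ = set0)//; apply/seteqP; split => // x /=.
  by rewrite in_itv/= andbT; have /andP[_] := C_arc_itv x; lra.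
have [a0|a0] := ltP a 0.
  rewrite (_ : _ @^-1` _ = setT)//; apply/seteqP; split => // x _ /=.
  by rewrite in_itv/= andbT; have /andP[] := C_arc_itv x; lra.
rewrite (_ : _ @^-1` _ = C_curve th0 `\` (C_point th0 @` `[0, a])).
  apply: measurableD; first exact: measurable_C_curve.
  apply: measurable_closedV; apply: compact_closed; first exact: norm_hausdorff.
  apply: continuous_compact; last exact: segment_compact.
  exact/continuous_subspaceT/continuous_C_point.
apply/seteqP; split => [x /=|x [/C_curve_half_open[s sI ->] h]].
  rewrite in_itv/= andbT => ax; split.
    apply: contrapT => nC; move: ax; rewrite /C_arc xgetPN; first by lra.
    by move=> s [/andP[s0 sL] e]; apply: nC; exists s => //=; rewrite in_itv/= s0 ltW.
  move=> [s /=]; rewrite in_itv/= => /andP[s0 sa] e.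
  by move: ax; rewrite -e C_arcK; [lra|apply/andP; split; lra].
rewrite /= in_itv/= andbT C_arcK// ltNge; apply/negP => sa.
apply: h; exists s => //=; rewrite in_itv/= sa andbT.
by case/andP: sI.
Qed.

End circle_arc.

(** * The fields of the solution *)

Section solution_fields.
Context {R : realType}.
Notation V := 'rV[R]_3.
Notation mR := (measurableTypeR R).
Variables (th0 alpha0 : R).
Hypothesis th0I : 0 < th0 < pi / 2.

Let pi0 := @pi_gt0 R.
Let L := C_length th0.
Let mO : measurable (Omega th0 : set V) := measurable_Omega th0I.
Let mC : measurable (C_curve th0 : set V) := measurable_C_curve th0I.

Let indicO (x : V) : Omega th0 x -> \1_(Omega th0) x = 1 :> R /\ \1_(C_curve th0) x = 0 :> R.
Proof.
move=> Ox; rewrite !indicE mem_set// memNset// => Cx.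
by have : (Omega th0 `&` C_curve th0) x by []; rewrite Omega_C_disj.
Qed.

Let indicC (x : V) : C_curve th0 x -> \1_(Omega th0) x = 0 :> R /\ \1_(C_curve th0) x = 1 :> R.
Proof.
move=> Cx; rewrite !indicE (mem_set Cx) memNset// => Ox.
by have : (Omega th0 `&` C_curve th0) x by []; rewrite Omega_C_disj.
Qed.

Let indicN (x : V) : ~ Omega th0 x -> ~ C_curve th0 x ->
  \1_(Omega th0) x = 0 :> R /\ \1_(C_curve th0) x = 0 :> R.
Proof. by move=> nO nC; rewrite !indicE !memNset. Qed.

Let cases (x : V) : [\/ Omega th0 x, exists2 s, 0 <= s < L & x = C_point th0 s |
  ~ Omega th0 x /\ ~ C_curve th0 x].
Proof.
have [|nO] := pselect (Omega th0 x); first by constructor 1.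
have [Cx|nC] := pselect (C_curve th0 x); last by constructor 3.
by constructor 2; exact: C_curve_half_open.
Qed.

Section velocity.
Variable ut : R -> R.
Hypothesis cut : continuous ut.
Let u := u_sol th0 alpha0 ut.

Lemma u_sol_Omega (x : V) : Omega th0 x -> u x = u0 alpha0 x.
Proof. by move=> Ox; rewrite /u /u_sol; have [-> ->] := indicO Ox; rewrite scale1r mul0r scale0r addr0. Qed.

Lemma u_sol_outside (x : V) : ~ Omega th0 x -> ~ C_curve th0 x -> u x = 0.
Proof. by move=> nO nC; rewrite /u /u_sol; have [-> ->] := indicN nO nC; rewrite mul0r !scale0r addr0. Qed.

Let u_sol_arc (x : V) : C_curve th0 x ->
  u x = ut (C_arc th0 x) *: C_tangent th0 (C_arc th0 x).
Proof. by move=> Cx; rewrite /u /u_sol; have [-> ->] := indicC Cx; rewrite scale0r add0r mul1r. Qed.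

Lemma C_tangent_periodic s : C_tangent th0 (s + L) = C_tangent th0 s :> V.
Proof.
rewrite !C_tangentE// mulrDl mulfK ?gt_eqF ?sin_th0_gt0// mulr_natl /e_ph.
by rewrite cosD2pi sinD2pi.
Qed.

Lemma u_sol_C (s : R) : periodic ut L -> 0 <= s <= L ->
  u (C_point th0 s) = ut s *: C_tangent th0 s.
Proof.
move=> pu sI; rewrite u_sol_arc; last exact: C_point_curve.
congr (_ *: _); first exact: (@periodic_C_arc _ _ th0I _ ut pu).
exact: (@periodic_C_arc _ _ th0I _ (C_tangent th0) C_tangent_periodic).
Qed.

Lemma dotp_u0 (x : V) : sphere x -> dotp (u0 alpha0 x) x = 0.
Proof.
rewrite sphereE => sx; rewrite /u0 /w0.
transitivity (dotp (V0 alpha0) x * (1 - dotp x x)); last by rewrite sx subrr mulr0.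
by rewrite !dotpE !mxE; ring.
Qed.

Lemma dotp_tangent (s : R) : dotp (C_tangent th0 s) (C_point th0 s) = 0.
Proof.
by rewrite C_tangentE// /C_point /sph_point dotpE !row3_coord; ring.
Qed.

(** The velocity is tangent to the sphere in $\Omega$, to the circle on $C$,
    and zero elsewhere. *)
Lemma u_sol_tangent (x : V) : dotp (u x) x = 0.
Proof.
case: (cases x) => [Ox|[s sI ->]|[nO nC]].
- by rewrite u_sol_Omega// dotp_u0//; exact: Omega_sphere Ox.
- rewrite u_sol_arc; last exact: C_point_curve.
  rewrite C_arcK//; transitivity (ut s * dotp (C_tangent th0 s) (C_point th0 s)).
    by rewrite !dotpE !mxE; ring.
  by rewrite dotp_tangent mulr0.
- by rewrite u_sol_outside// dotpE !mxE !mul0r !addr0.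
Qed.

Lemma continuous_w0 : continuous (w0 alpha0 : V -> R).
Proof.
rewrite (_ : w0 alpha0 = (fun x : V => dotp x (V0 alpha0))); last first.
  by apply/funext => x; rewrite /w0 dotpC.
exact: continuous_dotp.
Qed.

Lemma continuous_u0 i : continuous (fun x : V => u0 alpha0 x 0 i).
Proof.
rewrite (_ : (fun _ => _) = (fun x : V => V0 alpha0 0 i - w0 alpha0 x * x 0 i)); last first.
  by apply/funext => x; rewrite /u0 !mxE.
move=> x; apply: (@continuousB R R V (fun=> V0 alpha0 0 i) (fun x : V => w0 alpha0 x * x 0 i)).
  exact: cst_continuous.
apply: (@continuousM R V (w0 alpha0) (fun x : V => x 0 i)); first exact: continuous_w0.
exact: coord_continuous.
Qed.

Lemma measurable_u_sol i : measurable_fun setT (fun x => u x 0 i).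
Proof.
rewrite (_ : (fun _ => _) = (fun x : V => \1_(Omega th0) x * u0 alpha0 x 0 i +
    \1_(C_curve th0) x * ut (C_arc th0 x) * C_tangent th0 (C_arc th0 x) 0 i)); last first.
  by apply/funext => x; rewrite /u /u_sol !mxE.
have mA := measurable_C_arc th0I.
apply: measurable_funD; apply: measurable_funM.
- exact: measurable_indic.
- by apply: measurable_fun_contV; exact: continuous_u0.
- apply: measurable_funM; first exact: measurable_indic.
  exact: measurableT_comp (continuous_measurable_fun cut) mA.
- have ct : continuous (fun s : R => C_tangent th0 s 0 i : R).
    rewrite (_ : (fun _ => _) = (fun s => e_ph (s / sin th0) 0 i)); last first.
      by apply/funext => s; rewrite C_tangentE.
    move=> s; apply: (@continuous_comp R R R (fun s => s / sin th0) (fun t => e_ph t 0 i)).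
      by apply: continuousM; [exact: cvg_id|exact: cst_continuous].
    by have [_ _ _ ] := @tame_e_ph R i => /(_ 0); exact.
  exact: measurableT_comp (continuous_measurable_fun ct) mA.
Qed.

Lemma u_sol_bounded : exists M, forall x i, `|u x 0 i| <= M.
Proof.
have [M uM] := continuous_itv_bound (ltW (C_length_gt0 th0I)) cut.
have hO i : exists M, forall x : V, sphere x -> `|u0 alpha0 x 0 i| <= M.
  by apply: sphere_bounded => x _; exact: continuous_u0.
have [M0 h0] := hO 0; have [M1 h1] := hO 1; have [M2 h2] := hO 2%:R.
have M0p : 0 <= M0 by apply: le_trans (h0 _ (sph_point_sphere 0 0)).
have M1p : 0 <= M1 by apply: le_trans (h1 _ (sph_point_sphere 0 0)).
have M2p : 0 <= M2 by apply: le_trans (h2 _ (sph_point_sphere 0 0)).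
have Mp : 0 <= M.
  by apply: le_trans (uM 0 _) => //; rewrite lexx ltW// C_length_gt0.
exists (M0 + M1 + M2 + M) => x i; case: (cases x) => [Ox|[s sI ->]|[nO nC]].
- rewrite u_sol_Omega//; have sx := Omega_sphere Ox.
  move: i; elim/ord3P; have := h0 _ sx; have := h1 _ sx; have := h2 _ sx.
  + by move=> *; apply: (@le_trans _ _ M0) => //; lra.
  + by move=> *; apply: (@le_trans _ _ M1) => //; lra.
  + by move=> *; apply: (@le_trans _ _ M2) => //; lra.
- rewrite u_sol_arc; last exact: C_point_curve.
  rewrite C_arcK// mxE normrM.
  have h : `|C_tangent th0 s 0 i| <= 1 :> R.
    rewrite C_tangentE//; move: i; elim/ord3P; rewrite row3_coord ?normr0 ?normrN//.
      exact: norm_sin_le1.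
    exact: norm_cos_le1.
  have h' : `|ut s| <= M by apply: uM; move: sI => /andP[-> /ltW].
  apply: (@le_trans _ _ (M * 1)); first by rewrite ler_pM.
  by rewrite mulr1; lra.
- by rewrite u_sol_outside// mxE normr0; lra.
Qed.

End velocity.

Section radial_velocity.
Variable wC : R -> R.
Hypothesis cw : continuous wC.
Let w := w_sol th0 alpha0 wC.

Lemma w_sol_Omega (x : V) : Omega th0 x -> w x = w0 alpha0 x.
Proof. by move=> Ox; rewrite /w /w_sol; have [-> ->] := indicO Ox; rewrite mulr1 mulr0 addr0. Qed.

Lemma w_sol_outside (x : V) : ~ Omega th0 x -> ~ C_curve th0 x -> w x = 0.
Proof. by move=> nO nC; rewrite /w /w_sol; have [-> ->] := indicN nO nC; rewrite !mulr0 addr0. Qed.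

Let w_sol_arc (x : V) : C_curve th0 x -> w x = wC (C_arc th0 x).
Proof. by move=> Cx; rewrite /w /w_sol; have [-> ->] := indicC Cx; rewrite mulr1 mulr0 add0r. Qed.

Lemma w_sol_C (s : R) : periodic wC L -> 0 <= s <= L -> w (C_point th0 s) = wC s.
Proof.
move=> pw sI; rewrite w_sol_arc; last exact: C_point_curve.
exact: (@periodic_C_arc _ _ th0I _ wC pw).
Qed.

Lemma measurable_w_sol : measurable_fun setT w.
Proof.
apply: measurable_funD; apply: measurable_funM.
- by apply: measurable_fun_contV; exact: continuous_w0.
- exact: measurable_indic.
- exact: measurableT_comp (continuous_measurable_fun cw) (measurable_C_arc th0I).
- exact: measurable_indic.
Qed.

Lemma w_sol_bounded : exists M, forall x, `|w x| <= M.
Proof.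
have [M wM] := continuous_itv_bound (ltW (C_length_gt0 th0I)) cw.
have [N hN] : exists N, forall x : V, sphere x -> `|w0 alpha0 x| <= N.
  by apply: sphere_bounded => x _; exact: continuous_w0.
have Np : 0 <= N by apply: le_trans (hN _ (sph_point_sphere 0 0)).
have Mp : 0 <= M.
  by apply: le_trans (wM 0 _) => //; rewrite lexx ltW// C_length_gt0.
exists (N + M) => x; case: (cases x) => [Ox|[s sI ->]|[nO nC]].
- rewrite w_sol_Omega//; apply: (@le_trans _ _ N); last by rewrite lerDl.
  exact: hN (Omega_sphere Ox).
- rewrite w_sol_arc; last exact: C_point_curve.
  rewrite C_arcK//; apply: (@le_trans _ _ M); last by rewrite lerDr.
  by apply: wM; move: sI => /andP[-> /ltW].
- by rewrite w_sol_outside// normr0; lra.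
Qed.

End radial_velocity.

Section enthalpy.
Variable E0 : R.
Let E := E_sol th0 E0.

Lemma E_sol_closure (x : V) : clOmega th0 x -> E x = E0.
Proof.
rewrite (clOmega_split th0I) => -[Ox|Cx]; rewrite /E /E_sol.
  by have [-> ->] := indicO Ox; rewrite mulr1 mulr0 addr0.
by have [-> ->] := indicC Cx; rewrite mulr1 mulr0 add0r.
Qed.

Lemma measurable_E_sol : measurable_fun setT E.
Proof.
by apply: measurable_funD; apply: measurable_funM;
  [exact: measurable_cst|exact: measurable_indic|exact: measurable_cst|exact: measurable_indic].
Qed.

Lemma E_sol_bounded x : `|E x| <= `|E0|.
Proof.
have [Dx|nD] := pselect (clOmega th0 x); first by rewrite E_sol_closure.
have [nO nC] : ~ Omega th0 x /\ ~ C_curve th0 x.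
  by split => h; apply: nD; rewrite (clOmega_split th0I); [left|right].
by rewrite /E /E_sol; have [-> ->] := indicN nO nC; rewrite !mulr0 addr0 normr0.
Qed.

End enthalpy.

End solution_fields.

(** * Functions regular off the origin *)

Section regularity_off_origin.
Context {R : realType}.
Notation V := 'rV[R]_3.

Definition continuous_off0 (G : V -> R) := forall x, x != 0 -> {for x, continuous G}.

Definition C1_off0 (G : V -> R) := forall y, y != 0 -> differentiable G y /\
  forall a : V, {for y, continuous (fun z => 'D_a G z)}.

Lemma continuous_off0_eq (f g : V -> R) : (forall x, x != 0 -> f x = g x) ->
  continuous_off0 g -> continuous_off0 f.
Proof.
move=> fg cg x x0; have e : f x = g x by exact: fg.
have h : g @ x --> f x by rewrite e; exact: cg.
have nz : \forall y \near x, g y = f y.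
  have := @open_nonzero R; rewrite openE => /(_ x x0); apply: filterS => y y0.
  exact/esym/fg.
by apply: cvg_trans h; exact: near_eq_cvg nz.
Qed.

Lemma continuous_off0_cst (c : R) : continuous_off0 (fun=> c).
Proof. by move=> x _; exact: cst_continuous. Qed.

Lemma continuous_off0_all (f : V -> R) : continuous f -> continuous_off0 f.
Proof. by move=> cf x _; exact: cf. Qed.

Lemma continuous_off0M (f g : V -> R) : continuous_off0 f -> continuous_off0 g ->
  continuous_off0 (fun x => f x * g x).
Proof. by move=> cf cg x x0; apply: (@continuousM R V f g); [exact: cf|exact: cg]. Qed.

Lemma continuous_off0D (f g : V -> R) : continuous_off0 f -> continuous_off0 g ->
  continuous_off0 (fun x => f x + g x).
Proof. by move=> cf cg x x0; apply: (@continuousD R R V f g); [exact: cf|exact: cg]. Qed.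

Lemma C1_off0_continuous (f : V -> R) : C1_off0 f -> continuous_off0 f.
Proof. by move=> cf x /cf[/differentiable_continuous]. Qed.

Lemma C1_off0M (f g : V -> R) : C1_off0 f -> C1_off0 g ->
  C1_off0 (fun x => f x * g x).
Proof.
move=> cf cg y y0; split; first by apply: (@differentiableM _ _ f g); [case: (cf y y0)|case: (cg y y0)].
move=> a; apply: (@continuous_off0_eq _ (fun z => f z * 'D_a g z + g z * 'D_a f z)) => //.
  by move=> z z0; rewrite (@deriveM _ _ f g)//; apply: diff_derivable;
    [case: (cf z z0)|case: (cg z z0)].
apply: continuous_off0D; apply: continuous_off0M.
- exact: C1_off0_continuous.
- by move=> z z0; case: (cg z z0).
- exact: C1_off0_continuous.
- by move=> z z0; case: (cf z z0).
Qed.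

Lemma C1_off0D (f g : V -> R) : C1_off0 f -> C1_off0 g ->
  C1_off0 (fun x => f x + g x).
Proof.
move=> cf cg y y0; split; first by apply: (@differentiableD _ _ _ f g); [case: (cf y y0)|case: (cg y y0)].
move=> a; apply: (@continuous_off0_eq _ (fun z => 'D_a f z + 'D_a g z)) => //.
  by move=> z z0; rewrite (@deriveD _ _ _ f g)//; apply: diff_derivable;
    [case: (cf z z0)|case: (cg z z0)].
by apply: continuous_off0D => z z0; [case: (cf z z0)|case: (cg z z0)].
Qed.

Lemma C1_off0_cst (c : R) : C1_off0 (fun=> c).
Proof.
move=> y y0; split; first exact: differentiable_cst.
move=> a; apply: (@continuous_off0_eq _ (fun=> 0)) => //; last exact: continuous_off0_cst.
by move=> z _; rewrite derive_cst.
Qed.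

Lemma derive_coord (a y : V) i : 'D_a (fun x : V => x 0 i) y = a 0 i.
Proof.
have h := derive_mx (@derivable_id R V y a).
by have := congr1 (fun x : V => x 0 i) h; rewrite derive_id mxE.
Qed.

Lemma C1_off0_coord i : C1_off0 (fun x : V => x 0 i).
Proof.
move=> y y0; split; first exact: differentiable_coord.
move=> a; apply: (@continuous_off0_eq _ (fun=> a 0 i)) => //; last exact: continuous_off0_cst.
by move=> z _; exact: derive_coord.
Qed.

Lemma C1_off0_dotp (u v : V -> V) : (forall i, C1_off0 (fun x => u x 0 i)) ->
  (forall i, C1_off0 (fun x => v x 0 i)) -> C1_off0 (fun x => dotp (u x) (v x)).
Proof.
move=> cu cv; rewrite (_ : (fun _ => _) = (fun s => u s 0 0 * v s 0 0 +
    u s 0 1 * v s 0 1 + u s 0 2%:R * v s 0 2%:R)); last first.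
  by apply/funext => s; rewrite dotpE.
by apply: C1_off0D; [apply: C1_off0D|]; apply: C1_off0M.
Qed.

Lemma derive_scalar_comp (g : V -> R) (f : R -> R) (df : R) (z a : V) :
  differentiable g z -> is_derive (g z) 1 f df ->
  'D_a (f \o g) z = 'D_a g z * df.
Proof.
move=> dg [d df1]; have {}d : differentiable f (g z) by exact/derivable1_diffP.
rewrite !deriveE//; last exact: differentiable_comp.
rewrite diff_comp//= -df1 deriveE//.
by rewrite -[X in 'd f _ X]mulr1 -[X in 'd f _ X]/(_ *: 1) linearZ.
Qed.

(** Stated away from the origin, where the extensions that are constant along
    rays are regular. *)
Lemma C1_off0_comp (g : V -> R) (f df : R -> R) : C1_off0 g ->
  (forall y, y != 0 -> is_derive (g y) 1 f (df (g y))) ->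
  (forall y, y != 0 -> {for g y, continuous df}) -> C1_off0 (f \o g).
Proof.
move=> cg hf cdf y y0; split.
  apply: differentiable_comp; first by case: (cg y y0).
  by apply/derivable1_diffP; have [] := hf y y0.
move=> a; apply: (@continuous_off0_eq _ (fun z => 'D_a g z * df (g z))) => //.
  by move=> z z0; apply: derive_scalar_comp; [case: (cg z z0)|exact: hf].
apply: continuous_off0M => z z0; first by case: (cg z z0).
apply: (@continuous_comp V R R g df); last exact: cdf.
exact: C1_off0_continuous.
Qed.

End regularity_off_origin.

(** * Gradients and covariant derivatives *)

Section sphere_calculus.
Context {R : realType}.
Notation V := 'rV[R]_3.

Lemma dotpp_gt0 (y : V) : y != 0 -> 0 < dotp y y.
Proof.
move=> y0; rewrite lt_neqAle dotpp_ge0 andbT eq_sym; apply: contra_neq y0.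
rewrite dotpE => e; have := sqr_ge0 (y 0 0); have := sqr_ge0 (y 0 1); have := sqr_ge0 (y 0 2%:R).
move=> h2 h1 h0; apply: row3P; rewrite mxE; apply/eqP; rewrite -sqrf_eq0 eq_le; apply/andP; split => //;
  by lra.
Qed.

Let inv_sqrt (r : R) : R := (Num.sqrt r)^-1.
Let dinv_sqrt (r : R) : R := - (Num.sqrt r) ^- 2 * (2 * Num.sqrt r)^-1.

Let is_derive_inv_sqrt (r : R) : 0 < r -> is_derive r 1 inv_sqrt (dinv_sqrt r).
Proof.
move=> r0; have h := is_derive1_sqrt r0.
by apply: is_deriveV; rewrite gt_eqF// sqrtr_gt0.
Qed.

Let inv_enormE : (fun y : V => (enorm y)^-1) = inv_sqrt \o (fun y : V => dotp y y).
Proof. by []. Qed.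

Let C1_dotpp : C1_off0 (fun y : V => dotp y y).
Proof. by apply: C1_off0_dotp; exact: C1_off0_coord. Qed.

Lemma C1_off0_inv_enorm : C1_off0 (fun y : V => (enorm y)^-1).
Proof.
rewrite inv_enormE; apply: (C1_off0_comp (df := dinv_sqrt)) => // y y0.
  exact: is_derive_inv_sqrt (dotpp_gt0 y0).
have r0 := dotpp_gt0 y0; have s0 : Num.sqrt (dotp y y) != 0 by rewrite gt_eqF ?sqrtr_gt0.
apply: continuousM.
  apply: continuousN; apply: continuousV; first by rewrite expf_neq0.
  apply: continuousM; exact: sqrt_continuous.
apply: continuousV; first by rewrite mulf_neq0.
apply: continuousM; [exact: cst_continuous|exact: sqrt_continuous].
Qed.

Lemma derive_dotp_const (a b x : V) : 'D_b (fun y : V => dotp y a) x = dotp b a.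
Proof.
have h i : derivable (fun y : V => y 0 i * a 0 i) x b.
  by apply: diff_derivable; apply: (@differentiableM _ _ (fun y : V => y 0 i) (fun=> a 0 i));
    [exact: differentiable_coord|exact: differentiable_cst].
rewrite (_ : (fun _ => _) = (fun y : V => y 0 0 * a 0 0) + (fun y : V => y 0 1 * a 0 1) +
    (fun y : V => y 0 2%:R * a 0 2%:R)); last by apply/funext => y; rewrite dotpE.
rewrite deriveD ?deriveD//; last exact: derivableD.
have e i : 'D_b (fun y : V => y 0 i * a 0 i) x = b 0 i * a 0 i.
  rewrite (_ : (fun _ => _) = a 0 i *: (fun y : V => y 0 i)); last first.
    by apply/funext => y; rewrite mulrC.
  by rewrite deriveZ ?derive_coord 1?mulrC//; exact/diff_derivable/differentiable_coord.
by rewrite !e dotpE.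
Qed.

Lemma derive_dotpp (x b : V) : 'D_b (fun y : V => dotp y y) x = 2 * dotp b x.
Proof.
have dc i : derivable (fun y : V => y 0 i) x b by exact/diff_derivable/differentiable_coord.
have h i : derivable (fun y : V => y 0 i * y 0 i) x b by exact: derivableM.
rewrite (_ : (fun _ => _) = (fun y : V => y 0 0 * y 0 0) + (fun y : V => y 0 1 * y 0 1) +
    (fun y : V => y 0 2%:R * y 0 2%:R)); last by apply/funext => y; rewrite dotpE.
rewrite deriveD ?deriveD//; last exact: derivableD.
have e i : 'D_b (fun y : V => y 0 i * y 0 i) x = 2 * (b 0 i * x 0 i).
  rewrite (@deriveM _ _ (fun y : V => y 0 i) (fun y : V => y 0 i))// !derive_coord.
  by rewrite /GRing.scale/=; ring.
by rewrite !e dotpE; ring.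
Qed.

Lemma derive_inv_enorm (x b : V) : sphere x ->
  'D_b (fun y : V => (enorm y)^-1) x = - dotp b x.
Proof.
move=> sx; have x0 := sphere_neq0 sx; rewrite inv_enormE.
have e1 : dotp x x = 1 by rewrite -sphereE.
rewrite (@derive_scalar_comp R (fun y : V => dotp y y) _ _ x b _ (is_derive_inv_sqrt (dotpp_gt0 x0)));
  last by case: (C1_dotpp x0).
rewrite derive_dotpp /dinv_sqrt e1 sqrtr1 expr1n invr1 mulr1.
by rewrite mulN1r mulrN mulrAC divff ?mul1r// pnatr_eq0.
Qed.

Lemma radial_ext_dotp (a : V) :
  radial_ext (fun x : V => dotp a x) = (fun y => (enorm y)^-1 * dotp y a).
Proof. by apply/funext => y; rewrite /radial_ext !dotpE !mxE; ring. Qed.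

Lemma sphere_C1_dotp_const (a : V) : sphere_C1 (fun x : V => dotp a x).
Proof.
rewrite /sphere_C1 radial_ext_dotp.
apply: C1_off0M; first exact: C1_off0_inv_enorm.
by apply: C1_off0_dotp => i; [exact: C1_off0_coord|exact: C1_off0_cst].
Qed.

(** The gradient of a linear form on the sphere is the tangential part of its
    vector. *)
Lemma grad_dotp_const (a b x : V) : sphere x ->
  dotp b (sphere_grad (fun x : V => dotp a x) x) = dotp a b - dotp a x * dotp b x.
Proof.
move=> sx; have x0 := sphere_neq0 sx.
rewrite (sphere_gradE (sphere_C1_dotp_const a) _ sx).
rewrite radial_ext_dotp (@deriveM _ _ (fun y : V => (enorm y)^-1) (fun y : V => dotp y a)); last 2 first.
- by apply: diff_derivable; case: (C1_off0_inv_enorm x0).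
- apply: diff_derivable; have h : C1_off0 (fun y : V => dotp y a).
    by apply: C1_off0_dotp => i; [exact: C1_off0_coord|exact: C1_off0_cst].
  by case: (h _ x0).
rewrite derive_inv_enorm// derive_dotp_const /GRing.scale/= sx invr1 mul1r.
by rewrite [dotp b a]dotpC [dotp x a]dotpC; ring.
Qed.

Lemma sphere_C1M (f g : V -> R) : sphere_C1 f -> sphere_C1 g ->
  sphere_C1 (fun x => f x * g x).
Proof. exact: C1_off0M. Qed.

Lemma sphere_C1D (f g : V -> R) : sphere_C1 f -> sphere_C1 g ->
  sphere_C1 (fun x => f x + g x).
Proof. exact: C1_off0D. Qed.

Lemma sphere_C1_cst (c : R) : sphere_C1 (fun=> c : R).
Proof. exact: C1_off0_cst. Qed.

Lemma gradM (f g : V -> R) (b x : V) : sphere_C1 f -> sphere_C1 g -> sphere x ->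
  dotp b (sphere_grad (fun x => f x * g x) x) =
  f x * dotp b (sphere_grad g x) + g x * dotp b (sphere_grad f x).
Proof.
move=> cf cg sx; have x0 := sphere_neq0 sx.
rewrite (sphere_gradE (sphere_C1M cf cg) _ sx) (sphere_gradE cf _ sx) (sphere_gradE cg _ sx).
rewrite -[radial_ext _]/((radial_ext f) * (radial_ext g)) deriveM.
- by rewrite !radial_ext_sphere.
- by apply: diff_derivable; case: (cf _ x0).
- by apply: diff_derivable; case: (cg _ x0).
Qed.

Section vector_field.
Variable v : V -> V.
Hypothesis vC1 : sphere_C1_field v.
Let ve := radial_ext v.

Let dv (x : V) : x != 0 -> differentiable ve x.
Proof. by move=> x0; have [h _] := vC1; case: (h _ x0). Qed.

Lemma derive_field_coord (x a : V) i : x != 0 ->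
  'D_a (radial_ext (fun x => v x 0 i)) x = 'D_a ve x 0 i.
Proof. by move=> x0; rewrite derive_mx ?mxE//; exact/diff_derivable/dv. Qed.

Lemma sphere_C1_coord i : sphere_C1 (fun x => v x 0 i).
Proof.
move=> y y0; split.
  apply: (@differentiable_comp _ _ _ _ ve (fun x : V => x 0 i)); first exact: dv.
  exact: differentiable_coord.
move=> a; apply: (@continuous_off0_eq _ _ (fun z => 'D_a ve z 0 i)) => //.
  by move=> z z0; exact: derive_field_coord.
move=> z z0; apply: (@continuous_comp V V R (fun z => 'D_a ve z) (fun x : V => x 0 i)).
  by have [h _] := vC1; case: (h _ z0).
exact: coord_continuous.
Qed.

Lemma grad_field_coord (x a : V) i : sphere x ->
  dotp a (sphere_grad (fun x => v x 0 i) x) = 'D_a ve x 0 i.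
Proof.
move=> sx; rewrite (sphere_gradE (sphere_C1_coord i) _ sx).
by rewrite derive_field_coord//; exact: sphere_neq0.
Qed.

Lemma derive_field_sum (x a : V) : x != 0 ->
  'D_a ve x = a 0 0 *: 'D_(delta_mx 0 0) ve x + a 0 1 *: 'D_(delta_mx 0 1) ve x +
    a 0 2%:R *: 'D_(delta_mx 0 2%:R) ve x.
Proof.
move=> x0; rewrite (derive_sum_coord a (dv x0)) !big_ord_recr big_ord0 /= add0r.
pose F i := a 0 i *: 'D_(delta_mx 0 i) ve x.
by congr (_ + _ + _); apply: (congr1 F); exact/val_inj.
Qed.

Lemma derive_field_radial (x : V) : 'D_x ve x = 0.
Proof. exact: derive_radial_ext. Qed.

(** Differentiating $(x,v)=0$. *)
Lemma derive_field_normal (x a : V) : sphere x ->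
  dotp x ('D_a ve x) = - dotp a (v x).
Proof.
move=> sx; have x0 := sphere_neq0 sx.
have vx0 (y : V) : y != 0 -> dotp y (ve y) = 0.
  move=> y0; have e0 : enorm y != 0 by rewrite /enorm gt_eqF// sqrtr_gt0 dotpp_gt0.
  have sy : sphere ((enorm y)^-1 *: y).
    rewrite sphereE (_ : dotp _ _ = (enorm y) ^- 2 * dotp y y).
      by rewrite -enorm_sq mulVf// expf_neq0.
    by rewrite !dotpE !mxE; field.
  have [_ /(_ _ sy) h] := vC1; rewrite /ve /radial_ext.
  transitivity (enorm y * dotp (v ((enorm y)^-1 *: y)) ((enorm y)^-1 *: y)).
    by rewrite !dotpE !mxE; field.
  by rewrite h mulr0.
have D0 : 'D_a (fun y : V => dotp y (ve y)) x = 0.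
  rewrite (@near_eq_derive _ _ _ _ (fun=> 0)) ?derive_cst//.
  have := @open_nonzero R; rewrite openE => /(_ x x0); apply: filterS => y y0.
  exact: vx0.
have dc i : derivable (fun y : V => y 0 i) x a by exact/diff_derivable/differentiable_coord.
have dw i : derivable (fun y : V => ve y 0 i) x a.
  by apply: diff_derivable; have := @sphere_C1_coord i _ x0 => -[].
have h i : derivable (fun y : V => y 0 i * ve y 0 i) x a by exact: derivableM.
have e i : 'D_a (fun y : V => y 0 i * ve y 0 i) x = x 0 i * 'D_a ve x 0 i + v x 0 i * a 0 i.
  rewrite (@deriveM _ _ (fun y : V => y 0 i) (fun y : V => ve y 0 i))// derive_coord.
  rewrite -derive_field_coord// /GRing.scale/=; congr (_ + _ * _).
  by rewrite /ve radial_ext_sphere.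
move: D0; rewrite (_ : (fun _ => _) = (fun y : V => y 0 0 * ve y 0 0) +
    (fun y : V => y 0 1 * ve y 0 1) + (fun y : V => y 0 2%:R * ve y 0 2%:R)); last first.
  by apply/funext => y; rewrite dotpE.
rewrite deriveD ?deriveD//; last exact: derivableD.
rewrite !e !dotpE => /eqP; rewrite addrC => D0; apply/eqP; rewrite -subr_eq0 opprK -(eqP D0).
by apply/eqP; ring.
Qed.

Lemma sphere_DmxE (x : V) i j : sphere_Dmx v x i j =
  'D_(delta_mx 0 j) ve x 0 i - dotp ('D_(delta_mx 0 j) ve x) x * x 0 i.
Proof. by rewrite !mxE. Qed.

(** The normal part of the derivatives does not contribute to the trace,
    because the derivative of the extension vanishes along the ray. *)
Lemma sphere_divE (x : V) : sphere x ->
  sphere_div v x = \sum_(i < 3) dotp (delta_mx 0 i) (sphere_grad (fun x => v x 0 i) x).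
Proof.
move=> sx; have x0 := sphere_neq0 sx.
rewrite /sphere_div /mxtrace.
rewrite (eq_bigr (fun i => dotp (delta_mx 0 i) (sphere_grad (fun x => v x 0 i) x) -
   x 0 i * dotp ('D_(delta_mx 0 i) ve x) x)); last first.
  by move=> i _; rewrite sphere_DmxE grad_field_coord// [_ * x 0 i]mulrC.
rewrite big_split /= sumrN.
have e : \sum_(i < 3) x 0 i * dotp ('D_(delta_mx 0 i) ve x) x = dotp ('D_x ve x) x.
  rewrite (derive_field_sum x x0) sum3E.
  move: ('D_(delta_mx 0 0) ve x) ('D_(delta_mx 0 1) ve x) ('D_(delta_mx 0 2%:R) ve x) => A B C.
  by rewrite !dotpE !mxE; ring.
by rewrite e derive_field_radial [dotp 0 x](_ : _ = 0) ?subr0// dotpE !mxE !mul0r !addr0.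
Qed.

(** On the tangent plane the projection in the covariant derivative is not
    seen. *)
Lemma sphere_Dmx_tangent (x a b : V) : sphere x -> dotp a x = 0 ->
  \sum_(i < 3) \sum_(j < 3) a 0 i * b 0 j * sphere_Dmx v x i j = dotp a ('D_b ve x).
Proof.
move=> sx ax; have x0 := sphere_neq0 sx.
rewrite (derive_field_sum b x0).
under eq_bigr do under eq_bigr do rewrite sphere_DmxE.
suff key (D : 'I_3 -> V) : \sum_(i < 3) \sum_(j < 3)
    a 0 i * b 0 j * (D j 0 i - dotp (D j) x * x 0 i) =
    dotp a (b 0 0 *: D 0 + b 0 1 *: D 1 + b 0 2%:R *: D 2%:R).
  exact: (key (fun j => 'D_(delta_mx 0 j) ve x)).
move: ax; rewrite !sum3E !dotpE !mxE; move: (D 0) (D 1) (D 2%:R) => A B C ax.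
transitivity (a 0 0 * (b 0 0 * A 0 0 + b 0 1 * B 0 0 + b 0 2%:R * C 0 0) +
  a 0 1 * (b 0 0 * A 0 1 + b 0 1 * B 0 1 + b 0 2%:R * C 0 1) +
  a 0 2%:R * (b 0 0 * A 0 2%:R + b 0 1 * B 0 2%:R + b 0 2%:R * C 0 2%:R) -
  (a 0 0 * x 0 0 + a 0 1 * x 0 1 + a 0 2%:R * x 0 2%:R) *
  (b 0 0 * (A 0 0 * x 0 0 + A 0 1 * x 0 1 + A 0 2%:R * x 0 2%:R) +
   b 0 1 * (B 0 0 * x 0 0 + B 0 1 * x 0 1 + B 0 2%:R * x 0 2%:R) +
   b 0 2%:R * (C 0 0 * x 0 0 + C 0 1 * x 0 1 + C 0 2%:R * x 0 2%:R))); first by ring.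
by rewrite ax; ring.
Qed.

Lemma sphere_C1_dotp_field (a : V) : sphere_C1 (fun x => dotp a (v x)).
Proof.
rewrite (_ : (fun _ => _) = (fun x => a 0 0 * v x 0 0 + a 0 1 * v x 0 1 +
   a 0 2%:R * v x 0 2%:R)); last by apply/funext => x; rewrite dotpE.
have h i := sphere_C1M (sphere_C1_cst (a 0 i)) (sphere_C1_coord i).
exact: sphere_C1D (sphere_C1D (h 0) (h 1)) (h 2%:R).
Qed.

(** The scalar product with a constant vector commutes with the
    differentiation in the ambient space. *)
Lemma grad_dotp_field (a b x : V) : sphere x ->
  dotp b (sphere_grad (fun x => dotp a (v x)) x) = dotp a ('D_b ve x).
Proof.
move=> sx; have x0 := sphere_neq0 sx.
rewrite (sphere_gradE (sphere_C1_dotp_field a) _ sx).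
have dw i : derivable (fun y : V => a 0 i * ve y 0 i) x b.
  by apply: diff_derivable; have := sphere_C1M (sphere_C1_cst (a 0 i)) (sphere_C1_coord i) x0 => -[].
have e i : 'D_b (fun y : V => a 0 i * ve y 0 i) x = a 0 i * 'D_b ve x 0 i.
  rewrite -[X in X = _]/('D_b (a 0 i *: (fun y => ve y 0 i)) x) deriveZ.
    by rewrite -derive_field_coord.
  by apply: diff_derivable; have := @sphere_C1_coord i _ x0 => -[].
rewrite (_ : radial_ext _ = (fun y : V => a 0 0 * ve y 0 0) +
    (fun y : V => a 0 1 * ve y 0 1) + (fun y : V => a 0 2%:R * ve y 0 2%:R)); last first.
  by apply/funext => y; rewrite /radial_ext dotpE.
rewrite deriveD ?deriveD//; last exact: derivableD.
by rewrite !e dotpE.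
Qed.

End vector_field.

End sphere_calculus.

(** * Continuous functions on the sphere, and the balance on the circle *)

Section sphere_continuity.
Context {R : realType}.
Notation V := 'rV[R]_3.
Notation leb := (@lebesgue_measure R).

(** Only the values on the sphere matter, so that continuity is asked of some
    function that agrees with the given one on the sphere. *)
Definition sphere_continuous (G : V -> R) :=
  exists2 H, continuous_off0 H & forall x, sphere x -> G x = H x.

Implicit Types G H : V -> R.

Lemma sphere_continuous_off0 G : continuous_off0 G -> sphere_continuous G.
Proof. by move=> cG; exists G. Qed.

Lemma sphere_continuousM G H : sphere_continuous G -> sphere_continuous H ->
  sphere_continuous (fun x => G x * H x).
Proof.
move=> [G' cG GG] [H' cH HH]; exists (fun x => G' x * H' x).
  exact: continuous_off0M.
by move=> x sx; rewrite GG// HH.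
Qed.

Lemma sphere_continuousD G H : sphere_continuous G -> sphere_continuous H ->
  sphere_continuous (fun x => G x + H x).
Proof.
move=> [G' cG GG] [H' cH HH]; exists (fun x => G' x + H' x).
  exact: continuous_off0D.
by move=> x sx; rewrite GG// HH.
Qed.

Lemma sphere_continuous_cst (c : R) : sphere_continuous (fun=> c).
Proof. exact/sphere_continuous_off0/continuous_off0_cst. Qed.

Lemma sphere_continuousB G H : sphere_continuous G -> sphere_continuous H ->
  sphere_continuous (fun x => G x - H x).
Proof.
move=> cG cH; rewrite (_ : (fun _ => _) = (fun x => G x + -1 * H x)).
  by apply: sphere_continuousD => //; apply: sphere_continuousM => //; exact: sphere_continuous_cst.
by apply/funext => x; rewrite mulN1r.
Qed.

Lemma sphere_continuous_dotp (u v : V -> V) :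
  (forall i, sphere_continuous (fun x => u x 0 i)) ->
  (forall i, sphere_continuous (fun x => v x 0 i)) ->
  sphere_continuous (fun x => dotp (u x) (v x)).
Proof.
move=> cu cv; rewrite (_ : (fun _ => _) = (fun s => u s 0 0 * v s 0 0 +
    u s 0 1 * v s 0 1 + u s 0 2%:R * v s 0 2%:R)); last first.
  by apply/funext => s; rewrite dotpE.
by apply: sphere_continuousD; [apply: sphere_continuousD|]; apply: sphere_continuousM.
Qed.

Lemma sphere_continuous_C1 (psi : V -> R) : sphere_C1 psi -> sphere_continuous psi.
Proof.
move=> h; exists (radial_ext psi); first exact: C1_off0_continuous.
by move=> x sx; rewrite radial_ext_sphere.
Qed.

Lemma sphere_continuous_grad (psi : V -> R) i : sphere_C1 psi ->
  sphere_continuous (fun x => sphere_grad psi x 0 i).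
Proof.
move=> h; apply: sphere_continuous_off0 => x x0.
rewrite (_ : (fun _ => _) = (fun x => 'D_(delta_mx 0 i) (radial_ext psi) x)).
  by have [_] := h _ x0; exact.
by apply/funext => y; rewrite mxE.
Qed.

Lemma sphere_continuous_coord i : sphere_continuous (fun x : V => x 0 i).
Proof. by apply/sphere_continuous_off0/continuous_off0_all; exact: coord_continuous. Qed.

Lemma sphere_continuous_Dmx (v : V -> V) i j : sphere_C1_field v ->
  sphere_continuous (fun x => sphere_Dmx v x i j).
Proof.
move=> vC1; rewrite (_ : (fun _ => _) = (fun x =>
  'D_(delta_mx 0 j) (radial_ext v) x 0 i -
  dotp ('D_(delta_mx 0 j) (radial_ext v) x) x * x 0 i)); last first.
  by apply/funext => x; rewrite sphere_DmxE.
have h k : sphere_continuous (fun x => 'D_(delta_mx 0 j) (radial_ext v) x 0 k).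
  apply: sphere_continuous_off0 => x x0.
  apply: (@continuous_comp V V R (fun z => 'D_(delta_mx 0 j) (radial_ext v) z) (fun x : V => x 0 k)).
    by have [g _] := vC1; case: (g _ x0).
  exact: coord_continuous.
apply: sphere_continuousB => //; apply: sphere_continuousM; last exact: sphere_continuous_coord.
apply: sphere_continuous_dotp => // k; exact: sphere_continuous_coord.
Qed.

Variable th0 : R.
Hypothesis th0I : 0 < th0 < pi / 2.

Lemma sphere_continuous_C G : sphere_continuous G ->
  continuous (fun s => G (C_point th0 s)).
Proof.
move=> [H cH GH]; rewrite (_ : (fun _ => _) = (fun s => H (C_point th0 s))).
  move=> s; apply: (@continuous_comp R V R (C_point th0) H).
    exact: continuous_C_point.
  by apply: cH; apply: sphere_neq0; exact: sph_point_sphere.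
by apply/funext => s; rewrite GH//; exact: sph_point_sphere.
Qed.

Lemma sphere_continuous_measurable G : sphere_continuous G ->
  measurable_fun (clOmega th0) G.
Proof.
move=> [H cH GH]; apply: (eq_measurable_fun H).
  by move=> x; rewrite inE => /(clOmega_sphere th0I) sx; rewrite GH.
apply: measurable_funS (measurable_fun_sphere cH); first exact: measurable_sphere.
exact: clOmega_sphere.
Qed.

Lemma sphere_continuous_bounded G : sphere_continuous G ->
  exists M, forall x, clOmega th0 x -> `|G x| <= M.
Proof.
move=> [H cH GH]; have [M HM] := sphere_bounded cH.
by exists M => x /(clOmega_sphere th0I) sx; rewrite GH// HM.
Qed.

Lemma sphere_continuous_integrable G : sphere_continuous G ->
  hausdorff2.-integrable (Omega th0) (EFin \o G).
Proof.
move=> cG; have [M GM] := sphere_continuous_bounded cG.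
have OD : Omega th0 `<=` (clOmega th0 : set V) by exact: subset_closure.
apply: (bounded_integrable (M := M)).
- exact: measurable_Omega.
- exact: hausdorff_Omega_fin.
- apply: measurable_funS (sphere_continuous_measurable cG) => //.
  exact: measurable_clOmega.
- by move=> x Ox; apply: GM; exact: OD.
Qed.

Let L := C_length th0.

(** The form in which the divergence theorem meets the equations on the circle:
    the boundary term and the line density together are the derivative of a
    function of period $L$. *)
Lemma balance (a : V) (psi : V -> R) (K : V -> R) (c H : R -> R) :
  sphere_C1 psi ->
  (forall x, Omega th0 x -> K x = dotp a (sphere_grad psi x) - 2 * dotp a x * psi x) ->
  continuous c ->
  (forall s : R, is_derive s 1 H (psi (C_point th0 s) * dotp a (C_normal th0 s) + c s)) ->
  H L = H 0 ->
  \int[hausdorff2]_(x in Omega th0) K x + \int[leb]_(s in `[0, L]) c s = 0.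
Proof.
move=> psiC1 KE cc dH HL; have L0 := C_length_gt0 th0I.
have [mO iO IO] := divergence_cap th0I a psiC1.
have cb : continuous (fun s => psi (C_point th0 s) * dotp a (C_normal th0 s)).
  apply: contM; first by apply: sphere_continuous_C; exact: sphere_continuous_C1.
  rewrite (_ : (fun _ => _) = (fun s => dotp a (- e_th th0 (s / sin th0)))); last first.
    by apply/funext => s; rewrite C_normalE.
  have cd : continuous (fun s : R => s / sin th0).
    by apply: contM => s; [exact: cvg_id|exact: cst_continuous].
  have ce : continuous (fun t : R => dotp a (- e_th th0 t)).
    rewrite (_ : (fun _ => _) = (fun t : R => - dotp a (e_th th0 t))); last first.
      by apply/funext => t; rewrite !dotpE !mxE; ring.
    apply: contN.
    by move=> t; have [_ _ _] := tame_dotp (tame_vector_cst a) (@tame_e_th R); exact.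
  move=> s; apply: (@continuous_comp R R R (fun s => s / sin th0) (fun t => dotp a (- e_th th0 t)));
    [exact: cd|exact: ce].
have -> : \int[hausdorff2]_(x in Omega th0) K x =
    \int[leb]_(s in `[0, L]) (psi (C_point th0 s) * dotp a (C_normal th0 s)).
  rewrite /Rintegral -IO; congr fine; apply: eq_integral => x; rewrite inE => Ox.
  by rewrite KE.
rewrite -RintegralD//; last 2 first.
- exact: continuous_integrable (ltW L0) cb.
- exact: continuous_integrable (ltW L0) cc.
rewrite /Rintegral (continuous_FTC L0 dH); first by rewrite HL subrr.
exact: contD.
Qed.

End sphere_continuity.

(** * Pairings with the measures of the solution *)

Section pairings.
Context {R : realType}.
Notation V := 'rV[R]_3.
Notation leb := (@lebesgue_measure R).

Lemma Rintegral_sum d (T : measurableType d) (mu : {measure set T -> \bar R})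
    (D : set T) n (h : 'I_n -> T -> R) : measurable D ->
  (forall i, mu.-integrable D (EFin \o h i)) ->
  mu.-integrable D (EFin \o (fun x => \sum_(i < n) h i x)) /\
  \sum_(i < n) \int[mu]_(x in D) h i x = \int[mu]_(x in D) \sum_(i < n) h i x.
Proof.
move=> mD; elim: n h => [|n ih] h hi.
  rewrite big_ord0 (_ : (fun x => _) = (fun=> 0)); last first.
    by apply/funext => x; rewrite big_ord0.
  split; first exact: integrable0.
  by rewrite /Rintegral integral0.
have [i1 e1] := ih (fun i => h (widen_ord (leqnSn n) i)) (fun i => hi _).
rewrite (_ : (fun x => _) = (fun x => \sum_(i < n) h (widen_ord (leqnSn n) i) x + h ord_max x)); last first.
  by apply/funext => x; rewrite big_ord_recr.
split; first exact: (integrableD mD i1 (hi ord_max)).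
by rewrite big_ord_recr/= e1 RintegralD.
Qed.

Variables (th0 : R) (W : R -> R).
Hypothesis th0I : 0 < th0 < pi / 2.
Hypothesis cW : continuous W.
Hypothesis W0 : forall s, 0 <= W s.
Let varrho := cone_measure th0I cW W0.
Let L := C_length th0.
Let D : set V := clOmega th0.
Let O : set V := Omega th0.

Let mI : measurable (`[0, L]%classic : set (measurableTypeR R)).
Proof. exact: measurable_itv. Qed.

Let L0 : 0 <= L. Proof. exact: ltW (C_length_gt0 th0I). Qed.

Lemma RintegralB_O (F G : V -> R) (k : R) : sphere_continuous F -> sphere_continuous G ->
  \int[hausdorff2]_(x in O) (F x - k * G x) =
  \int[hausdorff2]_(x in O) F x - k * \int[hausdorff2]_(x in O) G x.
Proof.
move=> cF cG; have mO := measurable_Omega th0I.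
have ckG : sphere_continuous (fun x => k * G x).
  by apply: sphere_continuousM => //; exact: sphere_continuous_cst.
rewrite RintegralB//; last 2 first.
- exact: sphere_continuous_integrable.
- exact: sphere_continuous_integrable.
by rewrite RintegralZl//; exact: sphere_continuous_integrable.
Qed.

Lemma RintegralB_L (F G : R -> R) (k : R) : continuous F -> continuous G ->
  \int[leb]_(s in `[0, L]) (F s - k * G s) =
  \int[leb]_(s in `[0, L]) F s - k * \int[leb]_(s in `[0, L]) G s.
Proof.
move=> cF cG.
have ckG : continuous (fun x => k * G x).
  by apply: contM => // x; exact: cst_continuous.
rewrite RintegralB//; last 2 first.
- exact: continuous_integrable.
- exact: continuous_integrable.
by rewrite RintegralZl//; exact: continuous_integrable.
Qed.

(** The pairing with a measure of density $f$ with respect to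
    $\mathbb I_\Omega\,d\mathcal H^2+W\delta_C$. *)
Lemma cintegral_pairing (f fO : V -> R) (fC : R -> R) (M : R)
    (mf : measurable_fun setT f) (fM : forall x, `|f x| <= M) (G : V -> R) :
  (forall x, O x -> f x = fO x) -> (forall s, 0 <= s <= L -> f (C_point th0 s) = fC s) ->
  sphere_continuous G ->
  cintegral (density_charge varrho mf fM) D G =
  \int[hausdorff2]_(x in O) (fO x * G x) +
  \int[leb]_(s in `[0, L]) (fC s * G (C_point th0 s) * W s).
Proof.
move=> ffO ffC cG; have [N GN] := sphere_continuous_bounded th0I cG.
have mG := sphere_continuous_measurable th0I cG.
rewrite (cintegral_density_charge _ _ _ (measurable_clOmega th0) mG GN).
rewrite (@integral_cone_measure _ _ _ th0I cW W0 _ (M * N)); last 2 first.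
- by apply: measurable_funM => //; exact: measurable_funTS.
- by move=> x Dx; rewrite normrM ler_pM// GN.
congr (_ + _); apply: eq_Rintegral => x; rewrite inE.
  by move=> Ox; rewrite ffO.
by rewrite /= in_itv/= => xI; rewrite ffC.
Qed.

Lemma cintegral_vec_pairing (f : 'I_3 -> V -> R) (fO : V -> V) (fC : R -> V) (M : R)
    (mf : forall i, measurable_fun setT (f i)) (fM : forall i x, `|f i x| <= M)
    (G : V -> V) :
  (forall i x, O x -> f i x = fO x 0 i) ->
  (forall i s, 0 <= s <= L -> f i (C_point th0 s) = fC s 0 i) ->
  (forall i, sphere_continuous (fun x => fO x 0 i)) ->
  (forall i, continuous (fun s => fC s 0 i)) ->
  (forall i, sphere_continuous (fun x => G x 0 i)) ->
  cintegral_vec (fun i => density_charge varrho (mf i) (fM i)) D G =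
  \int[hausdorff2]_(x in O) dotp (fO x) (G x) +
  \int[leb]_(s in `[0, L]) (dotp (fC s) (G (C_point th0 s)) * W s).
Proof.
move=> ffO ffC cO cC cG; have mO := measurable_Omega th0I.
rewrite /cintegral_vec; under eq_bigr => i _.
  rewrite (cintegral_pairing (mf i) (fM i) (ffO i) (ffC i) (cG i)); over.
rewrite big_split /=; congr (_ + _).
  have hi i : hausdorff2.-integrable O (EFin \o (fun x => fO x 0 i * G x 0 i)).
    by apply: sphere_continuous_integrable => //; exact: sphere_continuousM.
  by have [_ ->] := Rintegral_sum mO hi.
have hi i : leb.-integrable `[0, L] (EFin \o (fun s => fC s 0 i * G (C_point th0 s) 0 i * W s)).
  apply: continuous_integrable => //; apply: contM => //; apply: contM => //.
  exact: (@sphere_continuous_C R th0 (fun x => G x 0 i) (cG i)).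
have [_ ->] := Rintegral_sum mI hi.
by apply: eq_Rintegral => s _; rewrite /dotp mulr_suml.
Qed.

(** The tensor-valued counterpart of [cintegral_vec_pairing], for the density
    $u\otimes u$. *)
Lemma cintegral_mx_pairing (f : 'I_3 -> 'I_3 -> V -> R) (fO : V -> V) (fC : R -> V) (M : R)
    (mf : forall i j, measurable_fun setT (f i j)) (fM : forall i j x, `|f i j x| <= M)
    (G : V -> 'M[R]_3) :
  (forall i j x, O x -> f i j x = fO x 0 i * fO x 0 j) ->
  (forall i j s, 0 <= s <= L -> f i j (C_point th0 s) = fC s 0 i * fC s 0 j) ->
  (forall i, sphere_continuous (fun x => fO x 0 i)) ->
  (forall i, continuous (fun s => fC s 0 i)) ->
  (forall i j, sphere_continuous (fun x => G x i j)) ->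
  cintegral_mx (fun i j => density_charge varrho (mf i j) (fM i j)) D G =
  \int[hausdorff2]_(x in O) (\sum_(i < 3) \sum_(j < 3) fO x 0 i * fO x 0 j * G x i j) +
  \int[leb]_(s in `[0, L])
     ((\sum_(i < 3) \sum_(j < 3) fC s 0 i * fC s 0 j * G (C_point th0 s) i j) * W s).
Proof.
move=> ffO ffC cO cC cG; have mO := measurable_Omega th0I.
have hi i j : hausdorff2.-integrable O (EFin \o (fun x => fO x 0 i * fO x 0 j * G x i j)).
  apply: sphere_continuous_integrable => //; apply: sphere_continuousM => //.
  exact: sphere_continuousM.
have hL i j : leb.-integrable `[0, L]
    (EFin \o (fun s => fC s 0 i * fC s 0 j * G (C_point th0 s) i j * W s)).
  apply: continuous_integrable => //; apply: contM => //; apply: contM => //.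
    exact: contM.
  exact: (@sphere_continuous_C R th0 (fun x => G x i j) (cG i j)).
rewrite /cintegral_mx; under eq_bigr => i _.
  under eq_bigr => j _.
    rewrite (cintegral_pairing (mf i j) (fM i j) (ffO i j) (ffC i j) (cG i j)); over.
  rewrite big_split /=.
  rewrite (proj2 (Rintegral_sum mO (hi i))) (proj2 (Rintegral_sum mI (hL i))).
  over.
rewrite big_split /=; congr (_ + _).
  exact: (proj2 (Rintegral_sum mO (fun i => proj1 (Rintegral_sum mO (hi i))))).
have e := proj2 (Rintegral_sum mI (fun i => proj1 (Rintegral_sum mI (hL i)))).
rewrite e; apply: eq_Rintegral => s _; rewrite mulr_suml.
by apply: eq_bigr => i _; rewrite mulr_suml.
Qed.

End pairings.

(** * The four balance laws *)

Section circle_calculus.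
Context {R : realType}.
Notation V := 'rV[R]_3.
Notation leb := (@lebesgue_measure R).
Variable th0 : R.
Hypothesis th0I : 0 < th0 < pi / 2.

Local Notation C := (C_point th0).
Local Notation t := (C_tangent th0).
Local Notation n := (C_normal th0).
Local Notation cot := (cos th0 / sin th0).

Let sn : sin th0 != 0. Proof. by rewrite gt_eqF// sin_th0_gt0. Qed.

Lemma dotpNr (a b : V) : dotp a (- b) = - dotp a b.
Proof. by rewrite !dotpE !mxE; ring. Qed.

Lemma dotpZl (k : R) (a b : V) : dotp (k *: a) b = k * dotp a b.
Proof. by rewrite !dotpE !mxE; ring. Qed.

Lemma dotpDl (a b c : V) : dotp (a + b) c = dotp a c + dotp b c.
Proof. by rewrite !dotpE !mxE; ring. Qed.

Lemma dotpZr (k : R) (a b : V) : dotp a (k *: b) = k * dotp a b.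
Proof. by rewrite !dotpE !mxE; ring. Qed.

(** The vectors $\mathbf n$, $\mathbf t$ and the position form an orthonormal
    frame along the circle. *)
Lemma circle_frame (a b : V) (s : R) : dotp a b =
  dotp a (n s) * dotp b (n s) + dotp a (t s) * dotp b (t s) + dotp a (C s) * dotp b (C s).
Proof. by rewrite (sph_frame a b th0 (s / sin th0)) C_normalE// C_tangentE// !dotpNr mulrNN. Qed.

Lemma dotp_normal_point (s : R) : dotp (n s) (C s) = 0.
Proof.
rewrite C_normalE// dotpC dotpNr.
rewrite (_ : dotp _ _ = sin th0 * cos th0 * (cos (s / sin th0) ^+ 2 + sin (s / sin th0) ^+ 2 - 1)).
  by rewrite cos2Dsin2 subrr mulr0 oppr0.
by rewrite dotpE !row3_coord; ring.
Qed.

Lemma dotp_tangent_tangent (s : R) : dotp (t s) (t s) = 1.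
Proof.
rewrite C_tangentE// dotpE !row3_coord -(cos2Dsin2 (s / sin th0)).
by ring.
Qed.

Let is_derive_angle (f df : R -> R) (s : R) : (forall x : R, is_derive x 1 f (df x)) ->
  is_derive s 1 (fun r => f (r / sin th0)) (df (s / sin th0) / sin th0).
Proof.
move=> hf; have h1 : is_derive s 1 (fun r => r / sin th0) (sin th0)^-1.
  apply: (@is_derive_eq _ _ _ (fun r : R => r * (sin th0)^-1)) => //.
  by rewrite !scaler0 add0r /GRing.scale /= mulr1.
exact: (@is_derive1_comp R f (fun r => r / sin th0) s _ _ (hf _) h1).
Qed.

(** The curvature vector of the circle: $-C$ is its component normal to the
    sphere, and its geodesic curvature is $\cot\theta_0$. *)
Lemma is_derive_C_tangent (s : R) :
  is_derive s 1 (t : R -> V) (- C s + cot *: n s).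
Proof.
have -> : (t : R -> V) = (fun r => row3 0 (- sin (r / sin th0)) (cos (r / sin th0))).
  by apply/funext => r; rewrite C_tangentE.
have d1 (x : R) : is_derive x 1 (fun y => - sin y) (- cos x) by exact: is_derive_eq.
have e : - C s + cot *: n s = row3 0 (- cos (s / sin th0) / sin th0) (- sin (s / sin th0) / sin th0).
  have q := cos2Dsin2 th0.
  have cs : (cos th0) ^+ 2 = 1 - sin th0 ^+ 2 by lra.
  rewrite C_normalE//; apply: row3P; rewrite !mxE /=.
  - by field.
  - transitivity (- ((sin th0 ^+ 2 + cos th0 ^+ 2) * cos (s / sin th0)) / sin th0); first by field.
    by rewrite cs; field.
  - transitivity (- ((sin th0 ^+ 2 + cos th0 ^+ 2) * sin (s / sin th0)) / sin th0); first by field.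
    by rewrite cs; field.
rewrite e; apply: (@is_derive_row3 R (fun=> 0) _ _ s 0 _ _ (@is_derive_cst R R R 0 s 1)).
- exact: (is_derive_angle s d1).
- exact: (is_derive_angle s (fun x => is_derive_cos x)).
Qed.

(** The derivative of $\mathbf n$ along the circle is $-\cot\theta_0\,\mathbf
    t$, which is already tangent to the sphere. *)
Lemma dotp_tangent_Dt_normal (s : R) : dotp (t s) (C_Dt_normal th0 s) = - cot.
Proof.
have dn : is_derive s 1 (n : R -> V) (- cot *: t s).
  have -> : (n : R -> V) = (fun r => row3 (sin th0) (- cos th0 * cos (r / sin th0))
      (- cos th0 * sin (r / sin th0))).
    by apply/funext => r; rewrite C_normalE//; apply: row3P; rewrite !mxE /=; ring.
  have d1 (x : R) : is_derive x 1 (fun y => - cos th0 * cos y) (- cos th0 * - sin x).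
    exact: (@is_deriveZ R R R cos (- cos th0) x 1 _ (is_derive_cos x)).
  have d2 (x : R) : is_derive x 1 (fun y => - cos th0 * sin y) (- cos th0 * cos x).
    exact: (@is_deriveZ R R R sin (- cos th0) x 1 _ (is_derive_sin x)).
  have -> : - cot *: t s = row3 0 (- cos th0 * - sin (s / sin th0) / sin th0)
      (- cos th0 * cos (s / sin th0) / sin th0).
    by rewrite C_tangentE//; apply: row3P; rewrite !mxE /=; field.
  apply: (@is_derive_row3 R (fun=> sin th0) _ _ s 0 _ _ (@is_derive_cst R R R (sin th0) s 1)).
  - exact: (is_derive_angle s d1).
  - exact: (is_derive_angle s d2).
rewrite /C_Dt_normal derive1E (derive_val (is_derive := dn)) /tproj.
transitivity (- cot * (dotp (t s) (t s) - dotp (t s) (C s) * dotp (t s) (C s))).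
  by rewrite !dotpE !mxE; ring.
by rewrite dotp_tangent_tangent dotp_tangent// mulr0 subr0 mulr1.
Qed.

Lemma continuous_C_tangent i : continuous (fun s => t s 0 i).
Proof.
rewrite (_ : (fun _ => _) = (fun s => e_ph (s / sin th0) 0 i)); last first.
  by apply/funext => s; rewrite C_tangentE.
move=> s; apply: (@continuous_comp R R R (fun s => s / sin th0) (fun t => e_ph t 0 i)).
  by apply: continuousM; [exact: cvg_id|exact: cst_continuous].
by have [_ _ _ ] := @tame_e_ph R i => /(_ 0); exact.
Qed.

Lemma continuous_C_normal i : continuous (fun s => n s 0 i).
Proof.
rewrite (_ : (fun _ => _) = (fun s => - e_th th0 (s / sin th0) 0 i)); last first.
  by apply/funext => s; rewrite C_normalE// mxE.
apply: contN => s; apply: (@continuous_comp R R R (fun s => s / sin th0) (fun t => e_th th0 t 0 i)).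
  by apply: continuousM; [exact: cvg_id|exact: cst_continuous].
by have [_ _ _ ] := @tame_e_th R i => /(_ th0); exact.
Qed.

Lemma is_derive_circle (psi : V -> R) (s : R) : sphere_C1 psi ->
  is_derive s 1 (fun r => psi (C r)) (dotp (t s) (sphere_grad psi (C s))).
Proof.
move=> psiC1; apply: (is_derive_sphere_curve psiC1 (fun r => sph_point_sphere _ _)).
exact: is_derive_C_point.
Qed.

Section field.
Variable v : V -> V.
Hypothesis vC1 : sphere_C1_field v.

Lemma is_derive_field_circle (s : R) :
  is_derive s 1 (fun r => v (C r)) ('D_(t s) (radial_ext v) (C s)).
Proof.
have sC := sph_point_sphere th0 (s / sin th0).
have d i : is_derive s 1 (fun r => v (C r) 0 i) ('D_(t s) (radial_ext v) (C s) 0 i).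
  rewrite -(grad_field_coord vC1 (t s) i sC).
  exact: is_derive_circle (sphere_C1_coord vC1 i).
have -> : (fun r => v (C r)) = (fun r => row3 (v (C r) 0 0) (v (C r) 0 1) (v (C r) 0 2%:R)).
  by apply/funext => r; apply: row3P; rewrite row3_coord.
have -> : 'D_(t s) (radial_ext v) (C s) = row3 ('D_(t s) (radial_ext v) (C s) 0 0)
  ('D_(t s) (radial_ext v) (C s) 0 1) ('D_(t s) (radial_ext v) (C s) 0 2%:R).
  by apply: row3P; rewrite row3_coord.
exact: is_derive_row3.
Qed.

Lemma derive_field_lin (x a b : V) (k : R) : x != 0 ->
  'D_(k *: a + b) (radial_ext v) x = k *: 'D_a (radial_ext v) x + 'D_b (radial_ext v) x.
Proof.
move=> x0; have dv : differentiable (radial_ext v) x by have [h _] := vC1; case: (h _ x0).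
by rewrite !deriveE// linearP.
Qed.

End field.

End circle_calculus.

Section balance_laws.
Context {R : realType}.
Notation V := 'rV[R]_3.
Notation leb := (@lebesgue_measure R).
Variables (th0 alpha0 : R) (W ut w : R -> R).
Hypothesis th0I : 0 < th0 < pi / 2.
Hypotheses (cW : continuous W) (cut : continuous ut) (cw : continuous w).

Local Notation C := (C_point th0).
Local Notation t := (C_tangent th0).
Local Notation n := (C_normal th0).
Local Notation cot := (cos th0 / sin th0).
Local Notation V0 := (V0 alpha0).
Local Notation u0 := (u0 alpha0).
Local Notation w0 := (w0 alpha0).
Let L := C_length th0.

Hypotheses (pW : periodic W L) (put : periodic ut L) (pw : periodic w L).
Hypothesis dmass : forall s : R, is_derive s 1 (fun r => W r * ut r)
  (dotp (u0 (C s)) (n s) - 2 * W s * w s).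
Hypothesis dradial : forall s : R, is_derive s 1 (fun r => W r * ut r * w r)
  (w0 (C s) * dotp (u0 (C s)) (n s) + W s * ut s ^+ 2 - 2 * W s * w s ^+ 2).
Hypothesis dmomentum : forall s : R, is_derive s 1 (fun r => W r * ut r ^+ 2)
  (dotp (u0 (C s)) (n s) * dotp (u0 (C s)) (t s) - 3 * W s * ut s * w s).

Let cc (c : R) : continuous (fun _ : R => c). Proof. by move=> s; exact: cst_continuous. Qed.

Let pC : C L = C 0. Proof. exact: C_point_length. Qed.
Let pW0 : W L = W 0. Proof. by have := pW 0; rewrite add0r. Qed.
Let put0 : ut L = ut 0. Proof. by have := put 0; rewrite add0r. Qed.
Let pw0 : w L = w 0. Proof. by have := pw 0; rewrite add0r. Qed.
Let pt0 : t L = t 0. Proof. by have := C_tangent_periodic th0I 0; rewrite add0r. Qed.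

Lemma dotp_u0_tangent (x g : V) : dotp x g = 0 -> dotp (u0 x) g = dotp V0 g.
Proof.
move=> xg; transitivity (dotp V0 g - w0 x * dotp x g); last by rewrite xg mulr0 subr0.
by rewrite /Defs.u0 !dotpE !mxE; ring.
Qed.

Lemma dotp_V0_normal (s : R) : dotp V0 (n s) = dotp (u0 (C s)) (n s).
Proof. by rewrite dotp_u0_tangent// dotpC dotp_normal_point. Qed.

Lemma dotp_V0_tangent (s : R) : dotp V0 (t s) = dotp (u0 (C s)) (t s).
Proof. by rewrite dotp_u0_tangent// dotpC dotp_tangent. Qed.

Lemma sphere_continuous_u0 i : sphere_continuous (fun x => u0 x 0 i).
Proof. by apply/sphere_continuous_off0/continuous_off0_all; exact: continuous_u0. Qed.

Lemma sphere_continuous_w0 : sphere_continuous w0.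
Proof. by apply/sphere_continuous_off0/continuous_off0_all; exact: continuous_w0. Qed.

Let cu := sphere_continuous_u0.
Let cw0 := sphere_continuous_w0.
Let ct := continuous_C_tangent th0I.
Let cn i : continuous (fun s => n s 0 i). Proof. exact: continuous_C_normal. Qed.

(** [balance] with the test function $\psi$ itself and the periodic function
    $w_\rho u^t\psi$. *)
Lemma mass_balance (psi : V -> R) : sphere_C1 psi ->
  \int[hausdorff2]_(x in Omega th0) dotp (u0 x) (sphere_grad psi x) +
  \int[leb]_(s in `[0, L]) (dotp (ut s *: t s) (sphere_grad psi (C s)) * W s) =
  2 * (\int[hausdorff2]_(x in Omega th0) (w0 x * psi x) +
       \int[leb]_(s in `[0, L]) (w s * psi (C s) * W s)).
Proof.
move=> psiC1.
have cg i := sphere_continuous_grad i psiC1; have cp := sphere_continuous_C1 psiC1.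
have c1 : sphere_continuous (fun x => dotp (u0 x) (sphere_grad psi x)).
  exact: sphere_continuous_dotp.
have c2 : sphere_continuous (fun x => w0 x * psi x) by exact: sphere_continuousM.
have c3 : continuous (fun s => dotp (ut s *: t s) (sphere_grad psi (C s)) * W s).
  apply: contM => //; apply: continuous_dotp2 => i; last exact: (@sphere_continuous_C R th0 (fun x => sphere_grad psi x 0 i) (cg i)).
  rewrite (_ : (fun _ => _) = (fun s => ut s * t s 0 i)); first exact: contM.
  by apply/funext => s; rewrite mxE.
have c4 : continuous (fun s => w s * psi (C s) * W s).
  by apply: contM => //; apply: contM => //; exact: sphere_continuous_C.
have := @balance R th0 th0I V0 psi (fun x => dotp (u0 x) (sphere_grad psi x) - 2 * (w0 x * psi x))
  (fun s => dotp (ut s *: t s) (sphere_grad psi (C s)) * W s - 2 * (w s * psi (C s) * W s))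
  (fun s => W s * ut s * psi (C s)) psiC1.
rewrite (RintegralB_O th0I _ c1 c2) (RintegralB_L th0I _ c3 c4) => h.
suff : \int[hausdorff2]_(x in Omega th0) dotp (u0 x) (sphere_grad psi x) -
  2 * \int[hausdorff2]_(x in Omega th0) (w0 x * psi x) +
  (\int[leb]_(s in `[0, L]) (dotp (ut s *: t s) (sphere_grad psi (C s)) * W s) -
   2 * \int[leb]_(s in `[0, L]) (w s * psi (C s) * W s)) = 0.
  by move=> e; apply: subr0_eq; apply: etrans e; rewrite /L; ring.
apply: h.
- move=> x Ox; rewrite dotp_u0_tangent; first by rewrite /Defs.w0; ring.
  by rewrite sphere_grad_tangent//; exact: Omega_sphere Ox.
- by apply: contB => //; exact: contM.
- move=> s; apply: is_derive_eq (is_deriveM (dmass s) (is_derive_circle th0I s psiC1)) _.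
  by rewrite dotp_V0_normal dotpZl /GRing.scale/=; ring.
- by rewrite pC pW0 put0.
Qed.

(** [balance] with the test function $w_0\psi$ and the periodic function
    $w_\rho u^tw\,\psi$; the term $|u_0|^2$ is $(V_0,\nabla w_0)$. *)
Lemma radial_balance (psi : V -> R) : sphere_C1 psi ->
  \int[hausdorff2]_(x in Omega th0) dotp (w0 x *: u0 x) (sphere_grad psi x) +
  \int[leb]_(s in `[0, L]) (dotp ((w s * ut s) *: t s) (sphere_grad psi (C s)) * W s) =
  2 * (\int[hausdorff2]_(x in Omega th0) (w0 x * w0 x * psi x) +
       \int[leb]_(s in `[0, L]) (w s * w s * psi (C s) * W s)) -
  (\int[hausdorff2]_(x in Omega th0) (dotp (u0 x) (u0 x) * psi x) +
   \int[leb]_(s in `[0, L]) (ut s ^+ 2 * psi (C s) * W s)).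
Proof.
move=> psiC1.
have cg i := sphere_continuous_grad i psiC1; have cp := sphere_continuous_C1 psiC1.
have w0C1 : sphere_C1 w0 by exact: (sphere_C1_dotp_const V0).
have c1 : sphere_continuous (fun x => dotp (w0 x *: u0 x) (sphere_grad psi x)).
  apply: sphere_continuous_dotp => // i.
  rewrite (_ : (fun _ => _) = (fun x => w0 x * u0 x 0 i)); first exact: sphere_continuousM.
  by apply/funext => s; rewrite mxE.
have c2 : sphere_continuous (fun x => w0 x * w0 x * psi x).
  by apply: sphere_continuousM => //; exact: sphere_continuousM.
have c2' : sphere_continuous (fun x => dotp (u0 x) (u0 x) * psi x).
  by apply: sphere_continuousM => //; exact: sphere_continuous_dotp.
have c12 : sphere_continuous (fun x => dotp (w0 x *: u0 x) (sphere_grad psi x) - 2 * (w0 x * w0 x * psi x)).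
  by apply: sphere_continuousB => //; apply: sphere_continuousM => //; exact: sphere_continuous_cst.
have c3 : continuous (fun s => dotp ((w s * ut s) *: t s) (sphere_grad psi (C s)) * W s).
  apply: contM => //; apply: continuous_dotp2 => i; last exact: (@sphere_continuous_C R th0 (fun x => sphere_grad psi x 0 i) (cg i)).
  rewrite (_ : (fun _ => _) = (fun s => w s * ut s * t s 0 i)).
    by apply: contM => //; exact: contM.
  by apply/funext => s; rewrite mxE.
have c4 : continuous (fun s => w s * w s * psi (C s) * W s).
  by apply: contM => //; apply: contM; [exact: contM|exact: sphere_continuous_C].
have c4' : continuous (fun s => ut s ^+ 2 * psi (C s) * W s).
  by apply: contM => //; apply: contM; [exact: contM|exact: sphere_continuous_C].
have c34 : continuous (fun s => dotp ((w s * ut s) *: t s) (sphere_grad psi (C s)) * W s -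
    2 * (w s * w s * psi (C s) * W s)) by apply: contB => //; exact: contM.
have := @balance R th0 th0I V0 (fun x => w0 x * psi x)
  (fun x => (dotp (w0 x *: u0 x) (sphere_grad psi x) - 2 * (w0 x * w0 x * psi x)) -
     -1 * (dotp (u0 x) (u0 x) * psi x))
  (fun s => (dotp ((w s * ut s) *: t s) (sphere_grad psi (C s)) * W s -
    2 * (w s * w s * psi (C s) * W s)) - -1 * (ut s ^+ 2 * psi (C s) * W s))
  (fun s => W s * ut s * w s * psi (C s)) (sphere_C1M w0C1 psiC1).
rewrite (RintegralB_O th0I _ c12 c2') (RintegralB_O th0I _ c1 c2).
rewrite (RintegralB_L th0I _ c34 c4') (RintegralB_L th0I _ c3 c4) => h.
match type of h with _ -> _ -> _ -> _ -> ?E => suff : E end.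
  by move=> e; apply: subr0_eq; apply: etrans e; rewrite /L; ring.
apply: h.
- move=> x Ox; have sx := Omega_sphere Ox; have gx := sphere_grad_tangent psiC1 sx.
  rewrite (gradM V0 w0C1 psiC1 sx) (grad_dotp_const V0 V0 sx).
  rewrite dotpZl (dotp_u0_tangent gx).
  rewrite [dotp (u0 x) (u0 x)](_ : _ = dotp V0 V0 - w0 x * w0 x); last first.
    transitivity (dotp V0 V0 - 2 * w0 x * dotp V0 x + w0 x ^+ 2 * dotp x x).
      by rewrite /Defs.u0 !dotpE !mxE; ring.
    by move: sx; rewrite sphereE => ->; rewrite /Defs.w0; ring.
  by rewrite /Defs.w0; ring.
- by apply: contB => //; exact: contM.
- move=> s; apply: is_derive_eq (is_deriveM (dradial s) (is_derive_circle th0I s psiC1)) _.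
  by rewrite dotp_V0_normal dotpZl /GRing.scale/=; ring.
- by rewrite pC pW0 put0 pw0.
Qed.

(** The sum of [divergence_cap] over the three basis vectors, applied to the
    components of $v$; the terms in $(x,v)$ vanish since $v$ is tangent. *)
Lemma integral_divergence (v : V -> V) : sphere_C1_field v ->
  \int[hausdorff2]_(x in Omega th0) sphere_div v x =
  \int[leb]_(s in `[0, L]) dotp (n s) (v (C s)).
Proof.
move=> vC1; have mO := measurable_Omega th0I.
have mI : measurable (`[0, L]%classic : set (measurableTypeR R)) by exact: measurable_itv.
pose h i x := dotp (delta_mx 0 i) (sphere_grad (fun y => v y 0 i) x) -
  2 * dotp (delta_mx 0 i) x * v x 0 i.
pose b i s := v (C s) 0 i * dotp (delta_mx 0 i) (n s).
have F i := divergence_cap th0I (delta_mx 0 i) (sphere_C1_coord vC1 i).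
have hi i : hausdorff2.-integrable (Omega th0) (EFin \o h i) by have [_ ? _] := F i.
have de (i : 'I_3) (y : V) : dotp (delta_mx 0 i) y = y 0 i.
  by move: i; elim/ord3P; rewrite dotpE !mxE /= ?mul1r ?mul0r ?add0r ?addr0.
have bi i : leb.-integrable `[0, L] (EFin \o b i).
  apply: continuous_integrable; first exact: ltW (C_length_gt0 th0I).
  apply: contM; first exact: (@sphere_continuous_C R th0 (fun x => v x 0 i) (sphere_continuous_C1 (sphere_C1_coord vC1 i))).
  by rewrite (_ : (fun _ => _) = (fun s => n s 0 i))//; apply/funext => s; rewrite de.
have hb i : \int[hausdorff2]_(x in Omega th0) h i x = \int[leb]_(s in `[0, L]) b i s.
  by have [_ _ e] := F i; rewrite /Rintegral -e.
transitivity (\int[hausdorff2]_(x in Omega th0) \sum_(i < 3) h i x).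
  apply: eq_Rintegral => x; rewrite inE => Ox; have sx := Omega_sphere Ox.
  rewrite (sphere_divE vC1 sx) /h big_split /= sumrN.
  rewrite [X in _ - X](_ : _ = 2 * dotp (v x) x); last first.
    by rewrite sum3E !de dotpE; ring.
  by have [_ ->] := vC1; rewrite ?mulr0 ?subr0.
rewrite -(proj2 (Rintegral_sum mO hi)); under eq_bigr do rewrite hb.
rewrite (proj2 (Rintegral_sum mI bi)); apply: eq_Rintegral => s _.
by rewrite /b sum3E !de dotpE; ring.
Qed.

Variable p0 : R.
Let q s := W s * ut s ^+ 2 * dotp (t s) (C_Dt_normal th0 s) + dotp (u0 (C s)) (n s) ^+ 2.

Lemma continuous_pressure : continuous (fun s => q s + p0).
Proof.
rewrite (_ : (fun _ => _) = (fun s => W s * (ut s * ut s) * (- cot) + dotp V0 (n s) * dotp V0 (n s) + p0)).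
  have cv : continuous (fun s => dotp V0 (n s)).
    by apply: continuous_dotp2 => // i; exact: cst_continuous.
  apply: contD => //; apply: contD; last exact: contM.
  by apply: contM => //; apply: contM => //; exact: contM.
by apply/funext => s; rewrite /q dotp_tangent_Dt_normal// dotp_V0_normal !expr2.
Qed.

(** [balance] with the test function $(V_0,v)$ and the periodic function
    $w_\rho(u^t)^2(\mathbf t,v)$.  Differentiating $\mathbf t$ along the
    circle produces the curvature term of $W_C$, and $\cot\theta_0$ cancels
    it. *)
Lemma momentum_balance (v : V -> V) : sphere_C1_field v ->
  \int[hausdorff2]_(x in Omega th0)
     (\sum_(i < 3) \sum_(j < 3) u0 x 0 i * u0 x 0 j * sphere_Dmx v x i j) +
  \int[leb]_(s in `[0, L]) ((\sum_(i < 3) \sum_(j < 3)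
     (ut s *: t s) 0 i * (ut s *: t s) 0 j * sphere_Dmx v (C s) i j) * W s) +
  p0 * \int[hausdorff2]_(x in Omega th0) sphere_div v x =
  3 * (\int[hausdorff2]_(x in Omega th0) dotp (w0 x *: u0 x) (v x) +
       \int[leb]_(s in `[0, L]) (dotp ((w s * ut s) *: t s) (v (C s)) * W s)) +
  \int[leb]_(s in `[0, L]) ((q s + p0) * dotp (n s) (v (C s))).
Proof.
move=> vC1; rewrite integral_divergence//.
have cv i := sphere_continuous_C1 (sphere_C1_coord vC1 i).
have cD i j := sphere_continuous_Dmx i j vC1.
pose S (f : V) x := \sum_(i < 3) \sum_(j < 3) f 0 i * f 0 j * sphere_Dmx v x i j.
have cut' i : continuous (fun s => (ut s *: t s) 0 i).
  rewrite (_ : (fun _ => _) = (fun s => ut s * t s 0 i)); first exact: contM.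
  by apply/funext => s; rewrite mxE.
have c1 : sphere_continuous (fun x => S (u0 x) x).
  rewrite (_ : (fun _ => _) = (fun x => dotp (u0 x) (\row_i \sum_(j < 3) u0 x 0 j * sphere_Dmx v x i j))).
    apply: sphere_continuous_dotp => // i.
    rewrite (_ : (fun _ => _) = (fun x => dotp (u0 x) (\row_j sphere_Dmx v x i j))).
      apply: sphere_continuous_dotp => // j.
      by rewrite (_ : (fun _ => _) = (fun x => sphere_Dmx v x i j))//; apply/funext => x; rewrite mxE.
    by apply/funext => x; rewrite mxE /dotp; apply: eq_bigr => j _; rewrite mxE.
  apply/funext => x; rewrite /S /dotp; apply: eq_bigr => i _.
  by rewrite [(\row_i _) 0 i]mxE mulr_sumr; apply: eq_bigr => j _; rewrite mulrA.
have c2 : sphere_continuous (fun x => dotp (w0 x *: u0 x) (v x)).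
  apply: sphere_continuous_dotp => // i.
  rewrite (_ : (fun _ => _) = (fun x => w0 x * u0 x 0 i)); first exact: sphere_continuousM.
  by apply/funext => s; rewrite mxE.
have c3 : continuous (fun s => S (ut s *: t s) (C s) * W s).
  apply: contM => //.
  rewrite (_ : (fun _ => _) = (fun s => dotp (ut s *: t s)
    (\row_i \sum_(j < 3) (ut s *: t s) 0 j * sphere_Dmx v (C s) i j))).
    apply: continuous_dotp2 => // i.
    rewrite (_ : (fun _ => _) = (fun s => dotp (ut s *: t s) (\row_j sphere_Dmx v (C s) i j))).
      apply: continuous_dotp2 => // j.
      rewrite (_ : (fun _ => _) = (fun s => sphere_Dmx v (C s) i j)); last first.
        by apply/funext => x; rewrite mxE.
      exact: (@sphere_continuous_C R th0 (fun x => sphere_Dmx v x i j) (cD i j)).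
    by apply/funext => x; rewrite mxE /dotp; apply: eq_bigr => j _; rewrite [(\row_j _) 0 j]mxE.
  apply/funext => s; rewrite /S /dotp; apply: eq_bigr => i _.
  by rewrite [(\row_i _) 0 i]mxE mulr_sumr; apply: eq_bigr => j _; rewrite mulrA.
have cvC i : continuous (fun s => v (C s) 0 i).
  exact: (@sphere_continuous_C R th0 (fun x => v x 0 i) (cv i)).
have c4 : continuous (fun s => dotp ((w s * ut s) *: t s) (v (C s)) * W s).
  apply: contM => //; apply: continuous_dotp2 => // i.
  rewrite (_ : (fun _ => _) = (fun s => w s * ut s * t s 0 i)).
    by apply: contM => //; exact: contM.
  by apply/funext => s; rewrite mxE.
have cnv : continuous (fun s => dotp (n s) (v (C s))) by exact: continuous_dotp2.
have cqp : continuous (fun s => (q s + p0) * dotp (n s) (v (C s))).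
  by apply: contM => //; exact: continuous_pressure.
have cq : continuous (fun s => (q s + p0) * dotp (n s) (v (C s)) - p0 * dotp (n s) (v (C s))).
  by apply: contB => //; exact: contM.
have c34 : continuous (fun s => S (ut s *: t s) (C s) * W s -
    3 * (dotp ((w s * ut s) *: t s) (v (C s)) * W s)) by apply: contB => //; exact: contM.
have := @balance R th0 th0I V0 (fun x => dotp V0 (v x))
  (fun x => S (u0 x) x - 3 * dotp (w0 x *: u0 x) (v x))
  (fun s => (S (ut s *: t s) (C s) * W s - 3 * (dotp ((w s * ut s) *: t s) (v (C s)) * W s)) -
     1 * ((q s + p0) * dotp (n s) (v (C s)) - p0 * dotp (n s) (v (C s))))
  (fun s => W s * ut s ^+ 2 * dotp (t s) (v (C s))) (sphere_C1_dotp_field vC1 V0).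
rewrite (RintegralB_O th0I _ c1 c2) (RintegralB_L th0I _ c34 cq) (RintegralB_L th0I _ c3 c4).
rewrite (RintegralB_L th0I _ cqp cnv) => h.
match type of h with _ -> _ -> _ -> _ -> ?E => suff : E end.
  by move=> e; apply: subr0_eq; apply: etrans e; rewrite /S /L; ring.
apply: h.
- move=> x Ox; have sx := Omega_sphere Ox; have x0 := sphere_neq0 sx.
  have ux : dotp (u0 x) x = 0 by exact: dotp_u0.
  have vx : dotp x (v x) = 0 by have [_ /(_ _ sx)] := vC1; rewrite dotpC.
  rewrite /S (sphere_Dmx_tangent vC1 (u0 x) sx ux) (grad_dotp_field vC1 V0 V0 sx).
  have V0E : V0 = w0 x *: x + u0 x by rewrite /Defs.u0 addrC subrK.
  rewrite [in 'D_V0 _ _]V0E (derive_field_lin vC1 _ _ _ x0) derive_field_radial scaler0 add0r.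
  rewrite -(dotp_u0_tangent vx) dotpZl.
  have -> : dotp V0 ('D_(u0 x) (radial_ext v) x) =
      w0 x * dotp x ('D_(u0 x) (radial_ext v) x) + dotp (u0 x) ('D_(u0 x) (radial_ext v) x).
    by rewrite {1}V0E dotpDl dotpZl.
  by rewrite (derive_field_normal vC1 (u0 x) sx) /Defs.w0; ring.
- by apply: contB => //; exact: contM.
- move=> s; have sC := sph_point_sphere th0 (s / sin th0); have x0 := sphere_neq0 sC.
  have vx : dotp (v (C s)) (C s) = 0 by have [_ /(_ _ sC)] := vC1.
  have dtv := is_derive_dotp (is_derive_C_tangent th0I s) (is_derive_field_circle th0I vC1 s).
  apply: is_derive_eq (is_deriveM (dmomentum s) dtv) _.
  have tx : dotp (ut s *: t s) (C s) = 0 by rewrite dotpZl dotp_tangent// mulr0.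
  rewrite /S (sphere_Dmx_tangent vC1 (ut s *: t s) sC tx).
  have -> : 'D_(ut s *: t s) (radial_ext v) (C s) = ut s *: 'D_(t s) (radial_ext v) (C s).
    by have := derive_field_lin vC1 (t s) 0 (ut s) x0; rewrite addr0 derive0 addr0.
  rewrite (circle_frame th0I V0 (v (C s)) s) vx mulr0 addr0 dotp_V0_normal dotp_V0_tangent.
  rewrite dotpZl dotpZl dotpZr dotpDl dotpZl -[- C s]scaleN1r dotpZl [dotp (C s) (v (C s))]dotpC vx.
  rewrite /q dotp_tangent_Dt_normal// [dotp (v (C s)) (n s)]dotpC [dotp (v (C s)) (t s)]dotpC.
  by rewrite /GRing.scale/=; ring.
- by rewrite pC pW0 put0 pt0.
Qed.

End balance_laws.

(** * The state in the domain *)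

Section upstream_state.
Context {R : realType}.
Notation V := 'rV[R]_3.
Notation leb := (@lebesgue_measure R).

Let pi0 := @pi_gt0 R.

Lemma half_ballE (x e : V) (r : R) : 0 < r ->
  half_ball x e r = cap x r `&` [set y | 0 < dotp (y - x) e].
Proof. by []. Qed.

Lemma measurable_half_ball (x e : V) (r : R) : 0 < r -> measurable (half_ball x e r).
Proof.
move=> r0; rewrite half_ballE//; apply: measurableI; first exact: measurable_cap.
have mf : measurable_fun setT (fun y : V => dotp (y - x) e).
  rewrite (_ : (fun _ => _) = (fun y : V => dotp y e - dotp x e)); last first.
    by apply/funext => y; rewrite !dotpE !mxE; ring.
  apply: measurable_funB; last exact: measurable_cst.
  by apply: measurable_fun_contV; exact: continuous_dotp.
rewrite (_ : mkset _ = (fun y : V => dotp (y - x) e) @^-1` `]0, +oo[%classic); last first.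
  by apply/seteqP; split => y /=; rewrite in_itv/= andbT.
by rewrite -[X in measurable X]setTI; apply: mf.
Qed.

(** After a rotation to the axes, the half cap is a rectangle on the cylinder,
    of height $r^2/2$ and of half a turn. *)
Lemma half_cap_area (x e : V) (r : R) : dotp x x = 1 -> dotp e e = 1 ->
  dotp x e = 0 -> 0 < r <= 1 -> sphere_area (half_ball x e r) = (pi * (r ^+ 2 / 2))%:E.
Proof.
move=> xx ee xe /andP[r0 r1].
have [M [[oM aM] xM eM]] := orthonormal_to_axes xx ee xe.
have -> : half_ball x e r = (fun y => y *m M) @^-1` half_ball (x *m M) (e *m M) r.
  by apply/seteqP; split => y; rewrite /half_ball /= -mulmxBl enorm_orthogonal// dotp_orthogonal.
rewrite aM; last exact: measurable_half_ball.
rewrite xM eM sphere_areaE2; last exact: measurable_half_ball.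
have r2 : 0 < r ^+ 2 <= 1 by apply/andP; split; nra.
transitivity (\int[leb]_(t in `[0%R, (2 * pi)%R[)
    (((fun=> (r ^+ 2 / 2)%:E) \_ (`]0%R, pi[%classic : set R)) t))%E.
  apply: eq_integral => t; rewrite inE/= in_itv/= => /andP[t0 t2].
  have E (h : R) : -1 <= h <= 1 ->
      dotp (cyl (h, t) - row3 1 0 0) (cyl (h, t) - row3 1 0 0) = 2 - 2 * h.
    by move=> hI; have := cyl_sphere t hI; rewrite sphereE !dotpE !mxE /=; lra.
  have E2 (h : R) : dotp (cyl (h, t) - row3 1 0 0) (row3 0 0 1) = lat h * sin t.
    by rewrite !dotpE !mxE /=; ring.
  have l0 (h : R) : 0 <= lat h by exact: sqrtr_ge0.
  rewrite patchE; case: ifPn => [|/negP] tI; last first.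
    have st : sin t <= 0.
      have [t1|t1] := ltP t pi.
        have -> : t = 0.
          by apply/eqP; rewrite eq_le t0 andbT leNgt; apply/negP => h; apply: tI; rewrite inE/= in_itv/= h.
        by rewrite sin0.
      rewrite -[t](subrK pi) sinDpi oppr_le0.
      by apply: sin_ge0_pi; apply/andP; split; lra.
    rewrite (_ : _ `&` _ = set0) ?measure0//; apply/seteqP; split => // h [_ [_ /=]].
    by rewrite E2; have := l0 h; nra.
  move: tI; rewrite inE/= in_itv/= => /andP[t0' tpi].
  have st : 0 < sin t by apply: sin_gt0_pi; rewrite t0' tpi.
  rewrite (_ : _ `&` _ = `]1 - r ^+ 2 / 2, 1[%classic); last first.
    apply/seteqP; split => h /=; rewrite !in_itv/= half_ballE//.
      move=> [hI]; rewrite /= capE// E//= E2 => -[h1 h2].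
      have hn1 : h != 1.
        by apply/eqP => h1'; move: h2; rewrite /lat h1' expr1n subrr sqrtr0 mul0r ltxx.
      by move: hI => /andP[h3 h4]; apply/andP; split; [lra|rewrite lt_neqAle hn1].
    move=> /andP[h1 h2]; have hI : -1 <= h <= 1 by apply/andP; split; lra.
    split => //; split; rewrite /= ?capE// ?E//; first by lra.
    by rewrite E2 mulr_gt0// /lat sqrtr_gt0; nra.
  apply: etrans (@lebesgue_measure_itv R `]1 - r ^+ 2 / 2, 1[) _.
  rewrite /= lte_fin ifT; last by lra.
  by rewrite -EFinB; congr (_%:E); lra.
rewrite -integral_mkcondr (_ : _ `&` _ = `]0%R, pi[%classic); last first.
  apply/seteqP; split => [t []//|t]; rewrite /= !in_itv/= => /andP[t0 tp].
  by split; apply/andP; split; lra.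
rewrite integral_cst//= (_ : lebesgue_measure _ = pi%:E); last first.
  apply: etrans (@lebesgue_measure_itv R `]0, pi[) _.
  by rewrite /= lte_fin pi0 -EFinB subr0.
by rewrite -EFinM mulrC.
Qed.

Variable th0 : R.
Hypothesis th0I : 0 < th0 < pi / 2.

(** A small cap about a point of $\Omega$ does not reach the cone. *)
Lemma half_ball_Omega_area (x e : V) (r : R) : Omega th0 x -> dotp e x = 0 ->
  enorm e = 1 -> 0 < r <= 1 -> r <= cos th0 - x 0 0 ->
  hausdorff2 (Omega th0 `&` half_ball x e r) = (pi * (r ^+ 2 / 2))%:E.
Proof.
move=> Ox ex e1 rI rc; have sx := Omega_sphere Ox; have /andP[r0 _] := rI.
rewrite (_ : _ `&` _ = half_ball x e r `&` sphere); last first.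
  rewrite (OmegaE th0I); apply/seteqP; split => y [].
    by move=> [sy _] hy; split.
  rewrite half_ballE// => -[cy hy] sy; split; last by split.
  split => //=; move: cy; rewrite capE// => cy.
  have h : (y 0 0 - x 0 0) ^+ 2 < r ^+ 2.
    move: cy; rewrite dotpE !mxE.
    have := sqr_ge0 (y 0 1 - x 0 1); have := sqr_ge0 (y 0 2%:R - x 0 2%:R).
    by rewrite !expr2; lra.
  by nra.
have mh := measurable_half_ball x e r0.
apply: etrans (hausdorff_sphereE mh) _; apply: half_cap_area => //.
- by rewrite -sphereE.
- by move: e1; rewrite -[enorm e = 1]/(sphere e) sphereE.
- by rewrite dotpC.
Qed.

(** The mean in the definition of the limit is constantly $\frac\pi2|c-a|$ for
    small radii. *)
Lemma one_sided_limit_constant (x e : V) (rho : V -> R) (c a : R) :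
  measurable_fun setT rho -> ae_eq hausdorff2 (Omega th0) (EFin \o rho) (EFin \o (fun=> c)) ->
  Omega th0 x -> dotp e x = 0 -> enorm e = 1 ->
  one_sided_limit th0 x e rho a -> a = c.
Proof.
move=> mr rc Ox ex e1 lim; apply/eqP; apply: contraT => nac; exfalso.
pose k := `|c - a|; have k0 : 0 < k by rewrite normr_gt0 subr_eq0 eq_sym.
have xc : 0 < cos th0 - x 0 0.
  by move: Ox; rewrite (OmegaE th0I) => -[_ /= h]; lra.
have mO := measurable_Omega th0I.
have val (r : R) : 0 < r <= 1 -> r <= cos th0 - x 0 0 ->
    ((r ^- 2)%:E * \int[hausdorff2]_(y in Omega th0 `&` half_ball x e r)
     `|rho y - a|%:E)%E = (k * (pi / 2))%:E.
  move=> rI rle; have /andP[r0 _] := rI.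
  have mh : measurable (Omega th0 `&` half_ball x e r).
    by apply: measurableI => //; exact: measurable_half_ball.
  rewrite (ae_eq_integral (fun=> k%:E))//.
  - rewrite integral_cst//.
    have E := half_ball_Omega_area Ox ex e1 rI rle.
    apply: etrans (congr1 (fun z => (r ^- 2)%:E * (k%:E * z))%E E) _.
    by rewrite -!EFinM; congr (_%:E); field; rewrite gt_eqF.
  - apply/measurable_EFinP; apply: measurableT_comp => //; apply: measurable_funB.
      exact: measurable_funTS.
    exact: measurable_cst.
  - apply: filterS rc => y h [Oy _]; have := h Oy; rewrite /= => -[->].
    by [].
have c0 : 0 < k * (pi / 4) by rewrite mulr_gt0// divr_gt0.
have nb : nbhs (0%E : \bar R) [set y | (y < (k * (pi / 4))%:E)%E].
  by apply: open_nbhs_nbhs; split; [exact: open_ereal_lt_ereal|rewrite /= lte_fin].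
have ev : \forall r \near (0 : R)^'+, ((r ^- 2)%:E * \int[hausdorff2]_(y in Omega th0 `&` half_ball x e r)
     `|rho y - a|%:E < (k * (pi / 4))%:E)%E by exact: (lim _ nb).
pose d := Num.min 1 (cos th0 - x 0 0).
have d0 : 0 < d by rewrite lt_min ltr01.
have ev2 : \forall r \near (0 : R)^'+, 0 < r by exact: nbhs_right_gt.
have ev3 : \forall r \near (0 : R)^'+, r < d by exact: nbhs_right_lt.
have /filter_ex[r [[h1 h2] h3]] : \forall r \near (0 : R)^'+,
    ((((r ^- 2)%:E * \int[hausdorff2]_(y in Omega th0 `&` half_ball x e r)
     `|rho y - a|%:E < (k * (pi / 4))%:E)%E /\ 0 < r) /\ r < d).
  by apply: filterI => //; exact: filterI.
move: h3; rewrite lt_min => /andP[h3 h4]; move: h1; rewrite val ?h2 ?ltW// lte_fin.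
by have := pi0; nra.
Qed.

(** Two functions with the same integral over every Borel subset of $\Omega$
    agree almost everywhere there. *)
Lemma density_on_Omega (mu : {finite_measure set V -> \bar R}) (f : V -> R) (c : R) :
  (forall A, measurable A -> A `<=` Omega th0 -> mu A = (c%:E * hausdorff2 A)%E) ->
  hausdorff_density th0 mu f ->
  ae_eq hausdorff2 (Omega th0) (EFin \o f) (EFin \o (fun=> c)).
Proof.
move=> muE [mf f0 fE]; have mO := measurable_Omega th0I.
have OD : Omega th0 `<=` (clOmega th0 : set V) by exact: subset_closure.
apply/ae_eq_sym; apply: integral_ae_eq => //.
- apply: (bounded_integrable (M := `|c|)) => //; first exact: hausdorff_Omega_fin.
- exact/measurable_EFinP/measurable_funTS.
- move=> A AO mA; rewrite -[A in RHS](setIidl (subset_trans AO OD)) -fE// muE//.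
  by rewrite integral_cst.
Qed.

End upstream_state.

(** * The Radon measure solution *)

Section assembly_tools.
Context {R : realType}.
Notation V := 'rV[R]_3.

Lemma ae_forall3 (mu : {measure set V -> \bar R}) (P : 'I_3 -> V -> Prop) :
  (forall i, {ae mu, forall x, P i x}) -> {ae mu, forall x, forall i, P i x}.
Proof.
move=> h; move: (h 0) (h 1) (h 2%:R); apply: filterS3 => x h0 h1 h2.
by elim/ord3P.
Qed.

(** Used for the energy, whose densities are $E_0$ times those of the mass on
    the closure of $\Omega$. *)
Lemma cintegral_scale (mu : {finite_measure set V -> \bar R}) (D : set V)
    (f g : V -> R) (k M N : R) (mf : measurable_fun setT f) (fM : forall x, `|f x| <= M)
    (mg : measurable_fun setT g) (gN : forall x, `|g x| <= N) (G : V -> R) (B : R) :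
  measurable D -> (forall x, D x -> g x = k * f x) ->
  measurable_fun D G -> (forall x, D x -> `|G x| <= B) ->
  cintegral (density_charge mu mg gN) D G = k * cintegral (density_charge mu mf fM) D G.
Proof.
move=> mD gf mG GB.
rewrite (cintegral_density_charge mu mg gN mD mG GB) (cintegral_density_charge mu mf fM mD mG GB).
rewrite -RintegralZl//.
  by apply: eq_Rintegral => x; rewrite inE => Dx; rewrite gf// mulrA.
apply: (@finite_integrable R mu D _ (M * B)) => //.
  by apply: measurable_funM => //; exact: measurable_funTS.
by move=> x Dx; rewrite normrM ler_pM// GB.
Qed.

End assembly_tools.

Theorem theorem2p1 (R : realType) (th0 alpha0 E0 : R) (ptilde : R -> R -> R)
    (wrho ut w : R -> R)
    (Hth0 : 0 < th0 < pi / 2) (HE0 : 1 / 2 <= E0)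
    (Hp0 : 0 <= ptilde rho0 E0)
    (Hperiodic : [/\ periodic wrho (C_length th0), periodic ut (C_length th0)
                   & periodic w (C_length th0)])
    (Hcontinuous : [/\ continuous wrho, continuous ut & continuous w])
    (Hwrho : forall s, 0 <= wrho s)
    (Hderivable : forall s,
       [/\ derivable (fun r => wrho r * ut r ^+ 2) s 1,
           derivable (fun r => wrho r * ut r * w r) s 1
         & derivable (fun r => wrho r * ut r) s 1])
    (Heq1 : forall s,
       derive1 (fun r => wrho r * ut r ^+ 2) s + 3 * wrho s * ut s * w s =
       rho0 * dotp (u0 alpha0 (C_point th0 s)) (C_normal th0 s) *
         dotp (u0 alpha0 (C_point th0 s)) (C_tangent th0 s))
    (Heq2 : forall s,
       derive1 (fun r => wrho r * ut r * w r) s - wrho s * ut s ^+ 2 +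
         2 * wrho s * w s ^+ 2 =
       rho0 * w0 alpha0 (C_point th0 s) *
         dotp (u0 alpha0 (C_point th0 s)) (C_normal th0 s))
    (Heq3 : forall s,
       derive1 (fun r => wrho r * ut r) s + 2 * wrho s * w s =
       rho0 * dotp (u0 alpha0 (C_point th0 s)) (C_normal th0 s))
    (HWC : forall s, 0 < WC_sol th0 alpha0 E0 ptilde wrho ut s) :
  exists varrho wp : {finite_measure set 'rV[R]_3 -> \bar R},
    [/\ forall A, measurable A ->
          varrho A = (rho0%:E * hausdorff2 (A `&` Omega th0) +
                      dirac_C th0 wrho A)%E,
        forall A, measurable A ->
          wp A = ((ptilde rho0 E0)%:E * hausdorff2 (A `&` clOmega th0))%E
      & radon_measure_solution th0 ptilde varrho
          (u_sol th0 alpha0 ut) (w_sol th0 alpha0 w) (E_sol th0 E0)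
          wp (WC_sol th0 alpha0 E0 ptilde wrho ut)].
Proof.
have [pW put pw] := Hperiodic; have [cW cut cw] := Hcontinuous.
set L := C_length th0.
have L0 : 0 <= L by exact: ltW (C_length_gt0 Hth0).
have mD : measurable (clOmega th0 : set 'rV[R]_3) by exact: measurable_clOmega.
have OD : Omega th0 `<=` (clOmega th0 : set 'rV[R]_3) by exact: subset_closure.
pose p0 := ptilde rho0 E0.
have zE (k : R) (a : 'rV[R]_3) i : (k *: a) 0 i = k * a 0 i by rewrite mxE.
pose varrho := cone_measure Hth0 cW Hwrho.
pose wp := pressure_measure Hth0 Hp0.
have dmass (s : R) : is_derive s 1 (fun r => wrho r * ut r)
    (dotp (u0 alpha0 (C_point th0 s)) (C_normal th0 s) - 2 * wrho s * w s).
  apply: DeriveDef; first by have [] := Hderivable s.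
  by rewrite -derive1E -[LHS](addrK (2 * wrho s * w s)) Heq3 /rho0 mul1r.
have dradial (s : R) : is_derive s 1 (fun r => wrho r * ut r * w r)
    (w0 alpha0 (C_point th0 s) * dotp (u0 alpha0 (C_point th0 s)) (C_normal th0 s) +
     wrho s * ut s ^+ 2 - 2 * wrho s * w s ^+ 2).
  apply: DeriveDef; first by have [] := Hderivable s.
  rewrite -derive1E -[X in X * dotp _ _]mul1r -[1 * _]/(rho0 * _) -Heq2.
  by ring.
have dmomentum (s : R) : is_derive s 1 (fun r => wrho r * ut r ^+ 2)
    (dotp (u0 alpha0 (C_point th0 s)) (C_normal th0 s) *
     dotp (u0 alpha0 (C_point th0 s)) (C_tangent th0 s) - 3 * wrho s * ut s * w s).
  apply: DeriveDef; first by have [] := Hderivable s.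
  by rewrite -derive1E -[LHS](addrK (3 * wrho s * ut s * w s)) Heq1 /rho0 mul1r.
exists varrho, wp; split.
- by move=> A _; rewrite /rho0 mul1e; exact: cone_measureE.
- by [].
pose u := u_sol th0 alpha0 ut; pose wf := w_sol th0 alpha0 w; pose E := E_sol th0 E0.
have mu := measurable_u_sol alpha0 Hth0 cut.
have mw := measurable_w_sol alpha0 Hth0 cw.
have mE := measurable_E_sol Hth0 E0.
have [Mu uM] := u_sol_bounded alpha0 Hth0 cut.
have [Mw wM] := w_sol_bounded alpha0 Hth0 cw.
have EM := E_sol_bounded Hth0 E0.
have uO x : Omega th0 x -> u x = u0 alpha0 x by exact: u_sol_Omega.
have wO x : Omega th0 x -> wf x = w0 alpha0 x by exact: w_sol_Omega.
have uC s : 0 <= s <= L -> u (C_point th0 s) = ut s *: C_tangent th0 s by exact: u_sol_C.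
have wC s : 0 <= s <= L -> wf (C_point th0 s) = w s by exact: w_sol_C.
have mEu i : measurable_fun setT (fun x => E x * u x 0 i) by exact: measurable_funM.
have mwu i : measurable_fun setT (fun x => wf x * u x 0 i) by exact: measurable_funM.
have muu i j : measurable_fun setT (fun x => u x 0 i * u x 0 j) by exact: measurable_funM.
have mEw : measurable_fun setT (fun x => E x * wf x) by exact: measurable_funM.
have mww : measurable_fun setT (fun x => wf x * wf x) by exact: measurable_funM.
have mdu : measurable_fun setT (fun x => dotp (u x) (u x)).
  by apply: measurable_dotp; apply: measurable_fun_coordV.
have EuM i x : `|E x * u x 0 i| <= `|E0| * Mu by rewrite normrM ler_pM.
have wuM i x : `|wf x * u x 0 i| <= Mw * Mu by rewrite normrM ler_pM.
have uuM i j x : `|u x 0 i * u x 0 j| <= Mu * Mu by rewrite normrM ler_pM.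
have EwM x : `|E x * wf x| <= `|E0| * Mw by rewrite normrM ler_pM.
have wwM x : `|wf x * wf x| <= Mw * Mw by rewrite normrM ler_pM.
have duM x : `|dotp (u x) (u x)| <= 3 * Mu * Mu by exact: dotp_bound.
pose ma i := density_charge varrho (mu i) (fun x => uM x i).
pose me i := density_charge varrho (mEu i) (EuM i).
pose mr i := density_charge varrho (mwu i) (wuM i).
pose mt i j := density_charge varrho (muu i j) (uuM i j).
pose na := density_charge varrho mw wM.
pose ne := density_charge varrho mEw EwM.
pose nr := density_charge varrho mww wwM.
pose nt := density_charge varrho mdu duM.
have cu0 := @sphere_continuous_u0 R alpha0.
have cw0 := @sphere_continuous_w0 R alpha0.
have cwu0 i : sphere_continuous (fun x : 'rV[R]_3 => (w0 alpha0 x *: u0 alpha0 x) 0 i).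
  rewrite (_ : (fun _ => _) = (fun x => w0 alpha0 x * u0 alpha0 x 0 i)); first exact: sphere_continuousM.
  by apply/funext => s; rewrite mxE.
have cut' i : continuous (fun s => (ut s *: C_tangent th0 s) 0 i).
  rewrite (_ : (fun _ => _) = (fun s => ut s * C_tangent th0 s 0 i)).
    by apply: contM => //; exact: continuous_C_tangent.
  by apply/funext => s; rewrite mxE.
have cwut i : continuous (fun s => ((w s * ut s) *: C_tangent th0 s) 0 i).
  rewrite (_ : (fun _ => _) = (fun s => w s * ut s * C_tangent th0 s 0 i)).
    by apply: contM; [exact: contM|exact: continuous_C_tangent].
  by apply/funext => s; rewrite mxE.
have massE psi : sphere_C1 psi ->
    cintegral_vec ma (clOmega th0) (sphere_grad psi) = 2 * cintegral na (clOmega th0) psi.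
  move=> psiC1; have cg i := sphere_continuous_grad i psiC1.
  rewrite /ma (@cintegral_vec_pairing R th0 wrho Hth0 cW Hwrho (fun i x => u x 0 i) (u0 alpha0)
    (fun s => ut s *: C_tangent th0 s) Mu mu (fun i x => uM x i) (sphere_grad psi))//.
  - rewrite /na (@cintegral_pairing R th0 wrho Hth0 cW Hwrho wf (w0 alpha0) w Mw mw wM psi)//.
      exact: (@mass_balance R th0 alpha0 wrho ut w Hth0).
    exact: sphere_continuous_C1.
  - by move=> i x Ox; rewrite uO.
  - by move=> i s sI; rewrite uC.
have energyE psi : sphere_C1 psi ->
    cintegral_vec me (clOmega th0) (sphere_grad psi) = 2 * cintegral ne (clOmega th0) psi.
  move=> psiC1; have cg i := sphere_continuous_grad i psiC1.
  have cp := sphere_continuous_C1 psiC1.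
  have EE x : clOmega th0 x -> E x = E0 by exact: E_sol_closure.
  have -> : cintegral ne (clOmega th0) psi = E0 * cintegral na (clOmega th0) psi.
    have [B pB] := sphere_continuous_bounded Hth0 cp.
    apply: (@cintegral_scale _ varrho _ _ _ _ _ _ mw wM mEw EwM psi B) => //.
      by move=> x Dx; rewrite EE.
    exact: sphere_continuous_measurable.
  have -> : cintegral_vec me (clOmega th0) (sphere_grad psi) =
      E0 * cintegral_vec ma (clOmega th0) (sphere_grad psi).
    rewrite /cintegral_vec mulr_sumr; apply: eq_bigr => i _.
    have [B pB] := sphere_continuous_bounded Hth0 (cg i).
    apply: (@cintegral_scale _ varrho _ _ _ _ _ _ (mu i) (fun x => uM x i) (mEu i) (EuM i) _ B) => //.
      by move=> x Dx; rewrite EE.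
    exact: (sphere_continuous_measurable Hth0 (cg i)).
  by rewrite massE// mulrCA.
have radialE psi : sphere_C1 psi ->
    cintegral_vec mr (clOmega th0) (sphere_grad psi) =
    2 * cintegral nr (clOmega th0) psi - cintegral nt (clOmega th0) psi.
  move=> psiC1; have cg i := sphere_continuous_grad i psiC1.
  have cp := sphere_continuous_C1 psiC1.
  rewrite /mr (@cintegral_vec_pairing R th0 wrho Hth0 cW Hwrho (fun i x => wf x * u x 0 i)
    (fun x => w0 alpha0 x *: u0 alpha0 x) (fun s => (w s * ut s) *: C_tangent th0 s) _ mwu wuM
    (sphere_grad psi))//; last 2 first.
  - by move=> i x Ox; rewrite uO// wO// zE.
  - by move=> i s sI; rewrite uC// wC// !zE mulrA.
  rewrite /nr (@cintegral_pairing R th0 wrho Hth0 cW Hwrho _ (fun x => w0 alpha0 x * w0 alpha0 x)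
    (fun s => w s * w s) _ mww wwM psi)//; last 2 first.
  - by move=> x Ox; rewrite wO.
  - by move=> s sI; rewrite wC.
  rewrite /nt (@cintegral_pairing R th0 wrho Hth0 cW Hwrho _ (fun x => dotp (u0 alpha0 x) (u0 alpha0 x))
    (fun s => ut s ^+ 2) _ mdu duM psi)//; last 2 first.
  - by move=> x Ox; rewrite uO.
  - by move=> s sI; rewrite uC// dotpZl dotpZr dotp_tangent_tangent// mulr1 -expr2.
  exact: (@radial_balance R th0 alpha0 wrho ut w Hth0).
have WCE s : WC_sol th0 alpha0 E0 ptilde wrho ut s = wrho s * ut s ^+ 2 *
    dotp (C_tangent th0 s) (C_Dt_normal th0 s) +
    dotp (u0 alpha0 (C_point th0 s)) (C_normal th0 s) ^+ 2 + p0.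
  by rewrite /WC_sol {1}/rho0 mul1r.
have momentumE v : sphere_C1_field v ->
    cintegral_mx mt (clOmega th0) (sphere_Dmx v) + \int[wp]_(x in clOmega th0) sphere_div v x =
    3 * cintegral_vec mr (clOmega th0) v +
    \int[lebesgue_measure]_(s in `[0, L])
      (WC_sol th0 alpha0 E0 ptilde wrho ut s * dotp (C_normal th0 s) (v (C_point th0 s))).
  move=> vC1; have cv i := sphere_continuous_C1 (sphere_C1_coord vC1 i).
  have cD i j := sphere_continuous_Dmx i j vC1.
  have cdiv : sphere_continuous (sphere_div v).
    rewrite (_ : sphere_div v = (fun x => sphere_Dmx v x 0 0 + sphere_Dmx v x 1 1 +
      sphere_Dmx v x 2%:R 2%:R)).
      by apply: sphere_continuousD => //; exact: sphere_continuousD.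
    by apply/funext => x; rewrite /sphere_div /mxtrace sum3E.
  have [B dB] := sphere_continuous_bounded Hth0 cdiv.
  rewrite /wp (@integral_pressure_measure R th0 p0 Hth0 Hp0 _ B
    (sphere_continuous_measurable Hth0 cdiv) dB).
  rewrite /mt (@cintegral_mx_pairing R th0 wrho Hth0 cW Hwrho (fun i j x => u x 0 i * u x 0 j)
    (u0 alpha0) (fun s => ut s *: C_tangent th0 s) _ muu uuM (sphere_Dmx v))//; last 2 first.
  - by move=> i j x Ox; rewrite uO.
  - by move=> i j s sI; rewrite uC.
  rewrite /mr (@cintegral_vec_pairing R th0 wrho Hth0 cW Hwrho (fun i x => wf x * u x 0 i)
    (fun x => w0 alpha0 x *: u0 alpha0 x) (fun s => (w s * ut s) *: C_tangent th0 s) _ mwu wuM v)//; last 2 first.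
  - by move=> i x Ox; rewrite uO// wO// zE.
  - by move=> i s sI; rewrite uC// wC// !zE mulrA.
  rewrite (@momentum_balance R th0 alpha0 wrho ut w Hth0 cW cut cw pW put dmomentum p0 v vC1).
  by congr (_ + _); apply: eq_Rintegral => s _; rewrite WCE.
(* The conditions on the Radon-Nikodym derivatives force these densities. *)
exists ma, me, mr, mt, na, ne, nr, nt; split.
- exact: cone_measure_closure.
- split=> [s _|]; first exact: HWC.
  apply: continuous_integrable => //.
  rewrite (_ : WC_sol _ _ _ _ _ _ = (fun s => wrho s * ut s ^+ 2 *
    dotp (C_tangent th0 s) (C_Dt_normal th0 s) +
    dotp (u0 alpha0 (C_point th0 s)) (C_normal th0 s) ^+ 2 + p0)); last exact/funext.
  exact: continuous_pressure.
- by split.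
- split.
  + split.
    * by move=> i; split; exact: density_charge_dominates.
    * by move=> i j; exact: density_charge_dominates.
    * by split; exact: density_charge_dominates.
    * apply/null_content_dominatesP => A mA vA.
      have H0 : hausdorff2 (A `&` Omega th0) = 0%E.
        have d0 : (0 <= dirac_C th0 wrho A)%E.
          by apply: integral_ge0 => s _; rewrite lee_fin.
        have vE : (hausdorff2 (A `&` Omega th0) + dirac_C th0 wrho A = 0)%E.
          exact: etrans (esym (cone_measureE Hth0 cW Hwrho A)) vA.
        have := leeDl (hausdorff2 (A `&` Omega th0)) d0; rewrite vE => le0.
        by apply/eqP; rewrite eq_le le0 /=; exact: measure_ge0.
      apply: etrans (pressure_measureE Hth0 Hp0 A) _.
      apply: etrans (congr1 (fun z => (p0%:E * z)%E) (etrans (hausdorff_clOmegaE Hth0 mA) H0)) _.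
      by rewrite mule0.
  + split => //; apply: aeW => x; exact: u_sol_tangent.
  + have h1 := ae_forall3 (fun i => RNd_density_charge varrho (mu i) (fun x => uM x i)).
    have h2 := ae_forall3 (fun i => RNd_density_charge varrho (mwu i) (wuM i)).
    have h3 := RNd_density_charge varrho mw wM.
    have h4 := RNd_density_charge varrho mww wwM.
    have h34 : {ae varrho, forall x, RNd na varrho x = wf x /\ RNd nr varrho x = wf x * wf x}.
      by move: h3 h4; apply: filterS2.
    move: h1 h2 h34; apply: filterS3 => x a b [c d]; split => //.
    * by move=> i; rewrite a b.
    * by rewrite c d.
  + have h1 := ae_forall3 (fun i => RNd_density_charge varrho (mu i) (fun x => uM x i)).
    have h2 := ae_forall3 (fun i => RNd_density_charge varrho (mEu i) (EuM i)).
    have h3 := RNd_density_charge varrho mw wM.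
    have h4 := RNd_density_charge varrho mEw EwM.
    have h34 : {ae varrho, forall x, RNd na varrho x = wf x /\ RNd ne varrho x = E x * wf x}.
      by move: h3 h4; apply: filterS2.
    move: h1 h2 h34; apply: filterS3 => x a b [c d]; split => //.
    * by move=> i; rewrite a b.
    * by rewrite c d.
  + have h1 := ae_forall3 (fun i => RNd_density_charge varrho (mu i) (fun x => uM x i)).
    have h2 := ae_forall3 (fun i => ae_forall3 (fun j => RNd_density_charge varrho (muu i j) (uuM i j))).
    have h3 := RNd_density_charge varrho mdu duM.
    by move: h1 h2 h3; apply: filterS3 => x a b c; split.
move=> _ _ rho p hrho hp.
have CO s : ~ Omega th0 (C_point th0 s).
  move=> Os; have : (Omega th0 `&` C_curve th0) (C_point th0 s).
    by split => //; exact: C_point_curve.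
  by rewrite Omega_C_disj.
(* The circle has no area: the two densities are tested inside Omega. *)
have rho1 : ae_eq hausdorff2 (Omega th0) (EFin \o rho) (EFin \o (fun=> 1)).
  apply: (density_on_Omega Hth0 _ hrho) => A mA AO.
  apply: etrans (cone_measureE Hth0 cW Hwrho A) _.
  rewrite mul1e (setIidl AO) /dirac_C [X in integral _ X _](_ : _ = set0) ?integral_set0 ?adde0//.
  by apply/seteqP; split => // s [_ /AO /CO].
have p1 : ae_eq hausdorff2 (Omega th0) (EFin \o p) (EFin \o (fun=> p0)).
  apply: (density_on_Omega Hth0 _ hp) => A mA AO.
  by apply: etrans (pressure_measureE Hth0 Hp0 A) _; rewrite (setIidl (subset_trans AO OD)).
split.
  have nC : {ae hausdorff2, forall x : 'rV[R]_3, ~ C_curve th0 x}.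
    exists (C_curve th0); split; [exact: measurable_C_curve|exact: hausdorff_C_curve|].
    by move=> x /= /contrapT.
  move: rho1 p1 nC; apply: filterS3 => x hr hq nCx Dx.
  have Ox : Omega th0 x by move: (Dx); rewrite (clOmega_split Hth0) => -[].
  have [r1] := hr Ox; have [q1] := hq Ox.
  by rewrite (E_sol_closure Hth0)// r1 q1.
have mrho : measurable_fun setT rho by case: hrho.
move=> x e r1 r2 b1 b2 c1 c2 a1 a2 Ox ex e1 [l1 _ _ _] [l2 _ _ _] _ _.
have -> : r1 = 1.
  apply: (one_sided_limit_constant Hth0 mrho rho1 Ox _ _ l1); last by rewrite enormN.
  by rewrite dotpC dotpNr dotpC ex oppr0.
by rewrite (one_sided_limit_constant Hth0 mrho rho1 Ox ex e1 l2).
Qed.
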